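(* Consider the nonlinear program: minimize $\varphi_0(x)$ subject to $\varphi_i(x)\le0$ for $i=1,\ldots,s$ and $\varphi_i(x)=0$ for $i=s+1,\ldots,m$, where $\varphi_0,\ldots,\varphi_m:\mathbb{R}^n\to\mathbb{R}$ are $\mathcal{C}^2$-smooth functions around the reference point. Let $\bar x$ be a feasible solution satisfying the first-order (KKT) condition $$\nabla_xL(\bar x,\bar y)=0\quad\text{and}\quad\langle\bar y,g(\bar x)\rangle=0\quad\text{for some }\bar y\in\mathbb{R}^s_+\times\mathbb{R}^{m-s},$$ and suppose that LICQ holds at $\bar x$, i.e. the vectors $\nabla\varphi_i(\bar x)$, $i\in I(\bar x)\cup\{s+1,\ldots,m\}$, are linearly independent. Then: (i) The variational sufficiency for local optimality holds at $\bar x$ if and only if there exist neighborhoods $U$ of $\bar x$ and $V$ of $0$ such that $$\langle\nabla^2_{xx}L(x,y)w,w\rangle\ge0\quad\text{whenever } x\in U,\ v\in V,\ y\in\Lambda(x,v),\ w\in S(x,y),$$ where, for $(x,v)$ near $(\bar x,0)$ with $\Lambda(x,v)\neq\emptyset$, the multiplier $y\in\Lambda(x,v)$ is unique. (ii) For $\sigma>0$, the strong variational sufficiency for local optimality holds at $\bar x$ with modulus $\sigma$ if and only if there exist neighborhoods $U$ of $\bar x$ and $V$ of $0$ such that $$\langle\nabla^2_{xx}L(x,y)w,w\rangle\ge\sigma\|w\|^2\quad\text{whenever } x\in U,\ v\in V,\ y\in\Lambda(x,v),\ w\in S(x,y),$$ with the unique multiplier $y$ as in (i). (iii) The strong variational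 sufficiency for local optimality holds at $\bar x$ (with some modulus) if and only if $$\langle\nabla^2_{xx}L(\bar x,\bar y)w,w\rangle>0\quad\text{whenever } \bar y\in\Lambda(\bar x,0)\ \text{and}\ w\in S(\bar x,\bar y)\setminus\{0\},$$ where $\bar y$ is the unique solution of the KKT system above.
   Context: Notation: $g:=(\varphi_1,\ldots,\varphi_m)$; $\Omega:=\{u\in\mathbb{R}^m\mid u_i\le0\ (i\le s),\ u_i=0\ (i>s)\}$; the program is identified with the unconstrained minimization of $\varphi:=\varphi_0+\delta_\Omega\circ g$, where $\delta_\Omega$ is the indicator function ($0$ on $\Omega$, $\infty$ off $\Omega$). The Lagrangian is $L(x,y):=\varphi_0(x)+\langle y,g(x)\rangle$. Active indices: $I(x):=\{i\in\{1,\ldots,s\}\mid\varphi_i(x)=0\}$, $I_+(x,y):=\{i\in I(x)\mid y_i>0\}$. Subspace: $S(x,y):=\{w\in\mathbb{R}^n\mid\langle\nabla\varphi_i(x),w\rangle=0\text{ for }i\in I_+(x,y)\cup\{s+1,\ldots,m\}\}$. Multipliers: for feasible $x$ (i.e. $g(x)\in\Omega$), $\Lambda(x,v):=\{y\in\mathbb{R}^s_+\times\mathbb{R}^{m-s}\mid v=\nabla_xL(x,y),\ \langle y,g(x)\rangle=0\}$, and $\Lambda(x,v):=\emptyset$ for infeasible $x$. Subdifferentials: for $\varphi:\mathbb{R}^n\to(-\infty,\infty]$ and $\bar x$ with $\varphi(\bar x)<\infty$, $$\widehat\partial\varphi(\bar x)=\Big\{v\;\Big|\;\liminf_{x\to\bar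 x}\frac{\varphi(x)-\varphi(\bar x)-\langle v,x-\bar x\rangle}{\|x-\bar x\|}\ge 0\Big\},$$ and $\partial\varphi(\bar x)$ is the set of all $v$ for which there are $x_k\to\bar x$ with $\varphi(x_k)\to\varphi(\bar x)$ and $v_k\in\widehat\partial\varphi(x_k)$ with $v_k\to v$. Variational convexity: a lower semicontinuous (l.s.c.) function $\varphi$ is variationally convex at $\bar x$ for $\bar v\in\partial\varphi(\bar x)$ if for some convex neighborhood $U\times V$ of $(\bar x,\bar v)$ there exist an l.s.c. convex function $\theta\le\varphi$ on $U$ and $\epsilon>0$ such that $(U_\epsilon\times V)\cap\operatorname{gph}\partial\varphi=(U\times V)\cap\operatorname{gph}\partial\theta$ and $\varphi(x)=\theta(x)$ at the common elements $(x,v)$, where $U_\epsilon:=\{x\in U\mid\varphi(x)<\varphi(\bar x)+\epsilon\}$. It is variationally strongly convex with modulus $\sigma>0$ if this holds with $\theta-\frac\sigma2\|\cdot\|^2$ convex on $U$. Variational sufficiency for local optimality holds at $\bar x$ if $\varphi=\varphi_0+\delta_\Omega\circ g$ is variationally convex at $\bar x$ for $0\in\partial\varphi(\bar x)$; strong variational sufficiency holds at $\bar x$ with modulus $\sigma$ if $\varphi$ is variationally strongly convex at $\bar x$ for $0$ with modulus $\sigma$. *)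

(* Defs.v *)
From HB Require Import structures.
From mathcomp Require Import all_boot all_order all_algebra.
From mathcomp Require Import all_classical all_reals all_analysis.

Set Implicit Arguments.
Unset Strict Implicit.
Unset Printing Implicit Defensive.

Import Order.TTheory GRing.Theory Num.Theory.
Import numFieldNormedType.Exports.

Local Open Scope classical_set_scope.
Local Open Scope ring_scope.

(* The library norm on 'rV[R]_n is the maximum norm. It is used only through
   the topology it induces; every metric quantity is Euclidean. *)
Definition dot (R : realType) (n : nat) (u v : 'rV[R]_n) : R :=
  \sum_(i < n) u 0 i * v 0 i.

Definition enorm (R : realType) (n : nat) (u : 'rV[R]_n) : R :=
  Num.sqrt (dot u u).

Definition grad (R : realType) (n : nat) (f : 'rV[R]_n -> R) (x : 'rV[R]_n)
    : 'rV[R]_n :=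
  \row_i 'D_(delta_mx 0 i) f x.

Definition hess (R : realType) (n : nat) (f : 'rV[R]_n -> R) (x : 'rV[R]_n)
    : 'M[R]_n :=
  'J (grad f) x.

Definition C2_around (R : realType) (n : nat) (f : 'rV[R]_n -> R)
    (xbar : 'rV[R]_n) : Prop :=
  \forall x \near xbar, [/\ differentiable f x, differentiable (grad f) x
    & {for x, continuous (hess f)}].

(* Extended-real-valued functions on R^n; values in (-oo, +oo] are ensured by
   an explicit hypothesis where a function is quantified. *)

Definition lsc_on (R : realType) (n : nat) (U : set 'rV[R]_n)
    (f : 'rV[R]_n -> \bar R) : Prop :=
  forall x, U x -> forall a : R, (a%:E < f x)%E ->
    \forall y \near x, U y -> (a%:E < f y)%E.

Definition convex_on (R : realType) (n : nat) (U : set 'rV[R]_n)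
    (f : 'rV[R]_n -> \bar R) : Prop :=
  forall x y (t : R), U x -> U y -> 0 < t < 1 ->
    (f ((1 - t) *: x + t *: y)%R <= (1 - t)%:E * f x + t%:E * f y)%E.

Definition regular_subdiff (R : realType) (n : nat) (f : 'rV[R]_n -> \bar R)
    (xbar : 'rV[R]_n) : set 'rV[R]_n :=
  [set v | f xbar \is a fin_num /\
    (0 <= limf_einf (fun x : 'rV[R]_n =>
            (f x - f xbar - (dot v (x - xbar))%:E)
              * ((enorm (x - xbar))^-1)%:E) (xbar^'))%E].

Definition subdiff (R : realType) (n : nat) (f : 'rV[R]_n -> \bar R)
    (xbar : 'rV[R]_n) : set 'rV[R]_n :=
  [set v | f xbar \is a fin_num /\
    exists (xk vk : nat -> 'rV[R]_n),
      [/\ xk @ \oo --> xbar, (f \o xk) @ \oo --> f xbar,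
          forall k, regular_subdiff f (xk k) (vk k) & vk @ \oo --> v]].

Definition gph (R : realType) (n : nat)
    (F : 'rV[R]_n -> set 'rV[R]_n) : set ('rV[R]_n * 'rV[R]_n) :=
  [set p | F p.1 p.2].

(* [theta], [U], [V], [e] are as in the definition of variational convexity of
   [f] at [xbar] for [vbar]. *)
Definition variational_convexity_data (R : realType) (n : nat)
    (f : 'rV[R]_n -> \bar R) (xbar vbar : 'rV[R]_n) (U V : set 'rV[R]_n)
    (theta : 'rV[R]_n -> \bar R) (e : R) : Prop :=
  let Ue := [set x | U x /\ (f x < f xbar + e%:E)%E] in
  [/\ [/\ nbhs xbar U, nbhs vbar V, convex_set U & convex_set V],
      [/\ forall x, (-oo < theta x)%E, lsc_on U theta, convex_on U theta
        & forall x, U x -> (theta x <= f x)%E],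
      0 < e,
      (Ue `*` V) `&` gph (subdiff f) = (U `*` V) `&` gph (subdiff theta)
    & forall p, ((Ue `*` V) `&` gph (subdiff f)) p -> f p.1 = theta p.1].

(* Lower semicontinuity of [f] is only required around [xbar]: the notion is
   local, and the problem data are controlled only there. *)
Definition variationally_convex (R : realType) (n : nat)
    (f : 'rV[R]_n -> \bar R) (xbar vbar : 'rV[R]_n) : Prop :=
  [/\ exists2 W, nbhs xbar W & lsc_on W f,
      subdiff f xbar vbar
    & exists U V theta e, variational_convexity_data f xbar vbar U V theta e].

Definition variationally_strongly_convex (R : realType) (n : nat)
    (f : 'rV[R]_n -> \bar R) (xbar vbar : 'rV[R]_n) (sigma : R) : Prop :=
  [/\ exists2 W, nbhs xbar W & lsc_on W f,
      subdiff f xbar vbar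
    & exists U V theta e, variational_convexity_data f xbar vbar U V theta e /\
        convex_on U (fun x => theta x - (sigma / 2 * enorm x ^+ 2)%:E)%E].

(* The program: minimize [phi0 x] subject to [phi i x <= 0] for [i < s] and
   [phi i x = 0] for [s <= i < m]. *)

Definition gmap (R : realType) (n m : nat) (phi : 'I_m -> 'rV[R]_n -> R)
    (x : 'rV[R]_n) : 'rV[R]_m :=
  \row_i phi i x.

Definition Omega (R : realType) (m s : nat) : set 'rV[R]_m :=
  [set u | (forall i : 'I_m, (i < s)%N -> u 0 i <= 0) /\
           (forall i : 'I_m, (s <= i)%N -> u 0 i = 0)].

Definition indicator_fun (R : realType) (m : nat) (A : set 'rV[R]_m)
    (u : 'rV[R]_m) : \bar R :=
  if u \in A then 0%E else +oo%E.

Definition essential_objective (R : realType) (n m s : nat)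
    (phi0 : 'rV[R]_n -> R) (phi : 'I_m -> 'rV[R]_n -> R)
    (x : 'rV[R]_n) : \bar R :=
  ((phi0 x)%:E + indicator_fun (@Omega R m s) (gmap phi x))%E.

Definition lagrangian (R : realType) (n m : nat)
    (phi0 : 'rV[R]_n -> R) (phi : 'I_m -> 'rV[R]_n -> R)
    (x : 'rV[R]_n) (y : 'rV[R]_m) : R :=
  phi0 x + dot y (gmap phi x).

Definition grad_L (R : realType) (n m : nat)
    (phi0 : 'rV[R]_n -> R) (phi : 'I_m -> 'rV[R]_n -> R)
    (x : 'rV[R]_n) (y : 'rV[R]_m) : 'rV[R]_n :=
  grad (fun x' => lagrangian phi0 phi x' y) x.

Definition hess_L (R : realType) (n m : nat)
    (phi0 : 'rV[R]_n -> R) (phi : 'I_m -> 'rV[R]_n -> R)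
    (x : 'rV[R]_n) (y : 'rV[R]_m) : 'M[R]_n :=
  hess (fun x' => lagrangian phi0 phi x' y) x.

Definition active (R : realType) (n m s : nat) (phi : 'I_m -> 'rV[R]_n -> R)
    (x : 'rV[R]_n) : {set 'I_m} :=
  [set i : 'I_m | (i < s)%N && (phi i x == 0)]%SET.

Definition active_pos (R : realType) (n m s : nat)
    (phi : 'I_m -> 'rV[R]_n -> R) (x : 'rV[R]_n) (y : 'rV[R]_m) :
    {set 'I_m} :=
  [set i in active s phi x | 0 < y 0 i]%SET.

Definition equality_idx (m s : nat) : {set 'I_m} :=
  [set i : 'I_m | (s <= i)%N]%SET.

Definition LICQ (R : realType) (n m s : nat) (phi : 'I_m -> 'rV[R]_n -> R)
    (x : 'rV[R]_n) : bool :=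
  free [seq grad (phi i) x
       | i <- enum (active s phi x :|: equality_idx m s)%SET].

Definition Ssub (R : realType) (n m s : nat) (phi : 'I_m -> 'rV[R]_n -> R)
    (x : 'rV[R]_n) (y : 'rV[R]_m) : set 'rV[R]_n :=
  [set w | forall i : 'I_m,
     i \in (active_pos s phi x y :|: equality_idx m s)%SET ->
     dot (grad (phi i) x) w = 0].

(* R^s_+ x R^(m-s) *)
Definition multiplier_cone (R : realType) (m s : nat) : set 'rV[R]_m :=
  [set y | forall i : 'I_m, (i < s)%N -> 0 <= y 0 i].

Definition feasible (R : realType) (n m s : nat)
    (phi : 'I_m -> 'rV[R]_n -> R) : set 'rV[R]_n :=
  [set x | @Omega R m s (gmap phi x)].

Definition Lambda (R : realType) (n m s : nat)
    (phi0 : 'rV[R]_n -> R) (phi : 'I_m -> 'rV[R]_n -> R)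
    (x v : 'rV[R]_n) : set 'rV[R]_m :=
  [set y | [/\ feasible s phi x, multiplier_cone s y,
               v = grad_L phi0 phi x y & dot y (gmap phi x) = 0]].

(* <H w, w> *)
Definition quad_form (R : realType) (n : nat) (H : 'M[R]_n) (w : 'rV[R]_n) : R :=
  dot (w *m H^T) w.

Definition variational_sufficiency (R : realType) (n m s : nat)
    (phi0 : 'rV[R]_n -> R) (phi : 'I_m -> 'rV[R]_n -> R)
    (xbar : 'rV[R]_n) : Prop :=
  variationally_convex (essential_objective s phi0 phi) xbar 0.

Definition strong_variational_sufficiency (R : realType) (n m s : nat)
    (phi0 : 'rV[R]_n -> R) (phi : 'I_m -> 'rV[R]_n -> R)
    (xbar : 'rV[R]_n) (sigma : R) : Prop :=
  variationally_strongly_convex (essential_objective s phi0 phi) xbar 0 sigma.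

(* Main.v *)
(* Near the reference point, LICQ identifies the graph of the subdifferential of
   [essential_objective] with the set [K] of pairs [(x, v)] for which
   [Lambda x v] is nonempty. Both the variational condition and the condition
   on [hess_L] turn out to be equivalent to the growth inequality
     phi0 x' >= phi0 x + <v, x' - x> + sigma / 2 |x' - x|^2
   for [(x, v)] in [K] near [(xbar, 0)] and [x'] feasible near [xbar].

   Growth gives variational convexity with [theta] the supremum of these
   quadratic minorants: a subgradient [v] of [theta] at [x] lies in [K] because
   the minimizer of [phi0 + |. - z|^2 / 2], [z = x + v], over the feasible set
   is a point of [K] with the same [z], and the subdifferential of [theta] is
   monotone. Conversely, subgradients of a strongly convex function satisfy the
   growth inequality.

   Growth gives the condition on [hess_L] by comparing two feasible curves
   leaving [x], second-order expansions being taken for the Lagrangian.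

   From the condition on [hess_L] at a single [(x, y)], penalizing the
   constraints with positive multipliers yields growth near [(x, v)] with any
   modulus [tau < sigma], but on a neighborhood depending on [(x, v)] and
   [tau]. To get a uniform neighborhood, [K] is parametrized by [z = x + v] (the
   proximal map is single valued and Lipschitz already by growth with modulus
   -1/2). Along a segment in [z] the Moreau envelope is locally supported by
   quadratics with curvature [tau / (1 + tau)], hence globally, and this is
   growth with modulus [tau] on a neighborhood independent of [tau]; let [tau]
   tend to [sigma]. *)
Require Import Defs.
From HB Require Import structures.
From mathcomp Require Import all_boot all_order all_algebra.
From mathcomp Require Import all_classical all_reals all_analysis.
From mathcomp Require Import ring lra.

Set Implicit Arguments.
Unset Strict Implicit.
Unset Printing Implicit Defensive.

Import Order.TTheory GRing.Theory Num.Theory.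
Import numFieldNormedType.Exports.

Local Open Scope classical_set_scope.
Local Open Scope ring_scope.

(** * Euclidean geometry *)

Section Euclidean.
Context {R : realType} {n : nat}.
Implicit Types (u v w x : 'rV[R]_n) (a r : R).

Lemma dotC u v : dot u v = dot v u.
Proof. by apply: eq_bigr => i _; rewrite mulrC. Qed.

Lemma dotDl u v w : dot (u + v) w = dot u w + dot v w.
Proof. by rewrite -big_split; apply: eq_bigr => i _; rewrite mxE mulrDl. Qed.

Lemma dotDr u v w : dot w (u + v) = dot w u + dot w v.
Proof. by rewrite dotC dotDl !(dotC w). Qed.

Lemma dotZl a u v : dot (a *: u) v = a * dot u v.
Proof. by rewrite /dot big_distrr/=; apply: eq_bigr => i _; rewrite mxE mulrA. Qed.

Lemma dotZr a u v : dot u (a *: v) = a * dot u v.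
Proof. by rewrite dotC dotZl dotC. Qed.

Lemma dotNl u v : dot (- u) v = - dot u v.
Proof. by rewrite -scaleN1r dotZl mulN1r. Qed.

Lemma dotNr u v : dot u (- v) = - dot u v.
Proof. by rewrite dotC dotNl dotC. Qed.

Lemma dotBl u v w : dot (u - v) w = dot u w - dot v w.
Proof. by rewrite dotDl dotNl. Qed.

Lemma dotBr u v w : dot w (u - v) = dot w u - dot w v.
Proof. by rewrite dotDr dotNr. Qed.

Lemma dot0l u : dot 0 u = 0.
Proof. by rewrite -(scale0r 0) dotZl mul0r. Qed.

Lemma dot0r u : dot u 0 = 0.
Proof. by rewrite dotC dot0l. Qed.

Lemma dot_suml (I : Type) (s : seq I) (P : pred I) (F : I -> 'rV[R]_n) u :
  dot (\sum_(i <- s | P i) F i) u = \sum_(i <- s | P i) dot (F i) u.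
Proof. by elim/big_rec2: _ => [|i y1 y2 _ <-]; rewrite ?dot0l ?dotDl. Qed.

Lemma dot_sumr (I : Type) (s : seq I) (P : pred I) (F : I -> 'rV[R]_n) u :
  dot u (\sum_(i <- s | P i) F i) = \sum_(i <- s | P i) dot u (F i).
Proof. by rewrite dotC dot_suml; apply: eq_bigr => i _; rewrite dotC. Qed.

Definition dotE := (dotDl, dotDr, dotNl, dotNr, dotZl, dotZr, dot0l, dot0r).

Lemma dot_ge0 u : 0 <= dot u u.
Proof. by apply: sumr_ge0 => i _; rewrite -expr2 sqr_ge0. Qed.

Lemma dot_eq0 u : (dot u u == 0) = (u == 0).
Proof.
apply/eqP/eqP => [/eqP|->]; last by rewrite dot0l.
rewrite psumr_eq0 => [/allP u0|i _]; last by rewrite -expr2 sqr_ge0.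
apply/rowP => i; rewrite mxE; apply/eqP.
by have := u0 i (mem_index_enum i); rewrite mulf_eq0 orbb.
Qed.

Lemma dot_inj u v : (forall w, dot u w = dot v w) -> u = v.
Proof.
by move=> uv; apply/eqP; rewrite -subr_eq0 -dot_eq0 dotBl uv subrr.
Qed.

Lemma sqr_enorm u : enorm u ^+ 2 = dot u u.
Proof. by rewrite sqr_sqrtr ?dot_ge0. Qed.

Lemma sqr_enormD u v :
  enorm (u + v) ^+ 2 = enorm u ^+ 2 + 2 * dot u v + enorm v ^+ 2.
Proof. by rewrite !sqr_enorm !dotE (dotC v u); ring. Qed.

Lemma sqr_enormB u v :
  enorm (u - v) ^+ 2 = enorm u ^+ 2 - 2 * dot u v + enorm v ^+ 2.
Proof. by rewrite !sqr_enorm !dotE (dotC v u); ring. Qed.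

Lemma enorm_ge0 u : 0 <= enorm u.
Proof. exact: sqrtr_ge0. Qed.

Lemma enorm_eq0 u : (enorm u == 0) = (u == 0).
Proof. by rewrite -dot_eq0 -sqr_enorm sqrf_eq0. Qed.

Lemma enorm_gt0 u : (0 < enorm u) = (u != 0).
Proof. by rewrite lt_def enorm_ge0 andbT enorm_eq0. Qed.

Lemma enorm0 : enorm (0 : 'rV[R]_n) = 0.
Proof. by apply/eqP; rewrite enorm_eq0. Qed.

Lemma enormZ a u : enorm (a *: u) = `|a| * enorm u.
Proof.
by rewrite /enorm dotZl dotZr mulrA -expr2 sqrtrM ?sqr_ge0// sqrtr_sqr.
Qed.

Lemma enormN u : enorm (- u) = enorm u.
Proof. by rewrite -scaleN1r enormZ normrN1 mul1r. Qed.

Lemma enorm_distC u v : enorm (u - v) = enorm (v - u).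
Proof. by rewrite -opprB enormN. Qed.

(** Cauchy-Schwarz, from the nonnegative square of [enorm v *: u - enorm u *: v] divided by the
    positive product of the norms. *)
Lemma dot_le_enorm u v : dot u v <= enorm u * enorm v.
Proof.
have [->|u0] := eqVneq u 0; first by rewrite dot0l enorm0 mul0r.
have [->|v0] := eqVneq v 0; first by rewrite dot0r enorm0 mulr0.
have := dot_ge0 (enorm v *: u - enorm u *: v).
rewrite !dotE -!sqr_enorm (dotC v u).
have uv0 : 0 < enorm u * enorm v by rewrite mulr_gt0// enorm_gt0.
move=> h; rewrite -(ler_pM2l uv0); nra.
Qed.

Lemma normr_dot_le u v : `|dot u v| <= enorm u * enorm v.
Proof.
rewrite ler_norml dot_le_enorm andbT lerNl -dotNl.
by rewrite (le_trans (dot_le_enorm _ _))// enormN.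
Qed.

Lemma ler_enormD u v : enorm (u + v) <= enorm u + enorm v.
Proof.
rewrite -(@ler_pXn2r _ 2)// ?nnegrE ?enorm_ge0 ?addr_ge0 ?enorm_ge0//.
rewrite sqrrD !sqr_enorm !dotE (dotC v u).
have := dot_le_enorm u v; lra.
Qed.

Lemma ler_enormB u v : enorm (u - v) <= enorm u + enorm v.
Proof. by rewrite -(enormN v) ler_enormD. Qed.

Lemma ler_enorm_dist u v : enorm u <= enorm v + enorm (u - v).
Proof. by rewrite -{1}(subrKC v u) ler_enormD. Qed.

Lemma enorm_dist_trans v u w : enorm (u - w) <= enorm (u - v) + enorm (v - w).
Proof. by rewrite -[u in leLHS](subrK v) -addrA ler_enormD. Qed.

Lemma ler_enorm_sum (I : Type) (s : seq I) (P : pred I) (F : I -> 'rV[R]_n) :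
  enorm (\sum_(i <- s | P i) F i) <= \sum_(i <- s | P i) enorm (F i).
Proof.
elim/big_rec2: _ => [|i y1 y2 _ ih]; first by rewrite enorm0.
by rewrite (le_trans (ler_enormD _ _))// lerD2l.
Qed.

Lemma norm_coord_le u i : `|u 0 i| <= enorm u.
Proof.
rewrite -sqrtr_sqr ler_sqrt ?dot_ge0// /dot (bigD1 i)//= -expr2 lerDl.
by apply: sumr_ge0 => j _; rewrite -expr2 sqr_ge0.
Qed.

Lemma mx_norm_le_enorm u : `|u| <= enorm u.
Proof.
have [->|u0] := eqVneq `|u| 0; first exact: enorm_ge0.
have [[i j] /= ue] := mx_norm_neq0 u0.
by rewrite /Num.norm/= ue ord1 norm_coord_le.
Qed.

Lemma norm_coord_le_mx_norm u i : `|u 0 i| <= `|u|.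
Proof.
rewrite [leRHS]mx_normrE.
by apply: (le_bigmax_cond _ (fun i : 'I_1 * 'I_n => `|u i.1 i.2|) (j := (0, i))).
Qed.

Lemma enorm_le_mx_norm u : enorm u <= n%:R * `|u|.
Proof.
rewrite [in leLHS](row_sum_delta u) (le_trans (ler_enorm_sum _ _ _))//.
have -> : n%:R * `|u| = \sum_(i < n) `|u| by rewrite sumr_const card_ord mulr_natl.
apply: ler_sum => i _; rewrite enormZ.
have -> : enorm (delta_mx 0 i : 'rV[R]_n) = 1.
  rewrite /enorm /dot (bigD1 i)//= big1 => [|j ji]; last first.
    by rewrite !mxE (negPf ji) andbF mul0r.
  by rewrite !mxE !eqxx addr0 mulr1 sqrtr1.
by rewrite mulr1 norm_coord_le_mx_norm.
Qed.

(** Equivalence of the maximum norm and the Euclidean norm lets all later neighborhoods be given by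
    Euclidean radii. *)
Lemma nbhs_enormP x (A : set 'rV[R]_n) :
  nbhs x A <-> exists2 r, 0 < r & forall x', enorm (x' - x) < r -> A x'.
Proof.
split=> [/nbhs_normP[r /= r0 rA]|[r r0 rA]].
  exists r => // x' x'x; apply: rA => /=.
  by rewrite distrC (le_lt_trans (mx_norm_le_enorm _)).
(* The divisor is [n.+1], not [n], so that it stays positive in dimension 0. *)
apply/nbhs_ballP; exists (r / n.+1%:R) => /=; first by rewrite divr_gt0.
move=> x'; rewrite -ball_normE/= distrC ltr_pdivlMr// mulrC => x'x.
apply: rA; rewrite (le_lt_trans (enorm_le_mx_norm _))// (le_lt_trans _ x'x)//.
by rewrite ler_wpM2r// ler_nat.
Qed.

Lemma cvg_enormP (T : Type) (F : set_system T) (f : T -> 'rV[R]_n) x :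
  Filter F ->
  f @ F --> x <-> forall r, 0 < r -> \forall t \near F, enorm (f t - x) < r.
Proof.
move=> FF; split=> [fx r r0|fx A /nbhs_enormP[r r0 rA]].
  have /fx : nbhs x [set x' | enorm (x' - x) < r] by apply/nbhs_enormP; exists r.
  by [].
by rewrite /nbhs/=; apply: filterS (fx r r0) => t; exact: rA.
Qed.

Lemma continuous_enormP (W : normedModType R) (f : 'rV[R]_n -> W) x :
  {for x, continuous f} <-> forall e, 0 < e ->
    exists2 r, 0 < r & forall x', enorm (x' - x) < r -> `|f x' - f x| < e.
Proof.
split=> [fx e e0|fx A /nbhs_ballP[e /= e0 eA]].
  have /nbhs_enormP[r r0 rA] := fx _ (nbhsx_ballx (f x) e e0).
  by exists r => // x' /rA; rewrite /= -ball_normE/= distrC.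
have [r r0 rf] := fx e e0; apply/nbhs_enormP; exists r => // x' /rf x'x.
by apply: eA; rewrite -ball_normE/= distrC.
Qed.

Lemma ler_dist_enorm u v : `|enorm u - enorm v| <= enorm (u - v).
Proof.
rewrite ler_norml; have := ler_enorm_dist u v; have := ler_enorm_dist v u.
by rewrite (enorm_distC v u) => *; apply/andP; split; lra.
Qed.

Lemma continuous_enorm_dist x : continuous (fun x' => enorm (x' - x)).
Proof.
move=> x1; apply/continuous_enormP => e e0; exists e => // x2 x21.
rewrite (le_lt_trans (ler_dist_enorm _ _))//.
by rewrite opprB addrA subrK.
Qed.

Lemma dot_continuousr u : continuous (dot u).
Proof.
move=> x; apply/continuous_enormP => e e0.
exists (e / (enorm u + 1)).
  by rewrite divr_gt0// ltr_wpDl// enorm_ge0.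
move=> x' x'x; rewrite -dotBr (le_lt_trans (normr_dot_le _ _))//.
rewrite ltr_pdivlMr in x'x; last by rewrite ltr_wpDl// enorm_ge0.
by have := enorm_ge0 (x' - x); nra.
Qed.

Lemma closed_enorm_ball x r : closed [set x' | enorm (x' - x) <= r].
Proof.
exact: (iffLR (continuous_closedP _) (@continuous_enorm_dist x) _ (@closed_le R r)).
Qed.

Lemma compact_enorm_ball x r : compact [set x' | enorm (x' - x) <= r].
Proof.
apply: bounded_closed_compact; last exact: closed_enorm_ball.
exists (`|x| + `|r|); split; first by rewrite num_real.
move=> M Mr x' /= x'x; rewrite (le_trans _ (ltW Mr))//.
rewrite -(subrKC x x') (le_trans (ler_normD _ _))// lerD2l.
by rewrite (le_trans (mx_norm_le_enorm _))// (le_trans x'x)// ler_norm.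
Qed.

(** The sum of the absolute entries is a crude substitute for the operator norm. *)
Lemma normr_bilin_le (H : 'M[R]_n) u v :
  `|dot (u *m H^T) v| <= (\sum_i \sum_j `|H i j|) * (enorm u * enorm v).
Proof.
rewrite /dot mulr_suml (le_trans (ler_norm_sum _ _ _))//.
apply: ler_sum => i _; rewrite mxE mulr_suml (le_trans (ler_norm_sum _ _ _))// mulr_suml.
apply: ler_sum => j _; rewrite mxE !normrM -mulrA mulrCA.
by rewrite ler_wpM2l// ler_pM// norm_coord_le.
Qed.

(** Transposing [H] leaves the scalar unchanged. This form fits the row convention, in which a
    directional derivative is [w] times the Jacobian. *)
Lemma quad_formE (H : 'M[R]_n) w : quad_form H w = dot (w *m H) w.
Proof.
rewrite /quad_form /dot.
under eq_bigr => i _ do rewrite mxE big_distrl/=.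
under [RHS]eq_bigr => i _ do rewrite mxE big_distrl/=.
rewrite exchange_big/=; apply: eq_bigr => i _; apply: eq_bigr => j _.
by rewrite mxE; ring.
Qed.

Lemma quad_formBl (H K : 'M[R]_n) w :
  quad_form (H - K) w = quad_form H w - quad_form K w.
Proof. by rewrite !quad_formE mulmxBr dotBl. Qed.

Lemma sum_norm_entry_le (H : 'M[R]_n) :
  \sum_i \sum_j `|H i j| <= (n * n)%:R * `|H|.
Proof.
have -> : (n * n)%:R * `|H| = \sum_(i < n) \sum_(j < n) `|H|.
  by rewrite !sumr_const card_ord -mulrnA mulr_natl.
apply: ler_sum => i _; apply: ler_sum => j _; rewrite [leRHS]mx_normrE.
by apply: (le_bigmax_cond _ (fun p : 'I_n * 'I_n => `|H p.1 p.2|) (j := (i, j))).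
Qed.

Lemma quad_formZ (H : 'M[R]_n) a w : quad_form H (a *: w) = a ^+ 2 * quad_form H w.
Proof. by rewrite /quad_form -scalemxAl dotZl dotZr mulrA expr2. Qed.

Lemma quad_formD (H : 'M[R]_n) u v : quad_form H (u + v) =
  quad_form H u + dot (u *m H^T) v + dot (v *m H^T) u + quad_form H v.
Proof. by rewrite /quad_form mulmxDl !dotE; ring. Qed.

End Euclidean.

(** * Second-order expansions *)

Section Calculus.
Context {R : realType}.

(** The differential depends only on the germ. This serves [grad] of the Lagrangian, whose
    expression as a sum is available only near the reference point. *)
Lemma near_eq_diff (V W : normedModType R) (f g : V -> W) (x : V) :
  (\near x, f x = g x) -> differentiable g x ->
  differentiable f x /\ 'd f x = 'd g x :> (V -> W).
Proof.
move=> fg dg; have [dgc dge] := iffLR (diff_locallyP x g) dg.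
have e : f \o shift x = cst (f x) + 'd g x +o_ 0 id.
  apply/eqaddoP => e e0.
  have := iffLR (eqaddoP _ _ _ _) dge _ e0.
  rewrite (nbhs_singleton fg).
  have : \forall h \near (0 : V), f (h + x) = g (h + x).
    have /nbhs_normP[r /= r0 fr] := fg; apply/nbhs_normP; exists r => // h /=.
    by rewrite sub0r normrN => hr; apply: fr; rewrite /= opprD addrCA subrr addr0 normrN.
  apply: filterS2 => h fgh.
  by rewrite /= !fctE/= fgh.
have de := diff_unique dgc e.
split; last exact: de.
by apply: (iffRL (diff_locallyP x f)); rewrite de; split; [exact: dgc|exact: e].
Qed.

Lemma is_derive_line (V W : normedModType R) (F : V -> W) (x d : V) (t : R) :
  differentiable F (x + t *: d) ->
  is_derive t 1 (fun t => F (x + t *: d)) ('D_d F (x + t *: d)).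
Proof.
move=> /(@diff_derivable _ _ _ _ _ d).
have e : (fun h => h^-1 *: (((fun t => F (x + t *: d)) \o shift t) (h *: 1)
            - F (x + t *: d))) =
    (fun h => h^-1 *: ((F \o shift (x + t *: d)) (h *: d) - F (x + t *: d))).
  apply/funext => h /=; congr (_ *: (F _ - _)).
  by rewrite scalerDl -scalerA scale1r addrCA.
by move=> dF; split; rewrite /derivable /derive e.
Qed.

Context {n : nat}.
Implicit Types (f : 'rV[R]_n -> R) (x d : 'rV[R]_n).

Lemma derive_grad f x d : differentiable f x -> 'D_d f x = dot (grad f x) d.
Proof.
move=> df; rewrite deriveE// {1}(row_sum_delta d) linear_sum.
by apply: eq_bigr => i _; rewrite linearZ mxE deriveE// mulrC.
Qed.

Lemma is_derive_dot (V : normedModType R) (F : V -> 'rV[R]_n) (a v : V) d :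
  derivable F a v -> is_derive a v (fun y : V => dot (F y) d) (dot ('D_v F a) d).
Proof.
move=> dF.
have e : (fun h => h^-1 *: (((fun y : V => dot (F y) d) \o shift a) (h *: v)
            - dot (F a) d)) =
    dot d \o (fun h => h^-1 *: ((F \o shift a) (h *: v) - F a)).
  by apply/funext => h /=; rewrite (dotC d) dotZl dotBl.
have c : h^-1 *: (((fun y : V => dot (F y) d) \o shift a) (h *: v)
            - dot (F a) d) @[h --> 0^'] --> dot ('D_v F a) d.
  rewrite e (dotC _ d); apply: continuous_cvg; first exact: dot_continuousr.
  exact: dF.
by split; [apply/cvg_ex; exists (dot ('D_v F a) d)|exact: cvg_lim].
Qed.

(** The gradient is taken at the moving base point [x1], whereas the Hessian is frozen at [x]; the
    estimate is uniform in both points. *)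
Definition taylor2 f (H : 'M[R]_n) x := forall e, 0 < e ->
  exists2 r, 0 < r & forall x1 x2, enorm (x1 - x) < r -> enorm (x2 - x) < r ->
    `|f x2 - f x1 - dot (grad f x1) (x2 - x1) - quad_form H (x2 - x1) / 2|
      <= e * enorm (x2 - x1) ^+ 2.

(** The mean value theorem is used twice: [k] is the restriction to the segment minus its model, its
    derivative is [l] up to a constant, and the derivative of [l] is the deviation of the Hessian
    from [H]. *)
Lemma taylor2_segment f (H : 'M[R]_n) (e : R) x1 x2 :
  (forall t : R, 0 <= t <= 1 -> differentiable f (x1 + t *: (x2 - x1)) /\
     differentiable (grad f) (x1 + t *: (x2 - x1))) ->
  (forall t : R, 0 <= t <= 1 ->
     `|quad_form (hess f (x1 + t *: (x2 - x1)) - H) (x2 - x1)| <= e) ->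
  `|f x2 - f x1 - dot (grad f x1) (x2 - x1) - quad_form H (x2 - x1) / 2| <= e.
Proof.
set d := x2 - x1 => df hf; set q := quad_form H d.
have fx2 : f x2 = f (x1 + 1 *: d) by rewrite scale1r subrKC.
pose k (t : R) := f (x1 + t *: d) - t * dot (grad f x1) d - t ^+ 2 * (q / 2).
pose l (t : R) := dot (grad f (x1 + t *: d)) d - t * q.
have dk (t : R) : 0 <= t <= 1 ->
    is_derive t 1 k (l t - dot (grad f x1) d).
  move=> /df[df1 _]; have h := is_derive_line df1.
  rewrite /k; apply: is_derive_eq.
  by rewrite derive_grad// /l /GRing.scale/= !(mulr1, mul1r); field.
have dl (t : R) : 0 <= t <= 1 ->
    is_derive t 1 l (quad_form (hess f (x1 + t *: d) - H) d).
  move=> /df[_ df2]; have h := is_derive_line df2.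
  have := @is_derive_dot _ (fun t : R => grad f (x1 + t *: d)) t 1 d (@ex_derive _ _ _ _ _ _ _ h).
  rewrite (@derive_val _ _ _ _ _ _ _ h) => h2.
  rewrite /l; apply: is_derive_eq.
  rewrite deriveEjacobian// quad_formBl !quad_formE /GRing.scale/= !(mulr1,mul1r).
  rewrite -/(hess f _).
  by rewrite /q quad_formE; ring.
have in01 (t : R) : t \in `[0, 1]%R = (0 <= t <= 1) by rewrite in_itv.
have oo01 (t : R) : t \in `]0, 1[%R -> 0 <= t <= 1.
  by rewrite in_itv/= => /andP[/ltW-> /ltW->].
have [c] : exists2 c, c \in `[0, 1]%R & k 1 - k 0 = (l c - dot (grad f x1) d) * (1 - 0).
  apply: (@MVT_segment _ k (fun t => l t - dot (grad f x1) d)) => // [t /oo01/dk//|].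
  by apply: derivable_within_continuous => t; rewrite in01 => /dk[].
rewrite in01 subr0 mulr1 => /andP[c0 c1] kc.
have [c' ] : exists2 c', c' \in `[0, c]%R &
    l c - l 0 = quad_form (hess f (x1 + c' *: d) - H) d * (c - 0).
  apply: (@MVT_segment _ l (fun t => quad_form (hess f (x1 + t *: d) - H) d)) => //.
    move=> t; rewrite in_itv/= => /andP[t0 tc]; apply: dl.
    by rewrite ltW//= (le_trans (ltW tc)).
  apply: derivable_within_continuous => t; rewrite in_itv/= => /andP[t0 tc].
  by have [] := dl t; rewrite ?t0 ?(le_trans tc).
rewrite in_itv/= subr0 => /andP[c'0 c'c] lc.
have := hf c'; rewrite c'0 (le_trans c'c)// => /(_ isT) hc'.
move: lc kc; rewrite /k /l !scale0r !addr0 -fx2 => lc kc.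
have -> : f x2 - f x1 - dot (grad f x1) d - q / 2 =
    quad_form (hess f (x1 + c' *: d) - H) d * c by rewrite -lc; lra.
rewrite normrM (ger0_norm c0).
by apply: le_trans hc'; rewrite ler_piMr.
Qed.

Lemma enorm_segment x x1 x2 r (t : R) : enorm (x1 - x) < r ->
  enorm (x2 - x) < r -> 0 <= t <= 1 -> enorm (x1 + t *: (x2 - x1) - x) < r.
Proof.
move=> x1r x2r /andP[t0 t1].
have -> : x1 + t *: (x2 - x1) - x = (1 - t) *: (x1 - x) + t *: (x2 - x).
  by apply/rowP => i; rewrite !mxE; ring.
rewrite (le_lt_trans (ler_enormD _ _))// !enormZ !ger0_norm// ?subr_ge0//.
have [->|tn0] := eqVneq t 0; first lra.
have : 0 < t by rewrite lt_def tn0.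
nra.
Qed.

Lemma C2_taylor2 f x : C2_around f x -> taylor2 f (hess f x) x.
Proof.
move=> C2 e e0; have [_ _ /continuous_enormP hc] := nbhs_singleton C2.
have /nbhs_enormP[r1 r10 C2r] := C2.
pose e' := e / (n * n).+1%:R.
have e'0 : 0 < e' by rewrite divr_gt0.
have [r2 r20 hr2] := hc _ e'0.
exists (Num.min r1 r2); first by rewrite lt_min r10.
move=> x1 x2 x1r x2r; apply: taylor2_segment => t t01.
  have := enorm_segment x1r x2r t01; rewrite lt_min => /andP[/C2r[]//].
have := enorm_segment x1r x2r t01; rewrite lt_min => /andP[_ /hr2 h].
rewrite /quad_form (le_trans (normr_bilin_le _ _ _))// -expr2.
rewrite ler_wpM2r ?sqr_ge0// (le_trans (sum_norm_entry_le _))//.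
rewrite (le_trans (ler_wpM2l _ (ltW h)))// /e'.
by rewrite mulrCA ler_piMr// ?(ltW e0)// ler_pdivrMr// mul1r ler_nat.
Qed.

Lemma grad_continuous f x : C2_around f x -> forall e, 0 < e ->
  exists2 r, 0 < r & forall x1, enorm (x1 - x) < r ->
    enorm (grad f x1 - grad f x) < e.
Proof.
move=> C2 e e0; have [_ /differentiable_continuous dg _] := nbhs_singleton C2.
have /cvg_enormP := dg; move=> /(_ e e0) /nbhs_enormP[r r0 rg].
by exists r => // x1 /rg.
Qed.

(** In the second-order expansion at [x1], both the change of gradient from [x] to [x1] and the
    quadratic term are small multiples of the distance. *)
Lemma strict_diff f x : C2_around f x -> forall e, 0 < e ->
  exists2 r, 0 < r & forall x1 x2, enorm (x1 - x) < r -> enorm (x2 - x) < r ->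
    `|f x2 - f x1 - dot (grad f x) (x2 - x1)| <= e * enorm (x2 - x1).
Proof.
move=> C2 e e0; have e20 : 0 < e / 2 by rewrite divr_gt0.
have [r1 r10 h1] := grad_continuous C2 e20.
have [r2 r20 h2] := C2_taylor2 C2 ltr01.
pose C := \sum_i \sum_j `|hess f x i j|.
have C0 : 0 <= C by apply: sumr_ge0 => i _; apply: sumr_ge0.
pose r3 := e / (4 * (C + 1)).
have r30 : 0 < r3 by rewrite divr_gt0// mulr_gt0// ltr_wpDl.
exists (Num.min r1 (Num.min r2 r3)); first by rewrite !lt_min r10 r20.
move=> x1 x2; rewrite !lt_min => /and3P[x11 x12 x13] /and3P[x21 x22 x23].
have := h2 _ _ x12 x22.
have := normr_bilin_le (hess f x) (x2 - x1) (x2 - x1).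
have := normr_dot_le (grad f x1 - grad f x) (x2 - x1).
rewrite -/(quad_form _ _) -/C mul1r dotBl.
have dr3 : enorm (x2 - x1) <= 2 * r3.
  by rewrite (le_trans (enorm_dist_trans x _ _))// (enorm_distC x); lra.
move: (h1 _ x11) (enorm_ge0 (x2 - x1)) dr3.
set D := enorm (x2 - x1); set G := enorm (_ - _) => Ge D0 D3.
have CD : (C + 1) * D <= e / 2.
  have : (C + 1) * r3 = e / 4.
    by rewrite /r3; field; rewrite gt_eqF// ltr_wpDl.
  by nra.
rewrite !ler_norml => /andP[a1 a2] /andP[b1 b2] /andP[c1 c2].
have GD : G * D <= e / 2 * D by rewrite ler_wpM2r// ltW.
have CDD : (C + 1) * D * D <= e / 2 * D by rewrite ler_wpM2r.
apply/andP; split; nra.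
Qed.

End Calculus.

(** * Dual systems and Lagrange multipliers *)

(** Supplies a common radius for finitely many constraints; the minimum starts from 1, which covers
    an empty index type. *)
Lemma finite_radius (R : realType) (I : finType) (P : I -> R -> Prop) :
  (forall i r r', r' <= r -> P i r -> P i r') ->
  (forall i, exists2 r, 0 < r & P i r) -> exists2 r, 0 < r & forall i, P i r.
Proof.
move=> Pm /(_ _)/cid2 Pex; pose r i := s2val (Pex i).
exists (\big[Num.min/1]_i r i).
  by apply: lt_bigmin => // i _; rewrite /r; case: (Pex i).
move=> i; apply: (Pm _ (r i)); first exact: bigmin_le_cond.
by rewrite /r; case: (Pex i).
Qed.

Section DualSystems.
Context {R : realType} {n m : nat}.
Implicit Types (J : {set 'I_m}) (a b : 'I_m -> 'rV[R]_n).

(** A biorthogonal family is the working form of linear independence: it extracts coefficients,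
    gives a right inverse and gives projections. Vanishing outside [J] allows sums over all
    indices. *)
Definition dual_system J a b :=
  (forall i j, i \in J -> j \in J -> dot (a i) (b j) = (i == j)%:R) /\
  (forall j, j \notin J -> b j = 0).

(** The dual vectors represent the coordinate functionals of the free family. *)
Lemma free_dual_system J a :
  free [seq a i | i <- enum J] -> exists b, dual_system J a b.
Proof.
pose X := [tuple of [seq a i | i <- enum J]].
move=> fX0; have fX : free X := fX0.
pose b j : 'rV[R]_n :=
  if [pick k : 'I_#|J| | enum_val k == j] is Some k
  then \row_l coord X k (delta_mx 0 l) else 0.
have Xk (k : 'I_#|J|) : X`_k = a (enum_val k).
  by rewrite (nth_map (enum_default k)) -?cardE// /enum_val.
have dotb u k : dot u (\row_l coord X k (delta_mx 0 l)) = coord X k u.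
  rewrite [in RHS](row_sum_delta u) linear_sum; apply: eq_bigr => l _.
  by rewrite mxE linearZ.
exists b; split=> [i j iJ jJ|j jJ]; last first.
  rewrite /b; case: pickP => // k /eqP kj.
  by move: jJ; rewrite -kj enum_valP.
rewrite /b; case: pickP => [k /eqP kj|/(_ (enum_rank_in jJ j))]; last first.
  by rewrite enum_rankK_in// eqxx.
rewrite -kj -(enum_rankK_in iJ iJ) dotb -Xk coord_free//.
by rewrite (inj_eq enum_val_inj).
Qed.

(** The matrix of pairings of [a'] with [b] is close to the identity, hence invertible; its inverse
    recombines [b] into a dual system for [a']. *)
Lemma dual_system_perturb J a b : dual_system J a b ->
  exists2 e, 0 < e & forall a', (forall i, enorm (a' i - a i) < e) ->
    exists b', dual_system J a' b'.
Proof.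
move=> [ab b0]; pose B := \sum_j enorm (b j).
have B0 : 0 <= B by apply: sumr_ge0 => j _; exact: enorm_ge0.
exists (B + 1)^-1; first by rewrite invr_gt0 ltr_wpDl.
move=> a' a'a.
(* Rows outside [J] are rows of the identity, so that [P] is a square matrix that can be
   invertible. *)
pose P : 'M[R]_m := \matrix_(i, j) if i \in J then dot (a' i) (b j) else (i == j)%:R.
have PB i j : `|(i == j)%:R - P i j| <= (B + 1)^-1 * enorm (b j).
  rewrite mxE; case: ifPn => iJ; last first.
    by rewrite subrr normr0 mulr_ge0 ?enorm_ge0// invr_ge0 addr_ge0.
  have [jJ|jJ] := boolP (j \in J); last first.
    rewrite b0// dot0r enorm0 mulr0 subr0; case: eqP => [ij|]; last by rewrite normr0.
    by rewrite -ij iJ in jJ.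
  rewrite -ab// -dotBl (le_trans (normr_dot_le _ _))//.
  by rewrite ler_wpM2r ?enorm_ge0// enorm_distC ltW.
have Pu : P \in unitmx.
  rewrite -row_free_unit; apply: inj_row_free => v vP.
  have vj j : v 0 j = \sum_i v 0 i * ((i == j)%:R - P i j).
    under eq_bigr do rewrite mulrBr; rewrite sumrB.
    have := congr1 (fun A : 'rV[R]_m => A 0 j) vP; rewrite !mxE => ->.
    rewrite subr0 (bigD1 j)//= eqxx mulr1 big1 ?addr0// => i /negPf->.
    by rewrite mulr0.
  (* For [v] in the left kernel, the sum norm [V] satisfies [V <= B / (B + 1) * V], which forces it
     to be 0. *)
  pose V := \sum_j `|v 0 j|.
  have V0 : 0 <= V by apply: sumr_ge0.
  have : V <= (B + 1)^-1 * B * V.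
    rewrite {1}/V (le_trans (ler_sum _ (G := fun j => (B + 1)^-1 * V * enorm (b j)) _))//.
      move=> j _; rewrite vj (le_trans (ler_norm_sum _ _ _))//.
      rewrite mulrAC mulr_sumr; apply: ler_sum => i _.
      by rewrite normrM mulrC ler_wpM2r.
    by rewrite -mulr_sumr mulrAC.
  have B1 : 0 < B + 1 by rewrite ltr_wpDl.
  rewrite -mulrA ler_pdivlMl// => VB.
  have {VB}V00 : V = 0 by lra.
  apply/rowP => j; rewrite mxE; apply/eqP; rewrite -normr_eq0.
  move/eqP: V00; rewrite psumr_eq0// => /allP/(_ j (mem_index_enum j)).
  by [].
exists (fun k => if k \in J then \sum_j invmx P j k *: b j else 0).
split=> [i k iJ kJ|k /negPf -> //].
rewrite kJ dot_sumr; have := congr1 (fun A : 'M[R]_m => A i k) (mulmxV Pu).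
rewrite !mxE => <-; apply: eq_bigr => j _.
by rewrite dotZr mulrC mxE iJ.
Qed.

Lemma dual_system_coeff J a b (y : 'rV[R]_m) j : dual_system J a b ->
  (forall i, i \notin J -> y 0 i = 0) -> j \in J ->
  dot (\sum_i y 0 i *: a i) (b j) = y 0 j.
Proof.
move=> [ab _] y0 jJ; rewrite dot_suml (bigD1 j)//= dotZl ab// eqxx mulr1.
rewrite big1 ?addr0// => i /negPf ij; rewrite dotZl.
have [iJ|iJ] := boolP (i \in J); last by rewrite y0// mul0r.
by rewrite ab// ij mulr0.
Qed.

End DualSystems.

(** * First and second derivatives of the Lagrangian in [x] *)

Section Program.
Context {R : realType} {n m s : nat}.
Variables (phi0 : 'rV[R]_n -> R) (phi : 'I_m -> 'rV[R]_n -> R).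
Implicit Types (x v w : 'rV[R]_n) (y : 'rV[R]_m) (J : {set 'I_m}).

Definition C2_data x := C2_around phi0 x /\ forall i, C2_around (phi i) x.

Lemma grad_LE x y : differentiable phi0 x ->
  (forall i, differentiable (phi i) x) ->
  grad_L phi0 phi x y = grad phi0 x + \sum_i y 0 i *: grad (phi i) x.
Proof.
move=> d0 d; rewrite /grad_L.
have -> : (fun x' => lagrangian phi0 phi x' y) =
    phi0 + \sum_i (y 0 i \*: phi i).
  apply/funext => x'; rewrite /lagrangian /dot !fctE fct_sumE; congr (_ + _).
  by apply: eq_bigr => i _; rewrite mxE.
apply/rowP => k; rewrite !mxE deriveD; [|exact: diff_derivable|]; last first.
  by apply: derivable_sum => i; apply: derivableZ; exact: diff_derivable.
rewrite derive_sum => [|i]; last by apply: derivableZ; exact: diff_derivable.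
rewrite summxE; congr (_ + _); apply: eq_bigr => i _.
by rewrite deriveZ ?mxE//; exact: diff_derivable.
Qed.

(** The gradient of the Lagrangian agrees near [x] with the explicit combination [G], so the two
    have the same derivative at [x], and that of [G] is computed termwise. *)
Lemma quad_form_hess_L x y w : C2_data x ->
  quad_form (hess_L phi0 phi x y) w =
  quad_form (hess phi0 x) w + \sum_i y 0 i * quad_form (hess (phi i) x) w.
Proof.
move=> [C0 C].
pose G := grad phi0 + \sum_i (y 0 i \*: grad (phi i)).
have d0 := nbhs_singleton C0; have d i := nbhs_singleton (C i).
have dZ i : differentiable (y 0 i \*: grad (phi i)) x.
  by apply: differentiableZ; case: (d i).
have dG : differentiable G x.
  apply: differentiableD; first by case: d0.
  exact: differentiable_sum.
have FG : \near x, grad (fun x' => lagrangian phi0 phi x' y) x = G x.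
  have Ci : \forall x' \near x, forall i, differentiable (phi i) x'.
    apply/nbhs_enormP.
    have [|i|r r0 rd] := @finite_radius _ _ (fun i r => forall x', enorm (x' - x) < r ->
      differentiable (phi i) x').
    - by move=> i r r' r'r h x' /lt_le_trans h'; apply: h; exact: h'.
    - have /nbhs_enormP[r r0 rC] := C i.
      by exists r => // x' /rC[].
    by exists r => // x' x'r i; exact: rd.
  apply: filterS2 C0 Ci => x' [d0' _ _] d'.
  rewrite -/(grad_L phi0 phi x' y) grad_LE// /G !fctE fct_sumE.
  by congr (_ + _); apply: eq_bigr.
have [dF dFG] := near_eq_diff FG dG.
have e : w *m hess_L phi0 phi x y = 'D_w G x.
  rewrite (deriveE w dG) -dFG.
  rewrite -(deriveE w dF).
  rewrite (deriveEjacobian w dF).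
  reflexivity.
have derJ (f : 'rV[R]_n -> 'rV[R]_n) : differentiable f x -> derivable f x w.
  exact: diff_derivable.
have dGE : 'D_w G x = w *m hess phi0 x + \sum_i y 0 i *: (w *m hess (phi i) x).
  rewrite /G (@deriveD _ _ _ (grad phi0) (\sum_i (y 0 i \*: grad (phi i))) x w).
  - rewrite derive_sum; last by move=> i; apply: derJ.
    rewrite deriveEjacobian; last by case: d0.
    congr (_ + _); apply: eq_bigr => i _; have [_ di _] := d i.
    by rewrite (@deriveZ _ _ _ _ _ _ _ (derJ _ di)) (deriveEjacobian w di).
  - by apply: derJ; case: d0.
  - by apply: derJ; exact: differentiable_sum.
rewrite [LHS]quad_formE e dGE dotDl dot_suml -quad_formE; congr (_ + _).
by apply: eq_bigr => i _; rewrite dotZl -quad_formE.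
Qed.

End Program.

Lemma C2_continuous (R : realType) (n : nat) (f : 'rV[R]_n -> R) x e :
  C2_around f x -> 0 < e -> exists2 r, 0 < r & forall x1, enorm (x1 - x) < r ->
    `|f x1 - f x| < e.
Proof.
move=> C2 e0; have [/differentiable_continuous fc _ _] := nbhs_singleton C2.
exact: (iffLR (continuous_enormP f x) fc).
Qed.

Lemma C2_around_near (R : realType) (n : nat) (f : 'rV[R]_n -> R) x :
  C2_around f x -> exists2 r, 0 < r & forall x1, enorm (x1 - x) < r ->
    C2_around f x1.
Proof.
move=> /nbhs_enormP[r r0 rC]; exists r => // x1 x1r; apply/nbhs_enormP.
exists (r - enorm (x1 - x)); first by rewrite subr_gt0.
move=> x2 x21; apply: rC.
by rewrite (le_lt_trans (enorm_dist_trans x1 _ _))// -ltrBrDr.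
Qed.

(** * Regular points, uniqueness and continuity of multipliers *)

Section Multipliers.
Context {R : realType} {n m s : nat}.
Variables (phi0 : 'rV[R]_n -> R) (phi : 'I_m -> 'rV[R]_n -> R).
Variable J : {set 'I_m}.
Implicit Types (x v w : 'rV[R]_n) (y : 'rV[R]_m).

(* [J] stands for the union of the active and the equality indices at the
   reference point, kept fixed when [x] moves away from it. *)
Definition regular_point x := [/\ C2_data phi0 phi x,
  forall i, i \notin J -> phi i x < 0
  & exists b, dual_system J (fun i => grad (phi i) x) b].

Lemma feasibleP x : feasible s phi x <->
  (forall i : 'I_m, (i < s)%N -> phi i x <= 0) /\
  (forall i : 'I_m, (s <= i)%N -> phi i x = 0).
Proof.
by split=> -[h1 h2]; split=> i /[dup] hi; move: (h1 i) (h2 i); rewrite mxE;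
  auto.
Qed.

(** Smoothness holds on neighborhoods by definition, strict negativity is stable by continuity, and
    dual systems survive small changes of the gradients. *)
Lemma regular_point_open x : regular_point x ->
  exists2 r, 0 < r & forall x1, enorm (x1 - x) < r -> regular_point x1.
Proof.
move=> [[C0 C] J0 [b db]].
have [r0 r00 h0] := C2_around_near C0.
have [|i|r1 r10 h1] := @finite_radius _ _
    (fun i r => forall x', enorm (x' - x) < r -> C2_around (phi i) x').
- by move=> i r r' r'r h x' x'r; apply: h; exact: lt_le_trans r'r.
- by have [r r_gt0 h] := C2_around_near (C i); exists r.
have [|i|r2 r20 h2] := @finite_radius _ _ (fun i r => forall x',
    enorm (x' - x) < r -> i \notin J -> phi i x' < 0).
- by move=> i r r' r'r h x' x'r; apply: h; exact: lt_le_trans r'r.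
- have [iJ|/J0 i0] := boolP (i \in J); first by exists 1.
  have i00 : 0 < - phi i x by rewrite oppr_gt0.
  have [r r0' hr] := C2_continuous (C i) i00.
  exists r => // x' /hr; rewrite ltr_norml => /andP[_ h] _; lra.
have [e e0 he] := dual_system_perturb db.
have [|i|r3 r30 h3] := @finite_radius _ _ (fun i r => forall x',
    enorm (x' - x) < r -> enorm (grad (phi i) x' - grad (phi i) x) < e).
- by move=> i r r' r'r h x' x'r; apply: h; exact: lt_le_trans r'r.
- by have [r r_gt0 h] := grad_continuous (C i) e0; exists r.
exists (Num.min (Num.min r0 r1) (Num.min r2 r3)).
  by rewrite !lt_min r00 r10 r20.
move=> x1; rewrite !lt_min => /andP[/andP[x10 x11] /andP[x12 x13]].
split; first by split; [exact: h0|move=> i; exact: h1].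
- by move=> i; exact: h2.
- by apply: he => i; exact: h3.
Qed.

Lemma regular_grad_LE x y : regular_point x ->
  grad_L phi0 phi x y = grad phi0 x + \sum_i y 0 i *: grad (phi i) x.
Proof.
move=> [[C0 C] _ _]; apply: grad_LE; first by have [] := nbhs_singleton C0.
by move=> i; have [] := nbhs_singleton (C i).
Qed.

(** At a feasible point every product [y 0 i * phi i x] is nonpositive, so complementarity of the
    sum is complementarity of each term. *)
Lemma LambdaP x v y : regular_point x -> Lambda s phi0 phi x v y <->
  [/\ feasible s phi x, multiplier_cone s y,
      v = grad phi0 x + \sum_i y 0 i *: grad (phi i) x
    & forall i, y 0 i * phi i x = 0].
Proof.
move=> rx; rewrite /Lambda /= -(regular_grad_LE _ rx).
have dotg : dot y (gmap phi x) = \sum_i y 0 i * phi i x.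
  by apply: eq_bigr => i _; rewrite mxE.
split=> -[fx cy vE y0]; split=> //; last by rewrite dotg big1.
have /feasibleP[f1 f2] := fx.
have le0 i : 0 <= - (y 0 i * phi i x).
  rewrite -mulrN; have [si|si] := leqP s i; first by rewrite f2// oppr0 mulr0.
  by rewrite mulr_ge0// ?oppr_ge0 ?f1//; exact: cy.
move=> i; apply/eqP; rewrite -oppr_eq0.
have /eqP : \sum_i - (y 0 i * phi i x) = 0 by rewrite sumrN -dotg y0 oppr0.
by rewrite psumr_eq0// => /allP/(_ i (mem_index_enum i)).
Qed.

Lemma Lambda_supp x v y i : regular_point x -> Lambda s phi0 phi x v y ->
  i \notin J -> y 0 i = 0.
Proof.
move=> rx /(LambdaP _ _ rx)[_ _ _ /(_ i)/eqP]; rewrite mulf_eq0.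
by case: rx => _ J0 _ /orP[/eqP//|/eqP pi /J0]; rewrite pi ltxx.
Qed.

(** Pairing the stationarity equation with the dual vectors determines the multipliers in [J]; the
    others vanish. *)
Lemma Lambda_unique x v y y' : regular_point x ->
  Lambda s phi0 phi x v y -> Lambda s phi0 phi x v y' -> y = y'.
Proof.
move=> rx L L'; have [_ _ [b db]] := rx.
have /(LambdaP _ _ rx)[_ _ vE _] := L; have /(LambdaP _ _ rx)[_ _ vE' _] := L'.
apply/rowP => i; have [iJ|iJ] := boolP (i \in J); last first.
  by rewrite (Lambda_supp rx L)// (Lambda_supp rx L').
rewrite -(dual_system_coeff db (fun i => Lambda_supp rx L) iJ).
rewrite -(dual_system_coeff db (fun i => Lambda_supp rx L') iJ).
by congr dot; apply: (addrI (grad phi0 x)); rewrite -vE.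
Qed.

(** Subtracting the two stationarity equations and pairing with the dual vectors bounds the sum norm
    [S] of the difference by [B * (eta * (2 + Y + S))]; the term in [S] is absorbed on the left. *)
Lemma Lambda_continuous x0 v0 y0 e : regular_point x0 ->
  Lambda s phi0 phi x0 v0 y0 -> 0 < e ->
  exists2 r, 0 < r & forall x v y, enorm (x - x0) < r -> enorm (v - v0) < r ->
    Lambda s phi0 phi x v y -> forall i, `|y 0 i - y0 0 i| <= e.
Proof.
move=> rx0 L0 e0; have [[C0 C] _ [b db]] := rx0.
pose B := \sum_j enorm (b j); pose Y := \sum_i `|y0 0 i|.
have B0 : 0 <= B by apply: sumr_ge0 => i _; exact: enorm_ge0.
have Y0 : 0 <= Y by apply: sumr_ge0.
(* This gives both [B * eta <= 1 / 2], needed for absorption, and [B * eta * (2 + Y) <= e / 2]. *)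
pose eta := Num.min 1 e / (2 * (B + 1) * (2 + Y)).
have N0 : 0 < 2 * (B + 1) * (2 + Y) by apply: mulr_gt0; [apply: mulr_gt0 => //; lra|lra].
have eta0 : 0 < eta by rewrite divr_gt0// lt_min ltr01.
have etaN : eta * (2 * (B + 1) * (2 + Y)) = Num.min 1 e.
  by rewrite divfK// gt_eqF.
have [r0 r00 h0] := grad_continuous C0 eta0.
have [|i|r1 r10 h1] := @finite_radius _ _ (fun i r => forall x',
    enorm (x' - x0) < r -> enorm (grad (phi i) x' - grad (phi i) x0) < eta).
- by move=> i r r' r'r h x' x'r; apply: h; exact: lt_le_trans r'r.
- by have [r r_gt0 h] := grad_continuous (C i) eta0; exists r.
have [r2 r20 h2] := regular_point_open rx0.
exists (Num.min (Num.min r0 r1) (Num.min r2 eta)).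
  by rewrite !lt_min r00 r10 r20.
move=> x v y; rewrite !lt_min => /andP[/andP[x10 x11] /andP[x12 x13]].
move=> /andP[_ /andP[_ veta]] L.
have rx := h2 _ x12.
have /(LambdaP _ _ rx)[_ _ vE _] := L; have /(LambdaP _ _ rx0)[_ _ vE0 _] := L0.
pose S := \sum_i `|y 0 i - y0 0 i|.
have yS : \sum_i `|y 0 i| <= Y + S.
  rewrite -big_split/=; apply: ler_sum => i _.
  by rewrite -{1}(subrKC (y0 0 i) (y 0 i)) ler_normD.
have yj j : `|y 0 j - y0 0 j| <= enorm (b j) * (eta * (2 + Y + S)).
  have [jJ|jJ] := boolP (j \in J); last first.
    rewrite (Lambda_supp rx L)// (Lambda_supp rx0 L0)// subrr normr0.
    rewrite mulr_ge0 ?enorm_ge0// mulr_ge0 ?(ltW eta0)// !addr_ge0//.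
    exact: sumr_ge0.
  have dsupp i : i \notin J -> (y - y0) 0 i = 0.
    by move=> iJ; rewrite !mxE (Lambda_supp rx L)// (Lambda_supp rx0 L0)// subrr.
  have := dual_system_coeff db dsupp jJ; rewrite !mxE => <-.
  have -> : \sum_i (y - y0) 0 i *: grad (phi i) x0 =
      (v - v0) - (grad phi0 x - grad phi0 x0)
      - \sum_i y 0 i *: (grad (phi i) x - grad (phi i) x0).
    under eq_bigr do rewrite !mxE scalerBl.
    under [in RHS]eq_bigr do rewrite scalerBr.
    rewrite !sumrB vE vE0; set a := \sum_i _; set c := \sum_i _.
    by apply/rowP => k; rewrite !mxE; ring.
  rewrite (le_trans (normr_dot_le _ _))// mulrC ler_wpM2l ?enorm_ge0//.
  rewrite (le_trans (ler_enormB _ _))//.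
  have : enorm (\sum_i y 0 i *: (grad (phi i) x - grad (phi i) x0)) <= eta * (Y + S).
    rewrite (le_trans (ler_enorm_sum _ _ _))//.
    rewrite (le_trans _ (ler_wpM2l (ltW eta0) yS))// mulr_sumr.
    by apply: ler_sum => i _; rewrite enormZ mulrC ler_wpM2r// ltW// h1.
  have := ler_enormB (v - v0) (grad phi0 x - grad phi0 x0).
  have := h0 _ x10; lra.
have S0 : 0 <= S by exact: sumr_ge0.
have SB : S <= B * (eta * (2 + Y + S)).
  by rewrite /B mulr_suml; apply: ler_sum => i _; exact: yj.
have m1 : Num.min 1 e <= 1 by rewrite ge_min lexx.
have me : Num.min 1 e <= e by rewrite ge_min lexx orbT.
have Be : B * eta * (2 + Y) <= e / 2 by nra.
have B1 : B * eta <= 1 / 2 by nra.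
have Se : S <= e by nra.
move=> i; apply: le_trans Se; rewrite /S (bigD1 i)//= lerDl.
exact: sumr_ge0.
Qed.

End Multipliers.

(** * Feasible curves and regular subgradients *)

(** Provides the complete normed structure required by the Banach fixed point theorem. *)
HB.instance Definition _ (R : realType) (m : nat) := Complete.on 'rV[R]_m.

Section Curves.
Context {R : realType} {n m : nat}.
Variables (J : {set 'I_m}) (phi : 'I_m -> 'rV[R]_n -> R) (a b : 'I_m -> 'rV[R]_n).
Variable x : 'rV[R]_n.
Hypothesis dab : dual_system J a b.
Hypothesis sphi : forall i e, 0 < e -> exists2 r, 0 < r & forall x1 x2,
  enorm (x1 - x) < r -> enorm (x2 - x) < r ->
  `|phi i x2 - phi i x1 - dot (a i) (x2 - x1)| <= e * enorm (x2 - x1).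

Lemma row_norm_le (u : 'rV[R]_m) c : 0 <= c -> (forall i, `|u 0 i| <= c) ->
  `|u| <= c.
Proof.
by move=> c0 uc; rewrite [leLHS]mx_normrE; apply: bigmax_le => //= -[i j] _;
  rewrite (ord1 i).
Qed.

(* The Newton-type iteration along the fixed directions [b] contracts, since
   they are a right inverse of the derivative of [phi] at [x]. *)
Lemma curve d e : 0 < e -> exists2 t0, 0 < t0 & forall t, 0 < t -> t < t0 ->
  exists2 x', enorm (x' - x - t *: d) <= e * t &
    forall i, i \in J -> phi i x' = phi i x + t * dot (a i) d.
Proof.
move=> e0; pose B := \sum_j enorm (b j); pose D := enorm d.
have B0 : 0 <= B by apply: sumr_ge0 => i _; exact: enorm_ge0.
have D0 : 0 <= D by exact: enorm_ge0.
pose eta := Num.min 1 e / (2 * (B + 1) * (D + 1)).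
have N0 : 0 < 2 * (B + 1) * (D + 1).
  by apply: mulr_gt0; [apply: mulr_gt0 => //; lra|lra].
have eta0 : 0 < eta by rewrite divr_gt0// lt_min ltr01.
have etaN : eta * (2 * (B + 1) * (D + 1)) = Num.min 1 e.
  by rewrite divfK// gt_eqF.
have m1 : Num.min 1 e <= 1 by rewrite ge_min lexx.
have me : Num.min 1 e <= e by rewrite ge_min lexx orbT.
have eB : eta * B <= 1 / 2 by nra.
have eBD : 2 * (eta * B * D) <= e by nra.
have [|i|r r0 hr] := @finite_radius _ _ (fun i r => forall x1 x2,
    enorm (x1 - x) < r -> enorm (x2 - x) < r ->
    `|phi i x2 - phi i x1 - dot (a i) (x2 - x1)| <= eta * enorm (x2 - x1)).
- by move=> i r r' r'r h x1 x2 x1r x2r; apply: h; exact: lt_le_trans r'r.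
- exact: sphi.
exists (r / (D + e + 1)); first by rewrite divr_gt0//; lra.
move=> t t_gt0; rewrite ltr_pdivlMr; last by lra.
(* [rho] is twice the residual bound at [z = 0]; with contraction factor 1/2 the ball of this radius
   is mapped into itself. *)
move=> tr; pose rho := 2 * eta * t * D.
have rho0 : 0 <= rho.
  by do 3 (apply: mulr_ge0; [|by rewrite ?(ltW eta0) ?(ltW t_gt0)]).
have Brho : B * rho <= e * t by rewrite /rho; nra.
pose X (z : 'rV[R]_m) := x + t *: d + \sum_j z 0 j *: b j.
have Xd (z z' : 'rV_m) : enorm (X z - X z') <= B * `|z - z'|.
  have -> : X z - X z' = \sum_j (z - z') 0 j *: b j.
    under eq_bigr do rewrite !mxE scalerBl; rewrite sumrB /X.
    by rewrite opprD addrACA subrr add0r.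
  rewrite (le_trans (ler_enorm_sum _ _ _))// mulr_suml; apply: ler_sum => j _.
  by rewrite enormZ mulrC ler_wpM2l ?enorm_ge0// norm_coord_le_mx_norm.
have X0 : X 0 = x + t *: d.
  by rewrite /X big1 ?addr0// => j _; rewrite mxE scale0r.
have X0d z : enorm (X z - (x + t *: d)) <= B * `|z|.
  by rewrite -X0 (le_trans (Xd _ _))// subr0.
have Xr z : `|z| <= rho -> enorm (X z - x) < r.
  move=> zr; have : enorm (X z - x) <= B * `|z| + t * D.
    rewrite (le_trans (enorm_dist_trans (x + t *: d) _ _))// lerD//.
    by rewrite addrAC subrr add0r enormZ gtr0_norm.
  by have : B * `|z| <= B * rho by [rewrite ler_wpM2l]; nra.
(* A fixed point of [T] has zero residual in each equation indexed by [J]. *)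
pose T (z : 'rV[R]_m) : 'rV[R]_m := \row_i if i \in J
  then z 0 i - (phi i (X z) - phi i x - t * dot (a i) d) else 0.
pose U := [set z : 'rV[R]_m | `|z| <= rho].
have TD z z' : U z -> U z' -> `|T z - T z'| <= 1 / 2 * `|z - z'|.
  move=> Uz Uz'; apply: row_norm_le => [|i]; first by rewrite mulr_ge0.
  rewrite !mxE; case: ifPn => iJ; last by rewrite subrr normr0 mulr_ge0.
  have := hr i _ _ (Xr _ Uz') (Xr _ Uz).
  have -> : dot (a i) (X z - X z') = z 0 i - z' 0 i.
    have -> : X z - X z' = \sum_j (z - z') 0 j *: b j.
      under eq_bigr do rewrite !mxE scalerBl; rewrite sumrB /X.
      by rewrite opprD addrACA subrr add0r.
    rewrite dot_sumr (bigD1 i)//= dotZr dab.1// eqxx mulr1 !mxE big1 ?addr0// => j ji.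
    have [jJ|jJ] := boolP (j \in J); last by rewrite dab.2// scaler0 dot0r.
    by rewrite dotZr dab.1// eq_sym (negPf ji) mulr0.
  have := Xd z z'; have := normr_ge0 (z - z').
  set N := `|z - z'|; set E := enorm _ => N0' EN h.
  rewrite distrC; apply: le_trans (_ : eta * E <= _).
    by apply: le_trans h; rewrite le_eqVlt; apply/orP; left; apply/eqP; congr (`| _ |); ring.
  have : eta * E <= eta * (B * N) by rewrite ler_wpM2l// ltW.
  by move=> h'; apply: (le_trans h'); rewrite mulrA ler_wpM2r.
have T0 : `|T 0| <= rho / 2.
  apply: row_norm_le => [|i]; first by rewrite divr_ge0.
  rewrite !mxE; case: ifPn => iJ; last by rewrite normr0 divr_ge0.
  rewrite sub0r normrN X0.
  have xr : enorm (x - x) < r by rewrite subrr enorm0.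
  have xr' : enorm (x + t *: d - x) < r.
    by rewrite -X0; apply: Xr; rewrite normr0.
  have := hr i _ _ xr xr'.
  have -> : x + t *: d - x = t *: d by rewrite addrAC subrr add0r.
  rewrite dotZr enormZ (gtr0_norm t_gt0) -/D => h.
  by apply: (le_trans h); rewrite /rho; lra.
have TU z : U z -> U (T z).
  move=> Uz; have U0 : U 0 by rewrite /U/= normr0.
  rewrite /U/= -(subrK (T 0) (T z)) (le_trans (ler_normD _ _))//.
  have := TD _ _ Uz U0; rewrite subr0.
  by have : `|z| <= rho by []; lra.
have [z Uz Tz] : exists2 z, U z & z = T z.
  have q0 : 0 <= (1 / 2 : R) by [].
  have ctr : is_contraction (mkfun TU : {fun U >-> U}).
    exists (NngNum q0); split => /=; first by lra.
    by move=> [z z'] [/= Uz Uz']; exact: TD.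
  have clU : closed U.
    have -> : U = (@Num.norm _ 'rV[R]_m) @^-1` [set t | t <= rho] by [].
    apply: (iffLR (continuous_closedP _)); last exact: closed_le.
    exact: norm_continuous.
  have U0 : U !=set0 by exists 0; rewrite /U/= normr0.
  by have [z Uz Tz] := banach_fixed_point ctr clU U0; exists z.
exists (X z).
  rewrite -addrA -opprD (le_trans (X0d z))// (le_trans _ Brho)//.
  by rewrite ler_wpM2l.
move=> i iJ; have := congr1 (fun A : 'rV[R]_m => A 0 i) Tz.
rewrite /T mxE iJ; lra.
Qed.

End Curves.

(** * Regular subgradients in epsilon form *)

Section RegularSubgradients.
Context {R : realType} {n : nat}.
Implicit Types (f : 'rV[R]_n -> \bar R) (x v : 'rV[R]_n).

Lemma regular_subdiffP f x v : regular_subdiff f x v <->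
  f x \is a fin_num /\ forall e, 0 < e -> exists2 r, 0 < r &
    forall x', enorm (x' - x) < r ->
      ((fine (f x) + dot v (x' - x) - e * enorm (x' - x))%:E <= f x')%E.
Proof.
rewrite /regular_subdiff/= limf_einfE.
split=> -[ffin H]; split=> //.
  move: H; rewrite -{1}(fineK ffin); set F := fine (f x) => H e e0.
  have : ((- e)%:E < ereal_sup [set ereal_inf
      ((fun x0 : 'rV_n => ((f x0 - F%:E - (dot v (x0 - x))%:E)
        * ((enorm (x0 - x))^-1)%:E)%E) @` V) | V in x^'])%E.
    by apply: lt_le_trans H; rewrite lte_fin oppr_lt0.
  move=> /ereal_sup_gt[_ [A xA <-] eA].
  have /nbhs_enormP[r r0 rA] : nbhs x (fun y => y != x -> A y) by exact: xA.
  exists r => // x' /rA; have [->|x'x] := eqVneq x' x.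
    by rewrite subrr dot0r enorm0 mulr0 !addr0 subr0 /F fineK.
  move=> /(_ isT) Ax'.
  have N0 : 0 < enorm (x' - x) by rewrite enorm_gt0 subr_eq0.
  have := lt_le_trans eA (ereal_inf_lbound (imageP _ Ax')).
  case: (f x') => [t| |] /=.
  - by rewrite lte_fin lee_fin ltr_pdivlMr// => h; lra.
  - by rewrite leey.
  - by rewrite /= gt0_mulNye ?lte_fin ?invr_gt0.
apply/lee_addgt0Pr => e e0; rewrite -leeBlDr// sub0e.
have [r r0 hr] := H e e0.
(* The limit inferior is a supremum of infima over punctured neighborhoods, so bounding the infimum
   over one of them suffices. *)
pose A := [set y | enorm (y - x) < r /\ y != x].
have xA : x^' A by apply/nbhs_enormP; exists r => // y yr yx; split.
apply: le_trans (ereal_sup_ubound (imageP _ xA)).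
apply: le_ereal_inf_tmp => _ [y [yr yx] <-].
have N0 : 0 < enorm (y - x) by rewrite enorm_gt0 subr_eq0.
rewrite -(fineK ffin); have := hr _ yr; move: (fine (f x)) => F.
case: (f y) => [t| |] /=.
- by rewrite !lee_fin ler_pdivlMr// => h; lra.
- by move=> _; rewrite gt0_mulye ?lte_fin ?invr_gt0// leey.
- by rewrite leeNy_eq.
Qed.

End RegularSubgradients.

(** * Regular subgradients of the essential objective and multipliers *)

Section StationaryPoints.
Context {R : realType} {n m s : nat}.
Variables (phi0 : 'rV[R]_n -> R) (phi : 'I_m -> 'rV[R]_n -> R).
Variable J : {set 'I_m}.
Hypothesis sJ : forall i : 'I_m, (s <= i)%N -> i \in J.
Implicit Types (x v w : 'rV[R]_n) (y : 'rV[R]_m).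

Let f := essential_objective s phi0 phi.

Lemma essential_objectiveT x : feasible s phi x -> f x = (phi0 x)%:E.
Proof.
move=> fx; rewrite /f /essential_objective /indicator_fun.
by rewrite mem_set// adde0.
Qed.

Lemma essential_objectiveF x : ~ feasible s phi x -> f x = +oo%E.
Proof.
move=> fx; rewrite /f /essential_objective /indicator_fun.
by rewrite memNset// addey.
Qed.

Lemma fin_num_essential_objective x : f x \is a fin_num -> feasible s phi x.
Proof.
by have [//|fx] := pselect (feasible s phi x); rewrite essential_objectiveF.
Qed.

Lemma dot_multiplier_le0 x y : feasible s phi x -> multiplier_cone s y ->
  \sum_i y 0 i * phi i x <= 0.
Proof.
move=> /feasibleP[f1 f2] cy; apply: sumr_le0 => i _.
have [si|si] := leqP s i; first by rewrite f2// mulr0.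
by rewrite mulr_ge0_le0 ?f1//; exact: cy.
Qed.

(** On the feasible set the objective dominates the Lagrangian, with equality at [x] by
    complementarity, and the Lagrangian is differentiable at [x] with gradient [v]. *)
Lemma Lambda_regular_subdiff x v y : regular_point phi0 phi J x ->
  Lambda s phi0 phi x v y -> regular_subdiff f x v.
Proof.
move=> rx /(LambdaP _ _ rx)[fx cy vE y0]; have [[C0 C] _ _] := rx.
apply/regular_subdiffP; rewrite essential_objectiveT//; split=> // e e0.
pose Y := \sum_i `|y 0 i|.
have Y0 : 0 <= Y by apply: sumr_ge0.
have e1 : 0 < e / (1 + Y) by rewrite divr_gt0//; lra.
have [r0 r00 h0] := strict_diff C0 e1.
have [|i|r1 r10 h1] := @finite_radius _ _ (fun i r => forall x1 x2,
    enorm (x1 - x) < r -> enorm (x2 - x) < r ->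
    `|phi i x2 - phi i x1 - dot (grad (phi i) x) (x2 - x1)| <=
      e / (1 + Y) * enorm (x2 - x1)).
- by move=> i r r' r'r h x1 x2 x1r x2r; apply: h; exact: lt_le_trans r'r.
- by have [r r_gt0 h] := strict_diff (C i) e1; exists r.
exists (Num.min r0 r1); first by rewrite lt_min r00.
move=> x'; rewrite lt_min => /andP[x'0 x'1].
have [fx'|/essential_objectiveF->] := pselect (feasible s phi x'); last first.
  by rewrite leey.
rewrite (essential_objectiveT fx') lee_fin /=.
have xx r : 0 < r -> enorm (x - x) < r by rewrite subrr enorm0.
have := h0 _ _ (xx _ r00) x'0.
have : `|\sum_i y 0 i * (phi i x' - phi i x - dot (grad (phi i) x) (x' - x))|
    <= Y * (e / (1 + Y) * enorm (x' - x)).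
  rewrite /Y mulr_suml (le_trans (ler_norm_sum _ _ _))//; apply: ler_sum => i _.
  by rewrite normrM ler_wpM2l// h1// xx.
have -> : \sum_i y 0 i * (phi i x' - phi i x - dot (grad (phi i) x) (x' - x)) =
    \sum_i y 0 i * phi i x' - dot (v - grad phi0 x) (x' - x).
  rewrite vE addrAC subrr add0r dot_suml -sumrB; apply: eq_bigr => i _.
  by rewrite dotZl !mulrBr y0 subr0.
have := dot_multiplier_le0 fx' cy.
rewrite dotBl; set N := enorm _; set P := \sum_i _.
have eY : (1 + Y) * (e / (1 + Y) * N) = e * N.
  by rewrite mulrA (mulrC (1 + Y)) divfK// gt_eqF//; lra.
move: eY; set E := e / (1 + Y) * N => eY P0.
rewrite !ler_norml => /andP[a1 a2] /andP[b1 b2]; lra.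
Qed.

(** The curve prescribes the values of the constraints in [J] exactly, which handles the active
    ones; those negative at [x] stay negative by continuity, whether or not they belong to [J]. *)
Lemma feasible_curve x d e : regular_point phi0 phi J x -> feasible s phi x ->
  (forall i : 'I_m, (i < s)%N -> phi i x = 0 -> dot (grad (phi i) x) d <= 0) ->
  (forall i : 'I_m, (s <= i)%N -> dot (grad (phi i) x) d = 0) ->
  0 < e -> exists2 t0, 0 < t0 & forall t, 0 < t -> t < t0 -> exists x',
    [/\ feasible s phi x', enorm (x' - x - t *: d) <= e * t
      & forall i, i \in J -> phi i x' = phi i x + t * dot (grad (phi i) x) d].
Proof.
move=> rx fx d1 d2 e0; have [[_ C] J0 [b db]] := rx.
have /feasibleP[f1 f2] := fx.
have [|i|r r0 hr] := @finite_radius _ _ (fun i r => forall x',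
    enorm (x' - x) < r -> phi i x < 0 -> phi i x' < 0).
- by move=> i r r' r'r h x' x'r; apply: h; exact: lt_le_trans r'r.
- have [i0|i0] := leP 0 (phi i x); first by exists 1.
  have i00 : 0 < - phi i x by rewrite oppr_gt0.
  have [r r_gt0 hr] := C2_continuous (C i) i00.
  by exists r => // x' /hr; rewrite ltr_norml => /andP[_ h] _; lra.
have [t0 t00 ht] := curve db (fun i => strict_diff (C i)) d e0.
have d0 := enorm_ge0 d.
exists (Num.min t0 (r / (enorm d + e + 1))).
  by rewrite lt_min t00 divr_gt0//; lra.
move=> t t_gt0; rewrite lt_min ltr_pdivlMr; last by lra.
move=> /andP[tt0 tr]; have [x' x'd x'phi] := ht _ t_gt0 tt0.
exists x'; split=> //.
have x'r : enorm (x' - x) < r.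
  rewrite -(subrK (t *: d) (x' - x)) (le_lt_trans (ler_enormD _ _))//.
  by rewrite enormZ (gtr0_norm t_gt0); lra.
apply/feasibleP; split=> i si; last by rewrite x'phi ?sJ// f2// d2// mulr0 addr0.
have [i0|i0] := eqVneq (phi i x) 0; last by rewrite ltW// hr// lt_neqAle i0 f1.
have [iJ|/J0] := boolP (i \in J); last by rewrite i0 ltxx.
by rewrite x'phi// i0 add0r pmulr_rle0// d1.
Qed.

(** Along a feasible curve with direction [d], the subgradient inequality and the expansion of
    [phi0] would conflict at first order in [t] if the product were positive. *)
Lemma tangent_subgradient x v d : regular_point phi0 phi J x ->
  regular_subdiff f x v ->
  (forall i : 'I_m, (i < s)%N -> phi i x = 0 -> dot (grad (phi i) x) d <= 0) ->
  (forall i : 'I_m, (s <= i)%N -> dot (grad (phi i) x) d = 0) ->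
  dot (v - grad phi0 x) d <= 0.
Proof.
move=> rx; have [[C0 _] _ _] := rx.
move=> /regular_subdiffP[/fin_num_essential_objective fx].
rewrite essential_objectiveT//= => subv d1 d2.
set u := v - grad phi0 x; rewrite leNgt; apply/negP => c0.
set c := dot u d in c0.
(* [N] bounds the total coefficient of [e * t] in the errors, and [e] makes that total at most half
   of [c * t]. *)
pose N := enorm u + 2 * enorm d + 3.
have u0 := enorm_ge0 u; have d0 := enorm_ge0 d.
have N0 : 0 < N by rewrite /N; lra.
pose e := Num.min 1 (c / (2 * N)).
have e0 : 0 < e by rewrite lt_min ltr01 divr_gt0// mulr_gt0.
have e1 : e <= 1 by rewrite ge_min lexx.
have eN : e * N <= c / 2.
  have : e <= c / (2 * N) by rewrite ge_min lexx orbT.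
  by rewrite ler_pdivlMr ?mulr_gt0//; lra.
have [r0 r00 h0] := strict_diff C0 e0.
have [r1 r10 h1] := subv _ e0.
have [t0 t00 ht] := feasible_curve rx fx d1 d2 e0.
pose r3 := Num.min r0 r1.
have r30 : 0 < r3 by rewrite !lt_min r00 r10.
pose t := Num.min (t0 / 2) (r3 / (enorm d + 2)).
have t_gt0 : 0 < t by rewrite lt_min !divr_gt0//; lra.
have tt0 : t < t0.
  by rewrite (@le_lt_trans _ _ (t0 / 2))// ?ge_min ?lexx//; lra.
have tr : t * (enorm d + 2) <= r3.
  by rewrite -ler_pdivlMr ?ge_min ?lexx ?orbT//; lra.
have [x' [fx' x'd _]] := ht _ t_gt0 tt0.
have x'N : enorm (x' - x) <= t * enorm d + e * t.
  rewrite -(subrK (t *: d) (x' - x)) (le_trans (ler_enormD _ _))//.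
  by rewrite enormZ (gtr0_norm t_gt0); lra.
have : enorm (x' - x) < r3 by nra.
rewrite !lt_min => /andP[x'0 x'1].
have := h1 _ x'1; rewrite essential_objectiveT// lee_fin => g1.
have xr0 : enorm (x - x) < r0 by rewrite subrr enorm0.
have := h0 _ _ xr0 x'0; rewrite ler_norml => /andP[_ g2].
have g3 : dot u (x' - x) <= 2 * e * enorm (x' - x).
  by rewrite /u dotBl; lra.
have : dot u (x' - x) = dot u (x' - x - t *: d) + t * c.
  by rewrite (dotBr (x' - x)) dotZr subrK.
have := normr_dot_le u (x' - x - t *: d); rewrite ler_norml => /andP[g4 _] g5.
have g6 : t * c <= 2 * e * (t * enorm d + e * t) + enorm u * (e * t).
  have : enorm u * enorm (x' - x - t *: d) <= enorm u * (e * t) by rewrite ler_wpM2l.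
  have : 2 * e * enorm (x' - x) <= 2 * e * (t * enorm d + e * t) by rewrite ler_wpM2l//; lra.
  by lra.
have g7 : t * c <= t * (e * N).
  apply: (le_trans g6); rewrite /N.
  have et0 : 0 < e * t by rewrite mulr_gt0.
  by have : e * (e * t) <= e * t by [rewrite ler_piMl// ltW]; lra.
have : t * (e * N) <= t * (c / 2) by rewrite ler_pM2l.
by have := mulr_gt0 t_gt0 c0; lra.
Qed.

(** The dual system replaces Farkas' lemma: the multiplier is written explicitly, and each of its
    properties comes from testing the subgradient with suitable linearized feasible directions. *)
Lemma regular_subdiff_Lambda x v : regular_point phi0 phi J x ->
  regular_subdiff f x v -> exists y, Lambda s phi0 phi x v y.
Proof.
move=> rx sv; have [_ J0 [b [ab b0]]] := rx.
have fx : feasible s phi x.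
  by case/regular_subdiffP: sv => /fin_num_essential_objective.
have /feasibleP[f1 f2] := fx.
set u := v - grad phi0 x.
have T d := @tangent_subgradient x v d rx sv.
exists (\row_j dot u (b j)); apply/(LambdaP _ _ rx); split=> //.
- move=> j js; rewrite mxE; have [jJ|/b0->] := boolP (j \in J); last first.
    by rewrite dot0r.
  (* The direction [- b j] decreases constraint [j] and leaves the other constraints of [J]
     unchanged to first order. *)
  rewrite -oppr_le0 -dotNr; apply: T => i.
    move=> is0 i0; rewrite dotNr oppr_le0.
    have [iJ|/J0] := boolP (i \in J); last by rewrite i0 ltxx.
    by rewrite ab// ler0n.
  move=> si; rewrite dotNr ab ?(sJ si)//.
  by case: eqP => [ij|_]; [move: js; rewrite -ij ltnNge si|rewrite oppr0].
- apply: (addrI (- grad phi0 x)); rewrite addKr addrC -/u.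
  apply: dot_inj => d0.
  (* This projection is orthogonal to all gradients in [J], so [d] and [- d] are both admissible and
     [u] vanishes on it. *)
  pose d := d0 - \sum_j dot (grad (phi j) x) d0 *: b j.
  have ad i : i \in J -> dot (grad (phi i) x) d = 0.
    move=> iJ; rewrite dotBr dot_sumr (bigD1 i)//= dotZr ab// eqxx mulr1.
    rewrite big1 ?addr0 ?subrr// => j ji.
    have [jJ|jJ] := boolP (j \in J); last by rewrite b0// scaler0 dot0r.
    by rewrite dotZr ab// eq_sym (negPf ji) mulr0.
  have ad' i : phi i x = 0 -> dot (grad (phi i) x) d = 0.
    by move=> i0; apply: ad; apply: contraT => /J0; rewrite i0 ltxx.
  have : dot u d = 0.
    apply/eqP; rewrite eq_le; apply/andP; split.
      by apply: T => [i _ /ad'->//|i /sJ/ad].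
    rewrite -oppr_le0 -dotNr; apply: T => [i _ /ad'|i /sJ/ad]; rewrite dotNr => ->;
      by rewrite oppr0.
  rewrite dotBr => /eqP; rewrite subr_eq0 => /eqP->.
  rewrite dot_sumr dot_suml; apply: eq_bigr => j _.
  by rewrite mxE dotZr dotZl mulrC.
- move=> j; rewrite mxE; have [->|j0] := eqVneq (phi j x) 0; first by rewrite mulr0.
  have [jJ|/b0->] := boolP (j \in J); last by rewrite dot0r mul0r.
  have js : (j < s)%N.
    by rewrite ltnNge; apply: contra j0 => /f2->.
  (* For [j] inactive at [x], both [b j] and [- b j] are admissible directions, which forces the
     multiplier to be 0. *)
  have ij0 i : phi i x = 0 -> dot (grad (phi i) x) (b j) = 0.
    move=> i0; have iJ : i \in J by apply: contraT => /J0; rewrite i0 ltxx.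
    by rewrite ab//; case: eqP => // ij; move: j0; rewrite -ij i0 eqxx.
  suff -> : dot u (b j) = 0 by rewrite mul0r.
  apply/eqP; rewrite eq_le; apply/andP; split.
    by apply: T => [i _ /ij0->//|i /f2/ij0].
  rewrite -oppr_le0 -dotNr; apply: T => [i _ /ij0|i /f2/ij0]; rewrite dotNr => ->;
    by rewrite oppr0.
Qed.

End StationaryPoints.

(** * Local growth from the Hessian of the Lagrangian *)

Section PartialPositivity.
Context {R : realType} {n m : nat}.

Lemma dual_system_sub (J P : {set 'I_m}) (a b : 'I_m -> 'rV[R]_n) :
  P \subset J -> dual_system J a b ->
  dual_system P a (fun j => if j \in P then b j else 0).
Proof.
move=> /fintype.subsetP PJ [ab _]; split=> [i j iP jP|j /negPf->//].
by rewrite jP ab// PJ.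
Qed.

(* Finsler's lemma, with the dual vectors giving the penalty explicitly. *)
Lemma finsler (P : {set 'I_m}) (a b : 'I_m -> 'rV[R]_n) (H : 'M[R]_n) sigma tau :
  dual_system P a b ->
  (forall w, (forall i, i \in P -> dot (a i) w = 0) ->
    sigma * enorm w ^+ 2 <= quad_form H w) ->
  tau < sigma ->
  exists2 K, 0 <= K & forall w, tau * enorm w ^+ 2 <=
    quad_form H w + K * \sum_(i in P) dot (a i) w ^+ 2.
Proof.
move=> [ab b0] HP ts.
pose B := \sum_j enorm (b j); pose C := \sum_i \sum_j `|H i j|.
have B0 : 0 <= B by apply: sumr_ge0 => i _; exact: enorm_ge0.
have C0 : 0 <= C by apply: sumr_ge0 => i _; apply: sumr_ge0.
pose d := sigma - tau; have d0 : 0 < d by rewrite subr_gt0.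
pose k := `|sigma| + C; have k0 : 0 <= k by rewrite addr_ge0.
pose K := (k ^+ 2 / d + `|sigma| + 3 * C) * B ^+ 2.
have K1 : 0 <= k ^+ 2 / d + `|sigma| + 3 * C.
  by rewrite !addr_ge0// ?mulr_ge0// ?invr_ge0 ?ltW// exprn_gt0.
exists K => [|w]; first by rewrite mulr_ge0// exprn_ge0.
pose A := \sum_(i in P) dot (a i) w ^+ 2.
have A0 : 0 <= A by apply: sumr_ge0 => i _; rewrite sqr_ge0.
(* Subtracting [r] moves [w] into the kernel, and the square of [enorm r] is at most [B ^+ 2 * A],
   so terms in [r] can be charged to the penalty. *)
pose r := \sum_j dot (a j) w *: b j.
have rA : enorm r ^+ 2 <= B ^+ 2 * A.
  have : enorm r <= B * Num.sqrt A.
    rewrite (le_trans (ler_enorm_sum _ _ _))// mulr_suml; apply: ler_sum => j _.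
    rewrite enormZ mulrC; have [jP|jP] := boolP (j \in P); last first.
      by rewrite b0// enorm0 !mul0r.
    rewrite ler_wpM2l ?enorm_ge0// -sqrtr_sqr ler_sqrt//.
    rewrite /A (bigD1 j)//= lerDl; apply: sumr_ge0 => i _; exact: sqr_ge0.
  move=> h; rewrite -[A in leRHS](sqr_sqrtr A0) -exprMn.
  by rewrite lerXn2r// ?nnegrE ?enorm_ge0// mulr_ge0// sqrtr_ge0.
pose w0 := w - r; have wE : w = w0 + r by rewrite subrK.
have aw0 i : i \in P -> dot (a i) w0 = 0.
  move=> iP; rewrite dotBr dot_sumr (bigD1 i)//= dotZr ab// eqxx mulr1.
  rewrite big1 ?addr0 ?subrr// => j ji.
  have [jP|jP] := boolP (j \in P); last by rewrite b0// scaler0 dot0r.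
  by rewrite dotZr ab// eq_sym (negPf ji) mulr0.
have Hw0 := HP _ aw0.
have w0w : enorm w0 <= enorm w + enorm r by exact: ler_enormB.
have w0E : enorm w0 ^+ 2 = enorm w ^+ 2 - 2 * dot w r + enorm r ^+ 2.
  by rewrite !sqr_enorm /w0 !dotE (dotC r w); ring.
have QE : quad_form H w = quad_form H w0 + dot (w0 *m H^T) r
    + dot (r *m H^T) w0 + quad_form H r by rewrite -quad_formD -wE.
have := normr_bilin_le H w0 r; have := normr_bilin_le H r w0.
have := normr_bilin_le H r r; have := normr_dot_le w r.
rewrite -/(quad_form H r) -/C.
have := enorm_ge0 w; have := enorm_ge0 r; have := enorm_ge0 w0.
move: rA Hw0 w0w w0E QE; rewrite -/A.
set W := enorm w; set rho := enorm r; set W0 := enorm w0.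
move=> rA Hw0 w0w w0E QE W00 rho0 Wge0.
rewrite !ler_norml => /andP[c1 c2] /andP[h1 _] /andP[h2 _] /andP[h3 _].
have sge : - `|sigma| * (2 * (W * rho) + rho ^+ 2) <=
    sigma * (- 2 * dot w r + rho ^+ 2).
  have : `|sigma * (- 2 * dot w r + rho ^+ 2)| <=
      `|sigma| * (2 * (W * rho) + rho ^+ 2).
    rewrite normrM ler_wpM2l// ler_norml; apply/andP; split; nra.
  by rewrite ler_norml (mulNr `|sigma|) => /andP[].
have CW : C * (W0 * rho) <= C * ((W + rho) * rho) by rewrite ler_wpM2l// ler_wpM2r.
(* Young's inequality with weight [d]: the part in [W] uses up the gap between [sigma] and [tau],
   the part in [rho] goes into [K]. *)
have young : 2 * k * (W * rho) <= d * W ^+ 2 + k ^+ 2 / d * rho ^+ 2.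
  have : 0 <= d * (W - k / d * rho) ^+ 2 by rewrite mulr_ge0 ?(ltW d0) ?sqr_ge0.
  have -> : d * (W - k / d * rho) ^+ 2 =
    d * W ^+ 2 - 2 * k * (W * rho) + k ^+ 2 / d * rho ^+ 2.
    by field; rewrite gt_eqF.
  by lra.
have KA : (k ^+ 2 / d + `|sigma| + 3 * C) * rho ^+ 2 <= K * A.
  by rewrite /K -mulrA ler_wpM2l.
move: KA young; set kd := k ^+ 2 / d; rewrite /k /d => KA young.
rewrite QE; nra.
Qed.

End PartialPositivity.

Section LocalGrowth.
Context {R : realType} {n m s : nat}.
Variables (phi0 : 'rV[R]_n -> R) (phi : 'I_m -> 'rV[R]_n -> R).
Variable J : {set 'I_m}.
Hypothesis sJ : forall i : 'I_m, (s <= i)%N -> i \in J.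
Implicit Types (x v w : 'rV[R]_n) (y : 'rV[R]_m).

(** Taylor expansion produces the Hessian of the Lagrangian at the fixed pair, while the nonnegative
    term [- \sum_i y 0 i * phi i x'] supplies the quadratic penalty of Finsler's lemma, up to small
    errors. *)
Lemma local_growth x0 v0 y0 (sigma tau : R) :
  regular_point phi0 phi J x0 -> Lambda s phi0 phi x0 v0 y0 ->
  (forall w, Ssub s phi x0 y0 w ->
    sigma * enorm w ^+ 2 <= quad_form (hess_L phi0 phi x0 y0) w) ->
  tau < sigma ->
  exists2 r, 0 < r & forall x v y x',
    enorm (x - x0) < r -> enorm (v - v0) < r -> enorm (x' - x0) < r ->
    Lambda s phi0 phi x v y -> feasible s phi x' ->
    phi0 x + dot v (x' - x) + tau / 2 * enorm (x' - x) ^+ 2 <= phi0 x'.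
Proof.
move=> rx0 L0 HS ts; have [[C0 C] J0 [b db]] := rx0.
have /(LambdaP _ _ rx0)[fx0 cy0 vE0 y00] := L0.
pose P := (active_pos s phi x0 y0 :|: equality_idx m s)%SET.
have PJ : P \subset J.
  apply/fintype.subsetP => i; rewrite !inE => /orP[/andP[/andP[_ /eqP i0] _]|]; last exact: sJ.
  by apply: contraT => /J0; rewrite i0 ltxx.
pose delta := sigma - tau; have delta0 : 0 < delta by rewrite subr_gt0.
(* Half of the gap is kept to absorb the Taylor and multiplier errors, whose coefficients are
   collected in [N]. *)
pose tau' := tau + delta / 2.
have ts' : tau' < sigma by rewrite /tau' /delta; lra.
have [K K0 HK] := finsler (dual_system_sub PJ db) HS ts'.
pose Y := \sum_i `|y0 0 i|.
have Y0 : 0 <= Y by apply: sumr_ge0.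
pose Q i w := quad_form (hess (phi i) x0) w.
pose C' := \sum_k \sum_i \sum_j `|hess (phi k) x0 i j|.
have C'0 : 0 <= C'.
  by apply: sumr_ge0 => k _; apply: sumr_ge0 => i _; apply: sumr_ge0.
have QC i w : `|Q i w| <= C' * enorm w ^+ 2.
  rewrite /Q /quad_form (le_trans (normr_bilin_le _ _ _))// -expr2.
  rewrite ler_wpM2r ?sqr_ge0// /C' (bigD1 i)//= lerDl.
  by apply: sumr_ge0 => k _; apply: sumr_ge0 => i' _; apply: sumr_ge0.
(* [c] is at most half of every positive multiplier; since [e <= c], the corresponding nearby
   multipliers are still at least [c]. *)
have [|i|c c0 hc] := @finite_radius R _ (fun i r => 0 < y0 0 i -> r <= y0 0 i / 2).
- by move=> i r r' r'r h /h; exact: le_trans.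
- have [i0|i0] := ltP 0 (y0 0 i); last by exists 1.
  by exists (y0 0 i / 2); rewrite ?divr_gt0.
pose N : R := 1 + Y + m%:R + m%:R * C' / 2 + m%:R * K.
have mC0 : 0 <= m%:R * C' by rewrite mulr_ge0.
have mK0 : 0 <= m%:R * K by rewrite mulr_ge0.
have mR0 : 0 <= m%:R :> R by [].
have N0 : 0 < N by rewrite /N; lra.
pose e := Num.min 1 (Num.min c (delta / (4 * N))).
have e0 : 0 < e by rewrite !lt_min ltr01 c0 divr_gt0// mulr_gt0.
have e1 : e <= 1 by rewrite ge_min lexx.
have ec : e <= c by rewrite !ge_min lexx !orbT.
have eN : e * N <= delta / 4.
  have : e <= delta / (4 * N) by rewrite !ge_min lexx !orbT.
  by rewrite ler_pdivlMr ?mulr_gt0//; lra.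
have [r0 r00 h0] := C2_taylor2 C0 e0.
have mono (x1 x2 : 'rV[R]_n) (r r' : R) : r' <= r -> enorm (x1 - x2) < r' -> enorm (x1 - x2) < r.
  by move=> ? /lt_le_trans; exact.
have [|i|r1 r10 h1] := @finite_radius _ _ (fun i r => forall x1 x2,
    enorm (x1 - x0) < r -> enorm (x2 - x0) < r ->
    `|phi i x2 - phi i x1 - dot (grad (phi i) x1) (x2 - x1) - Q i (x2 - x1) / 2|
      <= e * enorm (x2 - x1) ^+ 2).
- by move=> i r r' r'r h x1 x2 x1r x2r; apply: h; exact: mono r'r _.
- by have [r r_gt0 h] := C2_taylor2 (C i) e0; exists r.
have [|i|r2 r20 h2] := @finite_radius _ _ (fun i r => forall x1 x2,
    enorm (x1 - x0) < r -> enorm (x2 - x0) < r ->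
    `|phi i x2 - phi i x1 - dot (grad (phi i) x0) (x2 - x1)| <= e * enorm (x2 - x1)).
- by move=> i r r' r'r h x1 x2 x1r x2r; apply: h; exact: mono r'r _.
- by have [r r_gt0 h] := strict_diff (C i) e0; exists r.
(* With active constraint values this small, [K] times the absolute value is at most [c], hence at
   most the multiplier, so the linear term dominates [K] times the square. *)
have cK0 : 0 < c / (K + 1) by rewrite divr_gt0//; lra.
have [|i|r3 r30 h3] := @finite_radius _ _ (fun i r => forall x1,
    enorm (x1 - x0) < r -> `|phi i x1 - phi i x0| < c / (K + 1)).
- by move=> i r r' r'r h x1 x1r; apply: h; exact: mono r'r _.
- by have [r r_gt0 h] := C2_continuous (C i) cK0; exists r.
have [r4 r40 h4] := Lambda_continuous rx0 L0 e0.
have [r5 r50 h5] := regular_point_open rx0.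
exists (Num.min (Num.min r0 r1) (Num.min (Num.min r2 r3) (Num.min r4 r5))).
  by rewrite !lt_min r00 r10 r20 r30 r40.
move=> x v y x'.
rewrite !lt_min => /andP[/andP[x0r x1r] /andP[/andP[x2r x3r] /andP[x4r x5r]]].
move=> /andP[_ /andP[_ /andP[v4r _]]].
move=> /andP[/andP[x'0r x'1r] /andP[/andP[x'2r x'3r] _]] L fx'.
have rx := h5 _ x5r; have ye := h4 _ _ _ x4r v4r L.
have /(LambdaP _ _ rx)[fx cy vE y_0] := L.
set d := x' - x; set D := enorm d ^+ 2.
have D0 : 0 <= D by exact: sqr_ge0.
pose E i := phi i x' - phi i x - dot (grad (phi i) x) d.
have sum_vE : phi0 x' - phi0 x - dot v d =
    (phi0 x' - phi0 x - dot (grad phi0 x) d) + \sum_i y 0 i * E i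
    - \sum_i y 0 i * phi i x'.
  have -> : \sum_i y 0 i * E i = \sum_i y 0 i * phi i x'
      - dot (\sum_i y 0 i *: grad (phi i) x) d.
    rewrite dot_suml -sumrB; apply: eq_bigr => i _.
    by rewrite /E !mulrBr y_0 subr0 dotZl.
  by rewrite vE dotDl; ring.
have E_0 : quad_form (hess phi0 x0) d / 2 - e * D <=
    phi0 x' - phi0 x - dot (grad phi0 x) d.
  have := h0 _ _ x0r x'0r; rewrite -/d -/D ler_norml => /andP[h _].
  by clear - h; lra.
have E_i : \sum_i (y0 0 i * Q i d / 2
    - (`|y0 0 i| + e) * (e * D) - e * (C' * D) / 2) <= \sum_i y 0 i * E i.
  apply: ler_sum => i _.
  have := h1 i _ _ x1r x'1r; rewrite -/d -/D -/(E i) => hE.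
  have yi : `|y 0 i| <= `|y0 0 i| + e.
    by rewrite -(subrKC (y0 0 i) (y 0 i)) (le_trans (ler_normD _ _))// lerD2l.
  have a1 : `|y 0 i * (E i - Q i d / 2)| <= (`|y0 0 i| + e) * (e * D).
    by rewrite normrM ler_pM.
  have a2 : `|(y 0 i - y0 0 i) * Q i d| <= e * (C' * D).
    by rewrite normrM ler_pM// QC.
  move: a1 a2; rewrite !ler_norml => /andP[a1 _] /andP[a2 _].
  by clear - a1 a2; lra.
have P_i : \sum_i ((if i \in P then K / 2 * dot (grad (phi i) x0) d ^+ 2 else 0)
    - K * (e * D)) <= - \sum_i y 0 i * phi i x'.
  rewrite -sumrN; apply: ler_sum => i _.
  have KeD : 0 <= K * (e * D).
    by apply: mulr_ge0 => //; apply: mulr_ge0 => //; exact: ltW.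
  have e2 : e ^+ 2 * D <= e * D.
    by rewrite ler_wpM2r// expr2 ler_piMl// ltW.
  have /feasibleP[f1 f2] := fx; have /feasibleP[f1' f2'] := fx'.
  case: ifPn => iP; last first.
    rewrite sub0r lerN2; apply: le_trans KeD.
    have [si|si] := leqP s i; first by rewrite f2'// mulr0.
    by rewrite mulr_ge0_le0 ?f1'//; exact: cy.
  have := h2 i _ _ x2r x'2r; rewrite -/d.
  (* For an equality constraint both values vanish, so the linearization along [d] is itself only of
     order [e * enorm d]. *)
  move: iP; rewrite !inE => /orP[/andP[/andP[si /eqP i0] yi0]|si]; last first.
    rewrite f2// f2'// mulr0 oppr0 addr0 sub0r normrN => ad.
    have : dot (grad (phi i) x0) d ^+ 2 <= e ^+ 2 * D.
      by rewrite -real_normK ?num_real// /D -exprMn lerXn2r// nnegrE// mulr_ge0 ?enorm_ge0// ltW.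
    by clear - e2 K0; nra.
  (* A positive multiplier remains positive nearby, and complementarity then makes the constraint
     vanish at [x]. *)
  have yic : c <= y 0 i.
    by have := hc _ yi0; have := ye i; rewrite ler_norml => /andP[+ _]; clear - ec; lra.
  have -> : phi i x = 0.
    by apply/eqP; have /eqP := y_0 i; rewrite mulf_eq0 gt_eqF// (lt_le_trans c0).
  rewrite subr0 => ad.
  have := h3 i _ x'3r; rewrite i0 subr0 ltr_pdivlMr ?ltr_wpDl//.
  have p0 := f1' i si; rewrite (ler0_norm p0) => pK.
  have ad2 : (phi i x' - dot (grad (phi i) x0) d) ^+ 2 <= e ^+ 2 * D.
    by rewrite -real_normK ?num_real// /D -exprMn lerXn2r// nnegrE// mulr_ge0 ?enorm_ge0// ltW.
  move: ad2 pK p0; set p := phi i x'; set g := dot _ d => ad2 pK p0.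
  have g2 : g ^+ 2 <= 2 * p ^+ 2 + 2 * (e * D).
    by have := sqr_ge0 (2 * p - g); clear - ad2 e2; nra.
  have pp : K * p ^+ 2 <= - (y 0 i * p).
    have : K * - p <= y 0 i by clear - pK p0 yic; nra.
    by clear - p0; nra.
  have : K / 2 * g ^+ 2 <= K / 2 * (2 * p ^+ 2 + 2 * (e * D)).
    by rewrite ler_wpM2l// divr_ge0.
  by clear - pp; lra.
have := HK d; rewrite quad_form_hess_L// -/D.
have -> : \sum_(i in P) dot (grad (phi i) x0) d ^+ 2 =
    \sum_i (if i \in P then dot (grad (phi i) x0) d ^+ 2 else 0) by rewrite big_mkcond.
move: P_i E_i; rewrite !sumrB !sumr_const card_ord -!mulr_suml.
have -> : \sum_i (if i \in P then K / 2 * dot (grad (phi i) x0) d ^+ 2 else 0) =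
    K / 2 * \sum_i (if i \in P then dot (grad (phi i) x0) d ^+ 2 else 0).
  by rewrite mulr_sumr; apply: eq_bigr => i _; case: ifP => // _; rewrite mulr0.
rewrite big_split/= sumr_const card_ord -/Y -(mulr_natl e).
rewrite -[(K * _) *+ m]mulr_natl -[(e * (C' * D) / 2) *+ m]mulr_natl.
set SP := \sum_i (if _ then _ else _); set SQ := \sum_i y0 0 i * _.
move=> P_i E_i hK.
have eND : e * N * D <= delta / 4 * D by rewrite ler_wpM2r.
have meeD : m%:R * e * (e * D) <= m%:R * (e * D).
  by rewrite -mulrA ler_wpM2l// ler_piMl// mulr_ge0// ltW.
rewrite /N in eND; rewrite /tau' in hK; 
move: sum_vE E_0 E_i P_i hK eND meeD; clear; rewrite /delta.
nra.
Qed.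

End LocalGrowth.

(** * From local to uniform growth *)

(* A function on [0, 1] with locally supporting slopes is globally supported
   at 0, since the slopes have to be nondecreasing. *)
Lemma local_support_global (R : realType) (f q : R -> R) :
  (forall t, 0 <= t <= 1 -> exists2 r, 0 < r & forall t1 t2, 0 <= t1 <= 1 ->
    0 <= t2 <= 1 -> `|t1 - t| < r -> `|t2 - t| < r ->
    f t1 + q t1 * (t2 - t1) <= f t2) ->
  f 0 + q 0 <= f 1.
Proof.
move=> H.
have mono t1 t2 : t1 < t2 -> f t1 + q t1 * (t2 - t1) <= f t2 ->
  f t2 + q t2 * (t1 - t2) <= f t1 -> q t1 <= q t2.
  move=> t12 h1 h2; have : 0 < t2 - t1 by rewrite subr_gt0.
  nra.
(* A continuation argument: the claim is carried along together with monotonicity of the slope, and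
   the supremum of [A] is shown to be 1 and to be attained. *)
pose A := [set T | 0 <= T <= 1 /\ q 0 <= q T /\ f 0 + q 0 * T <= f T].
have A0 : A 0 by rewrite /A/= lexx ler01 mulr0 addr0 !lexx.
have supA : has_sup A by split; [exists 0|exists 1 => t [/andP[]]].
pose T := sup A.
have T01 : 0 <= T <= 1.
  by rewrite sup_upper_bound//= ge_sup//; [exists 0|move=> t [/andP[]]].
have [r r0 hr] := H _ T01.
have [t1 [/andP[t10 t11] [qt1 ft1]] Tt1] : exists2 t1, A t1 & T - r < t1.
  exact: sup_adherent.
have t1T : t1 <= T.
  by apply: sup_upper_bound => //; rewrite /A/= t10 t11.
have near1 : `|t1 - T| < r by rewrite ltr_norml; apply/andP; split; lra.
(* Near the supremum the mutual support of [t1] and [t2] extends both inequalities past [t1]. *)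
have ext t2 : t1 < t2 -> t2 <= 1 -> t2 < T + r -> A t2.
  move=> t12 t21 t2T.
  have near2 : `|t2 - T| < r by rewrite ltr_norml; apply/andP; split; lra.
  have i1 : 0 <= t1 <= 1 by rewrite t10.
  have i2 : 0 <= t2 <= 1 by apply/andP; split; lra.
  have h1 := hr _ _ i1 i2 near1 near2; have h2 := hr _ _ i2 i1 near2 near1.
  have q12 := mono _ _ t12 h1 h2.
  split=> //; split; first exact: le_trans q12.
  have : 0 < t2 - t1 by rewrite subr_gt0.
  nra.
suff [_ [_]] : A 1 by rewrite mulr1.
have [T1|T1] := ltP T 1.
  pose t2 := Num.min 1 (T + r / 2).
  have : A t2.
    by apply: ext; rewrite /t2 ?lt_min ?gt_min ?ge_min ?lexx//;
      [apply/andP; split; lra|apply/orP; right; lra].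
  move=> /(sup_upper_bound supA); rewrite -/T /t2 ge_min => /orP[]; lra.
have TE : T = 1 by apply/eqP; rewrite eq_le T1 andbT; case/andP: T01.
have [t1E|t1N] := eqVneq t1 1; last first.
  apply: ext; rewrite ?TE//; last lra.
  by rewrite lt_neqAle t1N.
by rewrite -t1E /A/= t10 t11.
Qed.

(* The Moreau envelope inherits convexity: with [z = x + v], the modulus [tau]
   of [h] becomes [tau / (1 + tau)] for [z |-> h x + |v|^2 / 2]. *)
Lemma envelope_support (R : realType) (n : nat) (h1 h2 tau : R)
    (x1 x2 v1 v2 : 'rV[R]_n) :
  0 < 1 + tau ->
  h1 + dot v1 (x2 - x1) + tau / 2 * enorm (x2 - x1) ^+ 2 <= h2 ->
  h1 + enorm v1 ^+ 2 / 2 + dot v1 (x2 + v2 - (x1 + v1))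
    + tau / (1 + tau) / 2 * enorm (x2 + v2 - (x1 + v1)) ^+ 2
  <= h2 + enorm v2 ^+ 2 / 2.
Proof.
move=> tau1; have -> : x2 + v2 - (x1 + v1) = (x2 - x1) + (v2 - v1).
  by rewrite opprD addrACA.
have {3}-> : v2 = v1 + (v2 - v1) by rewrite subrKC.
move: (x2 - x1) (v2 - v1) => a b; rewrite dotDr (sqr_enormD v1) => hab.
have : tau / (1 + tau) * enorm (a + b) ^+ 2 <= tau * enorm a ^+ 2 + enorm b ^+ 2.
  rewrite mulrAC ler_pdivrMr//; have := sqr_ge0 (enorm (tau *: a - b)).
  rewrite sqr_enormB sqr_enormD enormZ exprMn real_normK ?num_real// dotZl.
  by clear; lra.
by clear - hab; lra.
Qed.

(** * The proximal map and uniform growth *)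

Section Prox.
Context {R : realType} {n : nat}.
Implicit Types (x v z u : 'rV[R]_n).
Variables (F : set 'rV[R]_n) (h : 'rV[R]_n -> R).
Variables (K : 'rV[R]_n -> 'rV[R]_n -> Prop) (xbar : 'rV[R]_n) (R0 : R).
Hypothesis R0_gt0 : 0 < R0.
Hypothesis KF : forall x v, K x v -> F x.
Hypothesis Kbar : K xbar 0.
Hypothesis Kprox : forall x v r, enorm (x - xbar) < R0 -> F x -> 0 < r ->
  (forall x', F x' -> enorm (x' - x) < r ->
    h x + dot v (x' - x) - enorm (x' - x) ^+ 2 / 2 <= h x') -> K x v.
Hypothesis argmin : forall r z, 0 < r -> r < R0 ->
  exists2 u, F u /\ enorm (u - xbar) <= r &
    forall u', F u' -> enorm (u' - xbar) <= r ->
      h u + enorm (u - z) ^+ 2 / 2 <= h u' + enorm (u' - z) ^+ 2 / 2.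

(** [F], [h] and [K] abstract the feasible set, the objective and the pairs having a multiplier.
    Negative [tau] is allowed: modulus -1/2 is the starting estimate. *)
Definition uniform_growth tau r := forall x v x',
  enorm (x - xbar) < r -> enorm v < r -> enorm (x' - xbar) < r ->
  K x v -> F x' -> h x + dot v (x' - x) + tau / 2 * enorm (x' - x) ^+ 2 <= h x'.

Lemma growth_monotone tau x1 v1 x2 v2 :
  h x1 + dot v1 (x2 - x1) + tau / 2 * enorm (x2 - x1) ^+ 2 <= h x2 ->
  h x2 + dot v2 (x1 - x2) + tau / 2 * enorm (x1 - x2) ^+ 2 <= h x1 ->
  tau * enorm (x1 - x2) ^+ 2 <= dot (v1 - v2) (x1 - x2).
Proof.
rewrite (enorm_distC x2) -(opprB x1 x2) dotNr dotBl; lra.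
Qed.

(** [X z] minimizes [h] plus half the squared distance to [z] over [F] in a small ball. Growth at
    [(xbar, 0)] keeps the minimizer inside the ball, hence in [K], and the hypomonotonicity of [K]
    with modulus -1/2 yields uniqueness and the Lipschitz bound. *)
Lemma prox_exists r : 0 < r -> uniform_growth (- (1 / 2)) r ->
  exists2 rho, 0 < rho & exists X : 'rV[R]_n -> 'rV[R]_n,
  [/\ rho <= r,
      forall z, enorm (z - xbar) < rho ->
        [/\ enorm (X z - xbar) <= 4 * enorm (z - xbar), K (X z) (z - X z)
          & forall u, F u -> enorm (u - xbar) < rho ->
            h (X z) + enorm (X z - z) ^+ 2 / 2 <= h u + enorm (u - z) ^+ 2 / 2],
      forall z z', enorm (z - xbar) < rho -> enorm (z' - xbar) < rho ->
        enorm (X z - X z') <= 2 * enorm (z - z')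
    & forall x v, enorm (x - xbar) < r -> enorm v < r -> K x v ->
        enorm (x + v - xbar) < rho -> X (x + v) = x].
Proof.
move=> r0 gr; pose r' := Num.min r R0 / 2.
have r'r : r' < r.
  have : Num.min r R0 <= r by rewrite ge_min lexx.
  by rewrite /r'; lra.
have r'R : r' < R0.
  have : Num.min r R0 <= R0 by rewrite ge_min lexx orbT.
  by have := R0_gt0; rewrite /r'; lra.
have r'0 : 0 < r' by rewrite divr_gt0// lt_min r0.
have /choice[X HX] : forall z, exists u, [/\ F u, enorm (u - xbar) <= r' &
    forall u', F u' -> enorm (u' - xbar) <= r' ->
      h u + enorm (u - z) ^+ 2 / 2 <= h u' + enorm (u' - z) ^+ 2 / 2].
  by move=> z; have [u [Fu ur] uP] := argmin z r'0 r'R; exists u.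
have Fbar := KF Kbar.
have xx0 a : 0 < a -> enorm (xbar - xbar) < a by rewrite subrr enorm0.
(* Comparing the minimizer with [xbar] and using growth there gives, for [a = X z - xbar] and
   [b = z - xbar], a quarter of the square of [enorm a] bounded by [dot a b]. *)
have Xz z : enorm (X z - xbar) <= 4 * enorm (z - xbar).
  have [FX Xr XP] := HX z.
  have := XP xbar Fbar (ltW (xx0 _ r'0)).
  have v0r : enorm (0 : 'rV[R]_n) < r by rewrite enorm0.
  have := gr xbar 0 (X z) (xx0 _ r0) v0r (le_lt_trans Xr r'r) Kbar FX.
  rewrite dot0l addr0 (enorm_distC xbar).
  have -> : X z - z = (X z - xbar) - (z - xbar) by rewrite opprB addrA subrK.
  set a := X z - xbar; set b := z - xbar => h1 h2.
  have := dot_le_enorm a b; have := enorm_ge0 a; have := enorm_ge0 b.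
  rewrite sqr_enormB in h2 => b0 a0 ab.
  have h3 : enorm a * enorm a <= enorm a * (4 * enorm b) by nra.
  have [->|aN] := eqVneq (enorm a) 0; first by rewrite mulr_ge0.
  by rewrite -(ler_pM2l (_ : 0 < enorm a))// lt_def aN.
pose rho := r' / 16; have rho0 : 0 < rho by rewrite divr_gt0.
have rhor' : 16 * rho = r' by rewrite /rho; field.
have Xr z : enorm (z - xbar) < rho -> enorm (X z - xbar) < r' / 2.
  by move=> zr; have := Xz z; lra.
have XK z : enorm (z - xbar) < rho -> K (X z) (z - X z).
  move=> zr; have [FX _ XP] := HX z; have Xr' := Xr _ zr.
  apply: (Kprox (r := r' / 2)) => //; [by lra|by lra|].
  move=> x' Fx' x'X.
  have x'r : enorm (x' - xbar) <= r'.
    by rewrite (le_trans (enorm_dist_trans (X z) _ _))//; lra.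
  have := XP _ Fx' x'r.
  have -> : x' - z = (x' - X z) - (z - X z) by rewrite opprB addrA subrK.
  have -> : X z - z = - (z - X z) by rewrite opprB.
  rewrite enormN; set a := x' - X z; set b := z - X z.
  by rewrite sqr_enormB (dotC a b); lra.
have Vr z : enorm (z - xbar) < rho -> enorm (z - X z) < r.
  move=> zr; have := Xr _ zr; have := enorm_dist_trans xbar z (X z).
  by rewrite (enorm_distC xbar); lra.
(* Since [v1 - v2 = b - a], monotonicity up to -1/2 leaves half of the square of [enorm a] below
   [dot b a]. *)
have key x1 v1 x2 v2 : enorm (x1 - xbar) < r -> enorm v1 < r -> K x1 v1 ->
    enorm (x2 - xbar) < r -> enorm v2 < r -> K x2 v2 ->
    enorm (x1 - x2) <= 2 * enorm (x1 + v1 - (x2 + v2)).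
  move=> x1r v1r K1 x2r v2r K2.
  have g1 := gr _ _ _ x1r v1r x2r K1 (KF K2).
  have g2 := gr _ _ _ x2r v2r x1r K2 (KF K1).
  have := growth_monotone g1 g2.
  have -> : v1 - v2 = (x1 + v1 - (x2 + v2)) - (x1 - x2).
    by rewrite opprD addrACA [RHS]addrC addKr.
  set a := x1 - x2; set b := _ - (x2 + v2).
  have := dot_le_enorm b a; rewrite dotBl -sqr_enorm => ba h1.
  have h3 : enorm a * enorm a <= enorm a * (2 * enorm b) by nra.
  have [->|aN] := eqVneq (enorm a) 0; first by rewrite mulr_ge0// enorm_ge0.
  by rewrite -(ler_pM2l (_ : 0 < enorm a))// lt_def aN enorm_ge0.
exists rho => //; exists X; split=> //.
- by lra.
- move=> z zr; split=> //; first exact: XK.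
  by move=> u Fu ur; have [_ _] := HX z; apply=> //; lra.
- move=> z z' zr z'r.
  have := key (X z) (z - X z) (X z') (z' - X z'); rewrite !subrKC; apply.
  + by have := Xr _ zr; lra.
  + exact: Vr.
  + exact: XK.
  + by have := Xr _ z'r; lra.
  + exact: Vr.
  + exact: XK.
- move=> x v xr vr Kxv zr; apply/eqP; rewrite -subr_eq0 -enorm_eq0.
  rewrite eq_le enorm_ge0 andbT.
  have := key (X (x + v)) (x + v - X (x + v)) x v.
  rewrite subrKC subrr enorm0 mulr0; apply=> //.
  + by have := Xr _ zr; lra.
  + exact: Vr.
  + exact: XK.
Qed.

(** The radius in the local assumption may depend on the pair and on [tau]; support along segments
    in [z] removes this dependence. *)
Lemma growth_extend sigma r r1 : 0 <= sigma -> 0 < r ->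
  uniform_growth (- (1 / 2)) r -> 0 < r1 ->
  (forall x v tau, enorm (x - xbar) < r1 -> enorm v < r1 -> K x v ->
    tau < sigma -> exists2 rho, 0 < rho & forall x1 v1 x2,
      enorm (x1 - x) < rho -> enorm (v1 - v) < rho -> enorm (x2 - x) < rho ->
      K x1 v1 -> F x2 ->
      h x1 + dot v1 (x2 - x1) + tau / 2 * enorm (x2 - x1) ^+ 2 <= h x2) ->
  exists2 r2, 0 < r2 & uniform_growth sigma r2.
Proof.
move=> s0 r0 gr r10 Hloc.
have [rho rho0 [X [rhor HX Xlip Xfix]]] := prox_exists r0 gr.
pose rho1 := Num.min rho (r1 / 5).
have rho10 : 0 < rho1 by rewrite lt_min rho0 divr_gt0.
(* The radius [r2] below depends on [sigma] but not on [tau]; the factor [5 + 2 * sigma] keeps both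
   ends of the segment in [z] within [rho1]. *)
have rho1rho : rho1 <= rho by rewrite ge_min lexx.
have rho1r1 : rho1 <= r1 / 5 by rewrite ge_min lexx orbT.
pose r2 := rho1 / (5 + 2 * sigma).
have r20 : 0 < r2 by rewrite divr_gt0//; lra.
have r2E : r2 * (5 + 2 * sigma) = rho1 by rewrite divfK// gt_eqF//; lra.
have r2rho : 5 * r2 <= rho1 by nra.
exists r2 => // x v x' xr vr x'r Kxv Fx'.
set d := x' - x.
have dr : enorm d < 2 * r2.
  by rewrite (le_lt_trans (enorm_dist_trans xbar _ _))// (enorm_distC xbar); lra.
have main tau : sigma - 1 / 2 <= tau -> tau < sigma ->
    h x + dot v d + tau / 2 * enorm d ^+ 2 <= h x'.
  move=> ts1 ts2; have tau1 : 0 < 1 + tau by lra.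
  have taus : `|tau| <= sigma + 1 by rewrite ler_norml; apply/andP; split; lra.
  (* With this endpoint, bounding the envelope at [z1] by the value at [x'] turns curvature
     [tau / (1 + tau)] along the segment into exactly modulus [tau] between [x] and [x']. *)
  pose z0 := x + v; pose z1 := x' + v + tau *: d.
  have z0r : enorm (z0 - xbar) < rho1.
    by rewrite /z0 addrAC (le_lt_trans (ler_enormD _ _))//; lra.
  have z1r : enorm (z1 - xbar) < rho1.
    have -> : z1 - xbar = (x' - xbar) + v + tau *: d.
      by rewrite /z1; apply/rowP => k; rewrite !mxE; ring.
    have := ler_enormD (x' - xbar + v) (tau *: d).
    have := ler_enormD (x' - xbar) v.
    rewrite enormZ.
    have : `|tau| * enorm d <= (sigma + 1) * (2 * r2).
      by rewrite ler_pM ?enorm_ge0// ltW.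
    by nra.
  pose D := z1 - z0.
  have DE : D = (1 + tau) *: d.
    by rewrite /D /z1 /z0 scalerDl scale1r /d; apply/rowP => k; rewrite !mxE; ring.
  pose z (t : R) := z0 + t *: D.
  have zr t : 0 <= t <= 1 -> enorm (z t - xbar) < rho1 by exact: enorm_segment.
  pose V t := z t - X (z t).
  pose kappa := tau / (1 + tau).
  pose N := enorm D ^+ 2.
  pose e t := h (X (z t)) + enorm (V t) ^+ 2 / 2.
  (* After removal of the expected quadratic, local support with slopes [q] is what the envelope
     inequality provides. *)
  pose f t := e t - kappa / 2 * t ^+ 2 * N.
  pose q t := dot (V t) D - kappa * t * N.
  have : f 0 + q 0 <= f 1.
    apply: local_support_global => t t01.
    have zt := zr _ t01; have ztr := lt_le_trans zt rho1rho.
    have [Xt Kt _] := HX _ ztr.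
    have Xr1 : enorm (X (z t) - xbar) < r1 by clear - Xt zt rho1r1 rho10; lra.
    have Vr1 : enorm (V t) < r1.
      have := enorm_dist_trans xbar (z t) (X (z t)).
      by rewrite (enorm_distC xbar) -/(V t); clear - Xt zt rho1r1; lra.
    have [c c0 hc] := Hloc _ _ _ Xr1 Vr1 Kt ts2.
    have D0 := enorm_ge0 D.
    (* [X] is 2-Lipschitz, so [V] is 3-Lipschitz in [z]; adding 1 keeps the divisor positive when
       [D = 0]. *)
    exists (c / (3 * enorm D + 1)); first by rewrite divr_gt0// ltr_wpDl// mulr_ge0.
    have D1 : 0 < 3 * enorm D + 1 by clear - D0; lra.
    move=> t1 t2 t101 t201; rewrite !ltr_pdivlMr// => t1t t2t.
    have zd a b : enorm (z a - z b) = `|a - b| * enorm D.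
      by rewrite -enormZ /z opprD addrACA subrr add0r scalerBl.
    have Xc a : 0 <= a <= 1 -> `|a - t| * (3 * enorm D + 1) < c ->
        enorm (X (z a) - X (z t)) < c /\ enorm (V a - V t) < c.
      move=> a01 ac; have zar := lt_le_trans (zr _ a01) rho1rho.
      have := Xlip _ _ zar ztr; rewrite zd => l1.
      have -> : V a - V t = (z a - z t) - (X (z a) - X (z t)).
        rewrite /V !opprB addrACA [RHS]addrACA; congr (_ + _); exact: addrC.
      have := ler_enormB (z a - z t) (X (z a) - X (z t)); rewrite zd => l2.
      have := normr_ge0 (a - t).
      have := mulr_ge0 (normr_ge0 (a - t)) D0.
      by clear - l1 l2 ac; split; lra.
    have [X1c V1c] := Xc _ t101 t1t; have [X2c V2c] := Xc _ t201 t2t.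
    have [_ K1 _] := HX _ (lt_le_trans (zr _ t101) rho1rho).
    have [_ K2 _] := HX _ (lt_le_trans (zr _ t201) rho1rho).
    have := envelope_support (V t2) tau1 (hc _ _ _ X1c V1c X2c K1 (KF K2)).
    rewrite -/(V t1) -/kappa !subrKC.
    have -> : z t2 - z t1 = (t2 - t1) *: D.
      by rewrite /z opprD addrACA subrr add0r -scalerBl.
    rewrite dotZr enormZ exprMn real_normK ?num_real// /f /q /e -/N.
    by clear; lra.
  rewrite /f /q /e.
  have z0E : z 0 = z0 by rewrite /z scale0r addr0.
  have z1E : z 1 = z1 by rewrite /z scale1r /D subrKC.
  have Xz0 : X z0 = x.
    by apply: Xfix => //; clear - xr vr z0r r2rho rho1rho rhor r20; lra.
  rewrite /V z0E z1E Xz0.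
  have -> : z0 - x = v by rewrite /z0 addrAC subrr add0r.
  have [_ _ /(_ x' Fx')] := HX z1 (lt_le_trans z1r rho1rho).
  have x'rho : enorm (x' - xbar) < rho by lra.
  move=> /(_ x'rho).
  have -> : x' - z1 = - (v + tau *: d).
    by rewrite /z1 -addrA opprD addrA subrr add0r.
  rewrite (enorm_distC (X z1)) enormN /N DE enormZ (gtr0_norm tau1).
  rewrite (sqr_enormD v) (enormZ tau) !exprMn real_normK ?num_real// !dotZr.
  set dd := enorm d ^+ 2.
  have -> : kappa / 2 * 1 ^+ 2 * ((1 + tau) ^+ 2 * dd) =
      tau * (1 + tau) / 2 * dd.
    by rewrite /kappa; field; rewrite gt_eqF.
  by lra.
(* As the neighborhood is the same for all [tau], [tau = sigma - c] can tend to [sigma]. *)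
apply/ler_addgt0Pr => eps eps0.
have N0 : 0 <= enorm d ^+ 2 by exact: sqr_ge0.
pose c := Num.min (1 / 2) (eps / (enorm d ^+ 2 + 1)).
have c0 : 0 < c by rewrite lt_min divr_gt0//= divr_gt0//; lra.
have c1 : c <= 1 / 2 by rewrite ge_min lexx.
have ceps : c * (enorm d ^+ 2 + 1) <= eps.
  by rewrite -ler_pdivlMr ?ge_min ?lexx ?orbT//; lra.
have := main (sigma - c); rewrite lerB// gtrBl => /(_ isT c0).
by have : 0 <= c * enorm d ^+ 2 by [rewrite mulr_ge0// ltW]; lra.
Qed.

End Prox.

(** * Variational convexity *)

Section Subgradients.
Context {R : realType} {n : nat}.
Implicit Types (f theta : 'rV[R]_n -> \bar R) (x v : 'rV[R]_n).

Lemma regular_subdiff_subdiff f x v : regular_subdiff f x v -> subdiff f x v.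
Proof.
move=> sv; split; first by case: sv.
by exists (fun=> x), (fun=> v); split => //; exact: cvg_cst.
Qed.

Lemma subdiff_approx f x v : subdiff f x v -> f x \is a fin_num /\
  forall e, 0 < e -> exists x1 v1,
    [/\ enorm (x1 - x) < e, enorm (v1 - v) < e, regular_subdiff f x1 v1
      & `|fine (f x1) - fine (f x)| < e].
Proof.
move=> [ffin [xk [vk [xkx fk regk vkv]]]]; split=> // e e0.
have H1 := iffLR (cvg_enormP xk x _) xkx e e0.
have H2 := iffLR (cvg_enormP vk v _) vkv e e0.
rewrite -(fineK ffin) in fk; have /fine_cvgP[_ /cvgrPdist_lt/(_ e e0) H3] := fk.
near \oo => k; exists (xk k), (vk k); split.
- by near: k; exact: H1.
- by near: k; exact: H2.
- exact: regk.
- by rewrite distrC; near: k; exact: H3.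
Unshelve. all: by end_near. Qed.

(** Closes the growth inequality under limits of the value, the point and the subgradient: a
    violation by [g - T] would survive errors of size [e * N]. It transfers growth from regular to
    limiting subgradients. *)
Lemma support_limit (sigma a T : R) x v x' :
  (forall e, 0 < e -> exists a1 x1 v1,
    [/\ a - e < a1, enorm (x1 - x) < e, enorm (v1 - v) < e
      & a1 + dot v1 (x' - x1) + sigma / 2 * enorm (x' - x1) ^+ 2 <= T]) ->
  a + dot v (x' - x) + sigma / 2 * enorm (x' - x) ^+ 2 <= T.
Proof.
move=> H; set d := x' - x; rewrite leNgt; apply/negP => c0.
set g := _ + _ in c0; have {}c0 : 0 < g - T by rewrite subr_gt0.
have d0 := enorm_ge0 d; have v0 := enorm_ge0 v.
have s0 := normr_ge0 sigma.
pose N := 2 + enorm d + enorm v + `|sigma| * (enorm d + 1).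
have sd0 : 0 <= `|sigma| * (enorm d + 1) by rewrite mulr_ge0//; lra.
have N0 : 0 < N by rewrite /N; lra.
pose e := Num.min 1 ((g - T) / N).
have e0 : 0 < e by rewrite lt_min ltr01 divr_gt0.
have e1 : e <= 1 by rewrite ge_min lexx.
have eN : e * N <= g - T by rewrite -ler_pdivlMr// ge_min lexx orbT.
have [a1 [x1 [v1 [aa x1x v1v]]]] := H _ e0.
have -> : x' - x1 = d - (x1 - x) by rewrite /d opprB addrA subrK.
move: x1x v1v; set p := x1 - x; set w := v1 - v => pe we.
have -> : v1 = v + w by rewrite subrKC.
rewrite sqr_enormB dotDl !(dotBr d p) => le_T.
have vp : dot v p <= enorm v * e.
  by rewrite (le_trans (dot_le_enorm _ _))// ler_wpM2l// ltW.
have wd : - (e * enorm d) <= dot w d.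
  have := normr_dot_le w d; rewrite ler_norml => /andP[h _].
  have : enorm w * enorm d <= e * enorm d by rewrite ler_wpM2r// ltW.
  by lra.
have wp : dot w p <= e.
  rewrite (le_trans (dot_le_enorm _ _))//.
  have := enorm_ge0 w; have := enorm_ge0 p; nra.
have sp : - (`|sigma| * (e * (enorm d + 1))) <=
    sigma / 2 * (- 2 * dot d p + enorm p ^+ 2).
  have : `|sigma / 2 * (- 2 * dot d p + enorm p ^+ 2)| <=
      `|sigma| * (e * (enorm d + 1)).
    rewrite normrM normrM (ger0_norm (_ : 0 <= 2^-1)) ?invr_ge0//.
    have h1 : `|- 2 * dot d p + enorm p ^+ 2| <= 2 * (e * (enorm d + 1)).
      have := normr_dot_le d p; rewrite !ler_norml => /andP[h1 h2].
      have h3 : enorm d * enorm p <= enorm d * e by rewrite ler_wpM2l// ltW.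
      have p0 := enorm_ge0 p.
      have h4 : enorm p ^+ 2 <= e by nra.
      have h5 : 0 <= enorm p ^+ 2 by exact: sqr_ge0.
      by apply/andP; split; lra.
    by rewrite -mulrA ler_wpM2l//; lra.
  by rewrite ler_norml => /andP[].
have : g - T < e * N by rewrite /g /N; lra.
lra.
Qed.

(* The quadratic lower bound at a regular subgradient comes from letting
   [t] tend to 0 in the convexity inequality between [x] and [x']. *)
Lemma strong_convex_regular_subdiff (U : set 'rV[R]_n) theta (sigma : R) x v x' :
  (forall x, (-oo < theta x)%E) ->
  convex_on U (fun x => theta x - (sigma / 2 * enorm x ^+ 2)%:E)%E ->
  U x -> U x' -> regular_subdiff theta x v ->
  ((fine (theta x) + dot v (x' - x) + sigma / 2 * enorm (x' - x) ^+ 2)%:E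
    <= theta x')%E.
Proof.
move=> tNy cvx Ux Ux' /regular_subdiffP[tfin].
have := tNy x'; case Ex' : (theta x') => [T| |]// _; last by rewrite leey.
have := fineK tfin; set a := fine (theta x) => aE reg.
rewrite lee_fin; set d := x' - x; rewrite leNgt; apply/negP => c0.
set g := _ + _ in c0; have {}c0 : 0 < g - T by rewrite subr_gt0.
have d0 := enorm_ge0 d; have dd0 := sqr_ge0 (enorm d).
pose e := (g - T) / (4 * (enorm d + 1)).
have e0 : 0 < e by rewrite divr_gt0// mulr_gt0//; lra.
have ed : e * enorm d <= (g - T) / 4.
  have eE : e * (4 * (enorm d + 1)) = g - T.
    by rewrite divfK// gt_eqF// mulr_gt0//; lra.
  by nra.
have [r r0 hr] := reg _ e0.
pose sd := `|sigma| * enorm d ^+ 2.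
have sd0 : 0 <= sd by rewrite mulr_ge0.
(* The three bounds keep [t] inside []0, 1[], keep the point within the radius of the subgradient
   inequality, and make the term of order [t] smaller than the assumed gap. *)
pose t := Num.min (1 / 2) (Num.min (r / (enorm d + 1) / 2) ((g - T) / (2 * (sd + 1)))).
have t_gt0 : 0 < t.
  by rewrite !lt_min divr_gt0//= divr_gt0 ?divr_gt0//; [rewrite mulr_gt0//|]; lra.
have t1 : t <= 1 / 2 by rewrite ge_min lexx.
have tr : t * (enorm d + 1) <= r / 2.
  rewrite -ler_pdivlMr; last by lra.
  by rewrite mulrAC !ge_min lexx !orbT.
have tsd : t * (2 * (sd + 1)) <= g - T.
  by rewrite -ler_pdivlMr ?mulr_gt0//; [rewrite !ge_min lexx !orbT|lra].
have t01 : 0 < t < 1 by rewrite t_gt0/=; lra.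
have := cvx _ _ _ Ux Ux' t01.
have -> : (1 - t) *: x + t *: x' = x + t *: d.
  by rewrite /d scalerBl scale1r scalerBr addrAC addrA.
have xtr : enorm (x + t *: d - x) < r.
  rewrite addrAC subrr add0r enormZ gtr0_norm//; nra.
have := hr _ xtr.
have -> : x + t *: d - x = t *: d by rewrite addrAC subrr add0r.
rewrite Ex' -aE dotZr enormZ (gtr0_norm t_gt0).
rewrite -!EFinB -!EFinM -EFinD.
have x'E : enorm x' ^+ 2 = enorm x ^+ 2 + 2 * dot x d + enorm d ^+ 2.
  by rewrite -sqr_enormD /d subrKC.
have xtE : enorm (x + t *: d) ^+ 2 =
    enorm x ^+ 2 + 2 * t * dot x d + t ^+ 2 * enorm d ^+ 2.
  by rewrite sqr_enormD dotZr enormZ exprMn (gtr0_norm t_gt0) mulrA.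
case: (theta (x + t *: d)) => [b| |]//=.
rewrite !lee_fin x'E xtE => h1 h2.
have h3 : t * (g - T) <= t * (e * enorm d + sigma / 2 * t * enorm d ^+ 2).
  by rewrite /g; nra.
have h4 : g - T <= e * enorm d + sigma / 2 * t * enorm d ^+ 2.
  by rewrite -(ler_pM2l t_gt0).
have : sigma * enorm d ^+ 2 <= sd.
  by rewrite ler_wpM2r// ler_norm.
nra.
Qed.

Lemma strong_convex_subdiff (U : set 'rV[R]_n) theta (sigma : R) x v x' :
  (forall x, (-oo < theta x)%E) -> nbhs x U ->
  convex_on U (fun x => theta x - (sigma / 2 * enorm x ^+ 2)%:E)%E ->
  subdiff theta x v -> U x' ->
  ((fine (theta x) + dot v (x' - x) + sigma / 2 * enorm (x' - x) ^+ 2)%:E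
    <= theta x')%E.
Proof.
move=> tNy /nbhs_enormP[r r0 rU] cvx /subdiff_approx[tfin sub] Ux'.
have := tNy x'; case Et : (theta x') => [T| |]// _; last by rewrite leey.
rewrite lee_fin; apply: support_limit => e e0.
have e'0 : 0 < Num.min e r by rewrite lt_min e0.
have [x1 [v1 [x1x v1v reg tx1]]] := sub _ e'0.
move: x1x v1v tx1; rewrite !lt_min => /andP[x1e x1r] /andP[v1e _] /andP[tx1 _].
exists (fine (theta x1)), x1, v1; split=> //.
  by move: tx1; rewrite ltr_norml => /andP[h _]; lra.
have := strong_convex_regular_subdiff tNy cvx (rU _ x1r) Ux' reg.
by rewrite Et lee_fin.
Qed.

End Subgradients.

Lemma convex_enorm_ball (R : realType) (n : nat) (c : 'rV[R]_n) (r : R) :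
  convex_set [set x : 'rV[R]_n | enorm (x - c) < r].
Proof.
move=> x y t; rewrite !inE/= => xr yr.
have -> : conv t x y = (y : 'rV[R]_n) + t%:inum *: ((x : 'rV[R]_n) - y).
  have -> : conv t x y = t%:inum *: (x : 'rV[R]_n) + (1 - t%:inum) *: (y : 'rV[R]_n) by [].
  by apply/rowP => k; rewrite !mxE; ring.
by apply: enorm_segment => //; rewrite ge0 le1.
Qed.

Lemma sqr_enorm_conv (R : realType) (n : nat) (x y : 'rV[R]_n) (t : R) :
  enorm ((1 - t) *: x + t *: y) ^+ 2 =
  (1 - t) * enorm x ^+ 2 + t * enorm y ^+ 2 - t * (1 - t) * enorm (x - y) ^+ 2.
Proof.
by rewrite sqr_enormB sqr_enormD !enormZ !exprMn !real_normK ?num_real// dotZl dotZr; ring.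
Qed.

(** * Suprema of quadratic minorants *)

Section QuadraticEnvelope.
Context {R : realType} {n : nat}.
Variables (G : set ('rV[R]_n * 'rV[R]_n)) (h : 'rV[R]_n -> R) (sigma : R).
Implicit Types (x v : 'rV[R]_n) (p : 'rV[R]_n * 'rV[R]_n).

Definition quad_minorant p x : R :=
  h p.1 + dot p.2 (x - p.1) + sigma / 2 * enorm (x - p.1) ^+ 2.

Definition quad_envelope x : \bar R :=
  ereal_sup [set (quad_minorant p x)%:E | p in G].

Lemma quad_minorant_le p x : G p -> ((quad_minorant p x)%:E <= quad_envelope x)%E.
Proof. by move=> Gp; apply: ereal_sup_ubound; exists p. Qed.

Lemma quad_envelope_gtNy x : G !=set0 -> (-oo < quad_envelope x)%E.
Proof. by case=> p Gp; apply: lt_le_trans (quad_minorant_le x Gp); rewrite ltNyr. Qed.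

(** Re-expansion about another point, used to control a single minorant near [x] in the proof of
    lower semicontinuity. *)
Lemma quad_minorant_shift p x y : quad_minorant p y = quad_minorant p x +
  dot (p.2 + sigma *: (x - p.1)) (y - x) + sigma / 2 * enorm (y - x) ^+ 2.
Proof.
rewrite /quad_minorant.
have -> : y - p.1 = (x - p.1) + (y - x) by rewrite [RHS]addrC addrA subrK.
rewrite (sqr_enormD (x - p.1) (y - x)) (dotDr (x - p.1) (y - x)) (dotDl p.2) dotZl.
by field.
Qed.

Lemma quad_envelope_lsc (U : set 'rV[R]_n) : lsc_on U quad_envelope.
Proof.
move=> x Ux a /ereal_sup_gt[_ [p Gp <-]]; rewrite lte_fin => ap.
apply/nbhs_enormP; set w := p.2 + sigma *: (x - p.1).
have w0 := enorm_ge0 w; have s0 := normr_ge0 sigma.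
pose c := quad_minorant p x - a; have c0 : 0 < c by rewrite subr_gt0.
pose e := Num.min 1 (c / (enorm w + `|sigma| + 1)).
have e0 : 0 < e by rewrite lt_min ltr01 divr_gt0//; lra.
have e1 : e <= 1 by rewrite ge_min lexx.
have ec : e * (enorm w + `|sigma| + 1) <= c.
  by rewrite -ler_pdivlMr; [rewrite ge_min lexx orbT|lra].
exists e => // y yx _; apply: lt_le_trans (quad_minorant_le y Gp).
rewrite lte_fin (quad_minorant_shift p x y) -/w; set d := y - x in yx *.
have := normr_dot_le w d; rewrite ler_norml => /andP[h1 _].
have h2 : enorm w * enorm d <= enorm w * e by rewrite ler_wpM2l// ltW.
have d0 := enorm_ge0 d.
have h3 : `|sigma| * enorm d ^+ 2 <= `|sigma| * e.
  by rewrite ler_wpM2l//; nra.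
have h4 : - (`|sigma| * enorm d ^+ 2) <= sigma * enorm d ^+ 2.
  by rewrite -mulNr ler_wpM2r ?sqr_ge0// lerNl ler_normr lexx orbT.
have h5 : 0 <= `|sigma| * enorm d ^+ 2 by rewrite mulr_ge0 ?sqr_ge0.
rewrite /c in ec; lra.
Qed.

(** All minorants share the quadratic term [sigma / 2], so each satisfies this relation with
    equality, and the supremum keeps the inequality. *)
Lemma quad_envelope_conv x y (t : R) : 0 < t < 1 ->
  (quad_envelope ((1 - t) *: x + t *: y) <= (1 - t)%:E * quad_envelope x
    + t%:E * quad_envelope y
    - (sigma / 2 * (t * (1 - t) * enorm (x - y) ^+ 2))%:E)%E.
Proof.
move=> /andP[t0 t1]; have t1' : 0 < 1 - t by rewrite subr_gt0.
apply: ge_ereal_sup => _ [p Gp <-].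
have := quad_minorant_le x Gp; have := quad_minorant_le y Gp.
have -> : quad_minorant p ((1 - t) *: x + t *: y) =
    (1 - t) * quad_minorant p x + t * quad_minorant p y
    - sigma / 2 * (t * (1 - t) * enorm (x - y) ^+ 2).
  rewrite /quad_minorant.
  have -> : (1 - t) *: x + t *: y - p.1 = (1 - t) *: (x - p.1) + t *: (y - p.1).
    by apply/rowP => k; rewrite !mxE; ring.
  have -> : x - y = (x - p.1) - (y - p.1) by rewrite opprB addrA subrK.
  by rewrite sqr_enorm_conv (dotDr ((1 - t) *: _)) !dotZr; ring.
case: (quad_envelope x) => [X| |]; case: (quad_envelope y) => [Y| |] //=;
  rewrite ?(gt0_muley (x := (1 - t)%:E)) ?(gt0_muley (x := t%:E)) ?lte_fin ?leey//.
rewrite !lee_fin => hY hX.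
have : (1 - t) * quad_minorant p x <= (1 - t) * X by rewrite ler_pM2l.
have : t * quad_minorant p y <= t * Y by rewrite ler_pM2l.
lra.
Qed.

Lemma quad_envelope_convex (U : set 'rV[R]_n) : 0 <= sigma ->
  convex_on U quad_envelope.
Proof.
move=> s0 x y t Ux Uy /[dup] /andP[t0 t1] /(quad_envelope_conv x y) /le_trans; apply.
rewrite -[leRHS]adde0 leeD2l// leeNl oppe0 lee_fin.
apply: mulr_ge0; first by rewrite divr_ge0.
by apply: mulr_ge0; [nra|exact: sqr_ge0].
Qed.

Lemma quad_envelope_strongly_convex (U : set 'rV[R]_n) : G !=set0 ->
  convex_on U (fun x => quad_envelope x - (sigma / 2 * enorm x ^+ 2)%:E)%E.
Proof.
move=> G0 x y t Ux Uy /[dup] /andP[t0 t1] /(quad_envelope_conv x y).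
have t1' : 0 < 1 - t by rewrite subr_gt0.
rewrite sqr_enorm_conv.
have := quad_envelope_gtNy x G0; have := quad_envelope_gtNy y G0.
case: (quad_envelope x) => [X| |]//; case: (quad_envelope y) => [Y| |] //= _ _;
  rewrite ?(gt0_muley (x := (1 - t)%:E)) ?(gt0_muley (x := t%:E)) ?lte_fin ?leey//.
case: (quad_envelope _) => [b| |]//=; rewrite ?leNye//.
by rewrite !lee_fin; lra.
Qed.

End QuadraticEnvelope.

(** * Equivalence of uniform growth and variational convexity *)

Section VariationalConvexity.
Context {R : realType} {n : nat}.
Implicit Types (x v z u : 'rV[R]_n).
Variables (F : set 'rV[R]_n) (h : 'rV[R]_n -> R).
Variables (K : 'rV[R]_n -> 'rV[R]_n -> Prop) (xbar : 'rV[R]_n) (R0 : R).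
Variable f : 'rV[R]_n -> \bar R.
Hypothesis R0_gt0 : 0 < R0.
Hypothesis KF : forall x v, K x v -> F x.
Hypothesis Kbar : K xbar 0.
Hypothesis fT : forall x, F x -> f x = (h x)%:E.
Hypothesis fF : forall x, ~ F x -> f x = +oo%E.
Hypothesis hc : forall x e, enorm (x - xbar) < R0 -> 0 < e ->
  exists2 r, 0 < r & forall x', enorm (x' - x) < r -> `|h x' - h x| < e.
Hypothesis fK : forall x v, enorm (x - xbar) < R0 ->
  regular_subdiff f x v <-> K x v.
Hypothesis argmin : forall r z, 0 < r -> r < R0 ->
  exists2 u, F u /\ enorm (u - xbar) <= r &
    forall u', F u' -> enorm (u' - xbar) <= r ->
      h u + enorm (u - z) ^+ 2 / 2 <= h u' + enorm (u' - z) ^+ 2 / 2.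

(** A quadratic error is eventually below [e] times the distance. This discharges the hypothesis on
    [K] used for the proximal map. *)
Lemma proximal_subgradient x v r : enorm (x - xbar) < R0 -> F x -> 0 < r ->
  (forall x', F x' -> enorm (x' - x) < r ->
    h x + dot v (x' - x) - enorm (x' - x) ^+ 2 / 2 <= h x') -> K x v.
Proof.
move=> xR Fx r0 H; apply/(fK _ xR)/regular_subdiffP; rewrite fT//; split=> // e e0.
exists (Num.min r e) => [|x']; first by rewrite lt_min r0.
rewrite lt_min => /andP[x'r x'e].
have [Fx'|/fF->] := pselect (F x'); last by rewrite leey.
rewrite (fT Fx') lee_fin/=; have := H _ Fx' x'r; have := enorm_ge0 (x' - x).
nra.
Qed.

Let G r : set ('rV[R]_n * 'rV[R]_n) :=
  [set p | [/\ enorm (p.1 - xbar) < r, enorm p.2 < r & K p.1 p.2]].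

Lemma uniform_growth_variational_convexity sigma r : 0 <= sigma -> 0 < r ->
  uniform_growth F h K xbar sigma r ->
  exists U V theta e, variational_convexity_data f xbar 0 U V theta e /\
    convex_on U (fun x => theta x - (sigma / 2 * enorm x ^+ 2)%:E)%E.
Proof.
move=> s0; wlog rR : r / r < R0 => [wl|] r0 gr.
  pose r' := Num.min r R0 / 2.
  have m1 : Num.min r R0 <= r by rewrite ge_min lexx.
  have m2 : Num.min r R0 <= R0 by rewrite ge_min lexx orbT.
  have r'0 : 0 < Num.min r R0 by rewrite lt_min r0.
  apply: (wl r'); rewrite ?/r'; [lra|lra|].
  by move=> x v x' xr vr x'r; apply: gr; lra.
have gr' : uniform_growth F h K xbar (- (1 / 2)) r.
  move=> x v x' xr vr x'r Kxv Fx'; apply: le_trans (gr x v x' xr vr x'r Kxv Fx').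
  rewrite lerD2l ler_wpM2r ?sqr_ge0//; lra.
have [rho rho0 [X [rhor HX _ _]]] :=
  prox_exists R0_gt0 KF Kbar proximal_subgradient argmin r0 gr'.
have Fbar := KF Kbar.
have xbar0 a : 0 < a -> enorm (xbar - xbar) < a by rewrite subrr enorm0.
have v0 a : 0 < a -> enorm (0 : 'rV[R]_n) < a by rewrite enorm0.
pose theta := quad_envelope (G r) h sigma.
have G0 : G r !=set0 by exists (xbar, 0); split => /=; [exact: xbar0|exact: v0|].
have theta_ge x v x' : enorm (x - xbar) < r -> enorm v < r -> K x v ->
    ((h x + dot v (x' - x) + sigma / 2 * enorm (x' - x) ^+ 2)%:E <= theta x')%E.
  by move=> xr vr Kxv; apply: (@quad_minorant_le _ _ (G r) h sigma (x, v)).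
have theta_le x : enorm (x - xbar) < r -> (theta x <= f x)%E.
  move=> xr; have [Fx|/fF->] := pselect (F x); last by rewrite leey.
  rewrite fT//; apply: ge_ereal_sup => _ [[x1 v1] [/= x1r v1r K1] <-].
  by rewrite lee_fin; exact: gr.
(* Limiting subgradients of [f] also give minorants of [theta], as limits of the minorants at nearby
   regular subgradients. *)
have theta_lim x v x' : enorm (x - xbar) < r -> enorm v < r -> subdiff f x v ->
    F x /\ ((h x + dot v (x' - x) + sigma / 2 * enorm (x' - x) ^+ 2)%:E <= theta x')%E.
  move=> xr vr /subdiff_approx[ffin sub].
  have Fx : F x by apply: contrapT => /fF fx; rewrite fx in ffin.
  split=> //; have := quad_envelope_gtNy h sigma x' G0; rewrite -/theta.
  case Et : (theta x') => [T| |]// _; last by rewrite leey.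
  rewrite lee_fin; apply: support_limit => e e0.
  pose e' := Num.min e (Num.min (r - enorm (x - xbar)) (r - enorm v)).
  have e'0 : 0 < e' by rewrite !lt_min e0 !subr_gt0 xr.
  have [x1 [v1 [x1x v1v reg fx1]]] := sub _ e'0.
  move: x1x v1v fx1; rewrite !lt_min => /and3P[x1e x1r _] /and3P[v1e _ v1r].
  move=> /and3P[fx1 _ _].
  have x1r' : enorm (x1 - xbar) < r.
    by have := enorm_dist_trans x x1 xbar; lra.
  have v1r' : enorm v1 < r by have := ler_enorm_dist v1 v; lra.
  have /fK K1 : enorm (x1 - xbar) < R0 by lra.
  have {}K1 : K x1 v1 by apply/K1.
  exists (h x1), x1, v1; split=> //.
    by move: fx1; rewrite (fT (KF K1)) (fT Fx) /= ltr_norml => /andP[h1 _]; lra.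
  by have := theta_ge _ _ x' x1r' v1r' K1; rewrite Et lee_fin.
have theta_eq x v : enorm (x - xbar) < r -> enorm v < r -> subdiff f x v ->
    f x = theta x.
  move=> xr vr sub; apply/eqP; rewrite eq_le theta_le// andbT.
  have [Fx] := theta_lim _ _ x xr vr sub.
  by rewrite subrr dot0r enorm0 expr0n/= mulr0 !addr0 fT.
have theta_strong U : convex_on U (fun x => theta x - (sigma / 2 * enorm x ^+ 2)%:E)%E.
  exact: quad_envelope_strongly_convex.
have [r3 r30 hr3] := hc (xbar0 _ R0_gt0) ltr01.
(* This places [x + v] within [rho / 8], so the proximal point and its residual stay within [r];
   [r3] keeps feasible values below the level [f xbar + 1]. *)
pose r2 := Num.min (rho / 16) r3.
have r20 : 0 < r2 by rewrite lt_min divr_gt0.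
have r2rho : r2 <= rho / 16 by rewrite ge_min lexx.
have r2r3 : r2 <= r3 by rewrite ge_min lexx orbT.
have sub_theta_f x v : enorm (x - xbar) < r2 -> enorm v < r2 ->
    subdiff theta x v -> K x v.
  move=> xr vr sub; have [tfin _] := sub.
  pose z := x + v.
  have zr : enorm (z - xbar) < rho / 8.
    by rewrite /z addrAC (le_lt_trans (ler_enormD _ _))//; lra.
  have zrho : enorm (z - xbar) < rho by lra.
  have [Xz KX _] := HX _ zrho.
  have Xr : enorm (X z - xbar) < r by lra.
  have Vr : enorm (z - X z) < r.
    have := enorm_dist_trans xbar z (X z); rewrite (enorm_distC xbar); lra.
  have h1 := theta_ge _ _ x Xr Vr KX.
  have xr' : enorm (x - xbar) < r by lra.
  have cvx := theta_strong setT.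
  have tNy y : (-oo < theta y)%E by exact: quad_envelope_gtNy.
  have nT : nbhs x setT by apply/nbhs_enormP; exists 1.
  have := strong_convex_subdiff tNy nT cvx sub (x' := X z) I.
  have -> : theta (X z) = (h (X z))%:E.
    rewrite -(fT (KF KX)); apply/esym/(theta_eq _ (z - X z)) => //.
    by apply: regular_subdiff_subdiff; apply/fK => //; lra.
  rewrite lee_fin => h2.
  rewrite -(fineK tfin) lee_fin in h1.
  pose a := x - X z.
  have zE : z - X z = v + a by rewrite /z /a addrAC addrC.
  (* Adding the support inequalities at [X z] and at [x] gives [(1 + sigma) * enorm a ^+ 2 <= 0]. *)
  have a0 : a = 0.
    move: h1 h2; rewrite -(opprB x) -/a enormN zE dotNr dotDl -sqr_enorm => h1 h2.
    have : sigma * enorm a ^+ 2 >= 0 by rewrite mulr_ge0 ?sqr_ge0.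
    have := sqr_ge0 (enorm a) => a0 sa0.
    by apply/eqP; rewrite -enorm_eq0 -sqrf_eq0 eq_le a0 andbT; lra.
  have xX : x = X z by apply/eqP; rewrite -subr_eq0 -/a a0.
  by move: KX; rewrite zE a0 addr0 -xX.
exists [set x | enorm (x - xbar) < r2], [set v | enorm v < r2], theta, 1.
have cball c : convex_set [set x : 'rV[R]_n | enorm (x - c) < r2].
  exact: convex_enorm_ball.
split; last exact: theta_strong.
have r2r : r2 <= r by lra.
have r2R0 : r2 <= R0 by lra.
have Ufin x : enorm (x - xbar) < r2 -> F x -> (f x < f xbar + 1%:E)%E.
  move=> xr Fx; rewrite !fT// -EFinD lte_fin.
  by have := hr3 x (lt_le_trans xr r2r3); rewrite ltr_norml => /andP[_]; lra.
split=> //.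
- split.
  + by apply/nbhs_enormP; exists r2.
  + by apply/nbhs_enormP; exists r2 => // v; rewrite subr0.
  + exact: cball.
  + by have := cball 0; rewrite (_ : [set x | _] = [set v | enorm v < r2])//;
      apply/seteqP; split=> v /=; rewrite subr0.
- split.
  + by move=> x; exact: quad_envelope_gtNy.
  + exact: quad_envelope_lsc.
  + exact: quad_envelope_convex.
  + by move=> x xr; apply: theta_le; exact: lt_le_trans r2r.
- apply/seteqP; split=> -[x v] /= [].
    (* The minorant at [(x, v)] touches [theta] at [x], so [v] is even a regular subgradient of
       [theta]. *)
    move=> [[xr _] vr] sub; split=> //.
    apply: regular_subdiff_subdiff; apply/regular_subdiffP.
    have xr' := lt_le_trans xr r2r; have vr' := lt_le_trans vr r2r.
    have [Fx _] := theta_lim _ _ x xr' vr' sub.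
    rewrite -(theta_eq _ _ xr' vr' sub) (fT Fx); split=> // e e0.
    exists 1 => // x' _; have [_ ] := theta_lim _ _ x' xr' vr' sub.
    apply: le_trans; rewrite lee_fin /=.
    have : 0 <= sigma / 2 * enorm (x' - x) ^+ 2 by rewrite mulr_ge0 ?sqr_ge0 ?divr_ge0.
    by have := mulr_ge0 (ltW e0) (enorm_ge0 (x' - x)); lra.
  move=> [xr vr] sub; have Kxv := sub_theta_f _ _ xr vr sub.
  split; first by split=> //; split=> //; exact: Ufin (KF Kxv).
  by apply: regular_subdiff_subdiff; apply/fK => //; exact: lt_le_trans r2R0.
- move=> [x v] [[[/= xr _] vr] sub].
  by apply: theta_eq sub; exact: lt_le_trans r2r.
Qed.

(** A pair of [K] near the reference lies in the graph of the subdifferential of [theta]; growth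
    holds for [theta], which equals [f] at [x] and minorizes it at [x']. *)
Lemma variational_convexity_uniform_growth (sigma : R) U V theta e :
  variational_convexity_data f xbar 0 U V theta e ->
  convex_on U (fun x => theta x - (sigma / 2 * enorm x ^+ 2)%:E)%E ->
  exists2 r, 0 < r & uniform_growth F h K xbar sigma r.
Proof.
move=> [[nU nV _ _] [tNy _ _ tf] e0 gphE fE] cvx.
have /nbhs_enormP[r1 r10 rU] := nU; have /nbhs_enormP[r2 r20 rV] := nV.
have Fbar := KF Kbar.
have xbarR : enorm (xbar - xbar) < R0 by rewrite subrr enorm0.
have [r3 r30 hr3] := hc xbarR e0.
exists (Num.min (Num.min r1 r2) (Num.min r3 R0)).
  by rewrite !lt_min r10 r20 r30.
move=> x v x'; rewrite !lt_min => /andP[/andP[xr1 _] /andP[xr3 xR0]].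
move=> /andP[/andP[_ vr2] _] /andP[/andP[x'r1 _] _] Kxv Fx'.
have Fx := KF Kxv.
have sub : subdiff f x v by apply: regular_subdiff_subdiff; apply/fK.
have Uex : U x /\ (f x < f xbar + e%:E)%E.
  split; first exact: rU.
  rewrite !fT// -EFinD lte_fin.
  by have := hr3 _ xr3; rewrite ltr_norml => /andP[_]; lra.
have Vv : V v by apply: rV; rewrite subr0.
have mem : ([set x | U x /\ (f x < f xbar + e%:E)%E] `*` V `&` gph (subdiff f)) (x, v) by [].
have := mem; rewrite gphE => -[_ /= subt].
have /= fx := fE _ mem.
have nUx : nbhs x U.
  apply/nbhs_enormP; exists (r1 - enorm (x - xbar)); first by rewrite subr_gt0.
  move=> y yx; apply: rU; have := enorm_dist_trans x y xbar; lra.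
have := strong_convex_subdiff tNy nUx cvx subt (rU _ x'r1).
rewrite -fx (fT Fx) /= => h1; have := le_trans h1 (tf _ (rU _ x'r1)).
by rewrite fT// lee_fin.
Qed.

End VariationalConvexity.

(** * The Hessian of the Lagrangian from growth *)

Section Necessity.
Context {R : realType} {n m s : nat}.
Variables (phi0 : 'rV[R]_n -> R) (phi : 'I_m -> 'rV[R]_n -> R).
Variable J : {set 'I_m}.
Hypothesis sJ : forall i : 'I_m, (s <= i)%N -> i \in J.
Implicit Types (x v w : 'rV[R]_n) (y : 'rV[R]_m).

(** Continuity of both quadratic expressions; it allows the necessary condition to be tested only on
    approximations of [w]. *)
Lemma quad_form_limit (H : 'M[R]_n) (sigma : R) w : 0 <= sigma ->
  (forall e, 0 < e -> exists2 w', enorm (w' - w) <= e &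
    sigma * enorm w' ^+ 2 <= quad_form H w' + e * enorm w' ^+ 2) ->
  sigma * enorm w ^+ 2 <= quad_form H w.
Proof.
move=> s0 HQ; apply/ler_addgt0Pr => eps eps0.
pose C := \sum_i \sum_j `|H i j|.
have C0 : 0 <= C by apply: sumr_ge0 => i _; apply: sumr_ge0.
have W0 := enorm_ge0 w; set W := enorm w in W0 *.
pose N := C * (2 * W + 1) + 2 * sigma * W + (W + 1) ^+ 2.
have CW : 0 <= C * (2 * W + 1) by rewrite mulr_ge0//; lra.
have sW : 0 <= 2 * sigma * W by rewrite !mulr_ge0.
have W1 : 0 < (W + 1) ^+ 2 by rewrite exprn_gt0//; lra.
have N0 : 0 < N by rewrite /N; lra.
pose e := Num.min 1 (eps / N).
have e0 : 0 < e by rewrite lt_min ltr01 divr_gt0.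
have e1 : e <= 1 by rewrite ge_min lexx.
have eN : e * N <= eps by rewrite -ler_pdivlMr// ge_min lexx orbT.
have [w' w'w] := HQ _ e0; have wE : w' = w + (w' - w) by rewrite subrKC.
move: w'w; rewrite wE; set d := w' - w; rewrite [_ + _ - _]addrAC subrr add0r => de.
have d0 := enorm_ge0 d; set D := enorm d in de d0.
have := normr_bilin_le H d w; have := normr_bilin_le H w d.
have := normr_bilin_le H d d; have := normr_dot_le w d.
have wd := ler_enormD w d; have wd0 := enorm_ge0 (w + d).
rewrite quad_formD -/(quad_form H d) -/C -/W -/D !ler_norml.
move=> /andP[h0 _] /andP[_ h1] /andP[_ h2] /andP[_ h3] hq.
have h4 : e * enorm (w + d) ^+ 2 <= e * (W + 1) ^+ 2.
  by rewrite ler_wpM2l ?(ltW e0)// lerXn2r ?nnegrE//; rewrite -/W -/D in wd; lra.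
rewrite sqr_enormD -/W -/D in h4 hq; set DD := D ^+ 2 in h4 hq.
set WD := dot w d in h0 h4 hq.
have h5 : C * (W * D) <= C * (W * e) by rewrite ler_wpM2l// ler_wpM2l.
have h6 : C * (D * D) <= C * e by rewrite ler_wpM2l//; nra.
have h7 : sigma * (W * D) <= sigma * (W * e) by rewrite ler_wpM2l// ler_wpM2l.
have h8 : - (sigma * (W * D)) <= sigma * WD by nra.
have h9 : 0 <= sigma * DD by rewrite mulr_ge0// /DD sqr_ge0.
rewrite /N in eN; lra.
Qed.

(* [w] itself need not be a feasible direction: the constraints in
   [active \ active_pos] are first made inactive by moving along [d], and the
   two feasible curves with directions [d] and [d + w] are compared. *)
Lemma growth_hess_L x y (sigma r : R) :
  regular_point phi0 phi J x -> 0 < r -> 0 <= sigma ->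
  Lambda s phi0 phi x (grad_L phi0 phi x y) y ->
  (forall x1 v1 x2, enorm (x1 - x) < r ->
    enorm (v1 - grad_L phi0 phi x y) < r -> enorm (x2 - x) < r ->
    Lambda s phi0 phi x1 v1 y -> feasible s phi x2 ->
    phi0 x1 + dot v1 (x2 - x1) + sigma / 2 * enorm (x2 - x1) ^+ 2 <= phi0 x2) ->
  forall w, Ssub s phi x y w ->
    sigma * enorm w ^+ 2 <= quad_form (hess_L phi0 phi x y) w.
Proof.
move=> rx r0 s0 L gr w Sw; have [[C0 C] J0 [b [ab b0]]] := rx.
have /(LambdaP _ _ rx)[fx cy _ y_0] := L; have /feasibleP[f1 f2] := fx.
apply: quad_form_limit => // eps eps0.
(* The inward push of constraint [j] is large enough to compensate any increase along [w]; it is 0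
   wherever the value must stay fixed. *)
pose c (j : 'I_m) : R := if (j < s)%N && ~~ (0 < y 0 j) then `|dot (grad (phi j) x) w| else 0.
pose d := - \sum_j c j *: b j.
have ad i : i \in J -> dot (grad (phi i) x) d = - c i.
  move=> iJ; rewrite dotNr dot_sumr (bigD1 i)//= dotZr ab// eqxx mulr1.
  rewrite big1 ?addr0// => j ji.
  have [jJ|jJ] := boolP (j \in J); last by rewrite b0// scaler0 dot0r.
  by rewrite dotZr ab// eq_sym (negPf ji) mulr0.
have actJ i : phi i x = 0 -> i \in J.
  by move=> i0; apply: contraT => /J0; rewrite i0 ltxx.
have aw (i : 'I_m) : phi i x = 0 -> (s <= i)%N || (0 < y 0 i) -> dot (grad (phi i) x) w = 0.
  move=> i0 si; apply: Sw; rewrite !inE i0 eqxx andbT.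
  by move: si; have [_|_] := leqP s i; rewrite ?orbT//= => ->.
have c_0 (i : 'I_m) : (s <= i)%N || (0 < y 0 i) -> c i = 0.
  by rewrite /c; have [_|_] := leqP s i => //= ->.
have c_ge0 i : 0 <= c i by rewrite /c; case: ifP.
have yad i : phi i x = 0 -> y 0 i * dot (grad (phi i) x) d = 0 /\
    y 0 i * dot (grad (phi i) x) (d + w) = 0.
  move=> i0; have iJ := actJ _ i0; rewrite dotDr ad//.
  have [si|si] := boolP ((s <= i)%N || (0 < y 0 i)).
    by rewrite c_0// aw// oppr0 addr0 mulr0.
  move: si; rewrite negb_or -ltnNge -leNgt => /andP[si yi].
  have -> : y 0 i = 0 by apply/eqP; rewrite eq_le yi; exact: cy.
  by rewrite !mul0r.
have d1 (i : 'I_m) : (i < s)%N -> phi i x = 0 -> dot (grad (phi i) x) d <= 0.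
  by move=> _ /actJ iJ; rewrite ad// oppr_le0.
have d2 (i : 'I_m) : (s <= i)%N -> dot (grad (phi i) x) d = 0.
  by move=> si; rewrite ad ?sJ// c_0 ?si// oppr0.
have dw1 (i : 'I_m) : (i < s)%N -> phi i x = 0 -> dot (grad (phi i) x) (d + w) <= 0.
  move=> si i0; rewrite dotDr ad ?actJ//.
  have [yi|yi] := boolP (0 < y 0 i); first by rewrite c_0 ?aw ?yi ?orbT// oppr0 addr0.
  by rewrite /c si yi/= addrC subr_le0 ler_norm.
have dw2 (i : 'I_m) : (s <= i)%N -> dot (grad (phi i) x) (d + w) = 0.
  by move=> si; rewrite dotDr d2// aw ?si ?f2// addr0.
pose Y := \sum_i `|y 0 i|.
have Y0 : 0 <= Y by apply: sumr_ge0.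
pose e := eps / (2 * (1 + Y)).
have Y1 : 0 < 2 * (1 + Y) by rewrite mulr_gt0//; lra.
have e0 : 0 < e by rewrite divr_gt0.
have eE : e * (2 * (1 + Y)) = eps by rewrite divfK// gt_eqF.
have eps2 : 2 * e <= eps by nra.
have rY0 : 0 < r / (2 * (1 + Y)) by rewrite divr_gt0.
have [r0' r00 g0] := grad_continuous C0 rY0.
have [|i|r1 r10 g1] := @finite_radius _ _ (fun i r' => forall x',
    enorm (x' - x) < r' -> enorm (grad (phi i) x' - grad (phi i) x) < r / (2 * (1 + Y))).
- by move=> i q q' q'q h x' x'r; apply: h; exact: lt_le_trans q'q.
- by have [q q0 h] := grad_continuous (C i) rY0; exists q.
have [r2 r20 t0] := C2_taylor2 C0 e0.
have [|i|r3 r30 t1] := @finite_radius _ _ (fun i r => forall x1 x2,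
    enorm (x1 - x) < r -> enorm (x2 - x) < r ->
    `|phi i x2 - phi i x1 - dot (grad (phi i) x1) (x2 - x1)
      - quad_form (hess (phi i) x) (x2 - x1) / 2| <= e * enorm (x2 - x1) ^+ 2).
- move=> i q q' q'q h x1 x2 x1q x2q.
  by apply: h; [exact: lt_le_trans x1q q'q|exact: lt_le_trans x2q q'q].
- by have [q q0 h] := C2_taylor2 (C i) e0; exists q.
have [r4 r40 r4reg] := regular_point_open rx.
pose rr := Num.min (Num.min (Num.min r r0') (Num.min r1 r2)) (Num.min r3 r4).
have rr0 : 0 < rr by rewrite !lt_min r0 r00 r10 r20 r30.
have [ta ta0 Ha] := feasible_curve sJ rx fx d1 d2 e0.
have [tb tb0 Hb] := feasible_curve sJ rx fx dw1 dw2 e0.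
have nd0 := enorm_ge0 d; have ndw0 := enorm_ge0 (d + w).
pose M := enorm d + enorm (d + w) + e + 1.
have M0 : 0 < M by rewrite /M; lra.
pose t := Num.min (Num.min (ta / 2) (tb / 2)) (rr / M / 2).
have t_gt0 : 0 < t by rewrite !lt_min !divr_gt0.
have tta : t < ta.
  rewrite (@le_lt_trans _ _ (ta / 2))// ?ge_min ?lexx//; lra.
have ttb : t < tb.
  rewrite (@le_lt_trans _ _ (tb / 2))// ?ge_min ?lexx ?orbT//; lra.
have tM : t * M < rr.
  have : t * M <= rr / 2.
    by rewrite -ler_pdivlMr// mulrAC !ge_min lexx !orbT.
  by lra.
have [xa [fa xad xaphi]] := Ha _ t_gt0 tta.
have [xb [fb xbd xbphi]] := Hb _ t_gt0 ttb.
have etw : 0 < e * t by rewrite mulr_gt0.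
have near_x u p : enorm (p - x - t *: u) <= e * t -> enorm u <= M - e - 1 ->
    enorm (p - x) < rr.
  move=> pu uM; rewrite -(subrK (t *: u) (p - x)) (le_lt_trans (ler_enormD _ _))//.
  rewrite enormZ (gtr0_norm t_gt0); clear - pu uM tM t_gt0; nra.
have xar : enorm (xa - x) < rr by apply: near_x xad _; rewrite /M; clear - ndw0; lra.
have xbr : enorm (xb - x) < rr by apply: near_x xbd _; rewrite /M; clear - nd0; lra.
(* Complementarity with the same [y] persists at both ends: [xa] keeps [y] as a multiplier, and the
   constraint terms at [xb] vanish. *)
have ya i : y 0 i * phi i xa = 0.
  have [i0|i0] := eqVneq (phi i x) 0.
    by rewrite xaphi ?actJ// i0 add0r mulrCA (yad i i0).1 mulr0.
  by have /eqP := y_0 i; rewrite mulf_eq0 (negPf i0) orbF => /eqP->; rewrite mul0r.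
have yb i : y 0 i * phi i xb = 0.
  have [i0|i0] := eqVneq (phi i x) 0.
    by rewrite xbphi ?actJ// i0 add0r mulrCA (yad i i0).2 mulr0.
  by have /eqP := y_0 i; rewrite mulf_eq0 (negPf i0) orbF => /eqP->; rewrite mul0r.
move: (xar) (xbr); rewrite /rr !lt_min.
move=> /andP[/andP[/andP[ar ar0] /andP[ar1 ar2]] /andP[ar3 ar4]].
move=> /andP[/andP[/andP[br br0] /andP[br1 br2]] /andP[br3 br4]].
pose va := grad phi0 xa + \sum_i y 0 i *: grad (phi i) xa.
have rxa := r4reg _ ar4.
have La : Lambda s phi0 phi xa va y by apply/(LambdaP _ _ rxa); split.
have var : enorm (va - grad_L phi0 phi x y) < r.
  rewrite (regular_grad_LE _ rx) /va opprD addrACA -sumrB.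
  rewrite (le_lt_trans (ler_enormD _ _))//.
  have : enorm (\sum_i (y 0 i *: grad (phi i) xa - y 0 i *: grad (phi i) x)) <=
      Y * (r / (2 * (1 + Y))).
    rewrite (le_trans (ler_enorm_sum _ _ _))// mulr_suml; apply: ler_sum => i _.
    by rewrite -scalerBr enormZ ler_wpM2l// ltW// g1.
  have := g0 _ ar0.
  have : (1 + Y) * (r / (2 * (1 + Y))) = r / 2.
    by field; rewrite gt_eqF// ltr_wpDr.
  by clear - r0; lra.
have := gr _ _ _ ar var br La fb.
set D := xb - xa => gD.
pose E i := phi i xb - phi i xa - dot (grad (phi i) xa) D.
(* Since [y] annihilates all constraint values at [xa] and [xb], the linear constraint terms become
   Taylor remainders. *)
have vaE : dot va D = dot (grad phi0 xa) D - \sum_i y 0 i * E i.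
  rewrite /va dotDl dot_suml; congr (_ + _); rewrite -sumrN; apply: eq_bigr => i _.
  by rewrite /E !mulrBr yb ya subr0 sub0r opprK dotZl.
have := t0 _ _ ar2 br2; rewrite -/D => T0.
have T1 : \sum_i y 0 i * E i <=
    \sum_i (y 0 i * quad_form (hess (phi i) x) D / 2 + `|y 0 i| * (e * enorm D ^+ 2)).
  apply: ler_sum => i _; have := t1 i _ _ ar3 br3; rewrite -/D -/(E i) => h.
  have : `|y 0 i * (E i - quad_form (hess (phi i) x) D / 2)| <=
      `|y 0 i| * (e * enorm D ^+ 2) by rewrite normrM ler_wpM2l.
  by rewrite ler_norml => /andP[_]; rewrite mulrBr lerBlDl mulrA.
rewrite big_split/= -!mulr_suml -/Y in T1.
have QD : sigma * enorm D ^+ 2 <=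
    quad_form (hess_L phi0 phi x y) D + eps * enorm D ^+ 2.
  rewrite quad_form_hess_L// -eE; move: T0; rewrite ler_norml => /andP[_ T0].
  by rewrite vaE in gD; clear - gD T0 T1; lra.
(* The curves have directions [d] and [d + w] up to [e], so this quotient approximates [w]. *)
exists (t^-1 *: D).
  have -> : t^-1 *: D - w = t^-1 *: ((xb - x - t *: (d + w)) - (xa - x - t *: d)).
    have tV : t^-1 * t = 1 by rewrite mulVf// gt_eqF.
    by apply/rowP => k; rewrite /D !mxE; field; rewrite gt_eqF.
  rewrite enormZ gtr0_norm ?invr_gt0// mulrC ler_pdivrMr//.
  rewrite (le_trans (ler_enormB _ _))//.
  have : 2 * e * t <= eps * t by rewrite ler_pM2r.
  by clear - xad xbd; lra.
have tN : 0 <= t^-1 ^+ 2 by exact: sqr_ge0.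
rewrite quad_formZ enormZ exprMn real_normK ?num_real//.
by have := ler_wpM2l tN QD; clear; lra.
Qed.

End Necessity.

(** * The nonlinear program *)

Section LocalProblem.
Context {R : realType} {n m s : nat}.
Variables (phi0 : 'rV[R]_n -> R) (phi : 'I_m -> 'rV[R]_n -> R).
Variables (J : {set 'I_m}) (xbar : 'rV[R]_n) (R0 : R).
Hypothesis sJ : forall i : 'I_m, (s <= i)%N -> i \in J.
Hypothesis R0_gt0 : 0 < R0.
Hypothesis regB : forall x, enorm (x - xbar) < R0 -> regular_point phi0 phi J x.
Hypothesis Lbar : exists y, Lambda s phi0 phi xbar 0 y.
Implicit Types (x v w z u : 'rV[R]_n) (y : 'rV[R]_m).

Let f := essential_objective s phi0 phi.
Let F := feasible s phi.
Let K x v := exists y, Lambda s phi0 phi x v y.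

Let KF x v : K x v -> F x. Proof. by case=> y []. Qed.

Let xbarR : enorm (xbar - xbar) < R0. Proof. by rewrite subrr enorm0. Qed.

Let phi0_continuous x e : enorm (x - xbar) < R0 -> 0 < e ->
  exists2 r, 0 < r & forall x', enorm (x' - x) < r -> `|phi0 x' - phi0 x| < e.
Proof. by move=> /regB[[C0 _] _ _] e0; exact: C2_continuous. Qed.

Let subdiff_Lambda x v : enorm (x - xbar) < R0 -> regular_subdiff f x v <-> K x v.
Proof.
move=> /regB rx; split=> [h|].
  by have [y L] := regular_subdiff_Lambda sJ rx h; exists y.
by case=> y L; exact: Lambda_regular_subdiff rx L.
Qed.

(** Yields local closedness of the feasible set, for existence of proximal points and for lower
    semicontinuity. *)
Lemma infeasible_open x : enorm (x - xbar) < R0 -> ~ feasible s phi x ->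
  exists2 e, 0 < e & forall u, enorm (u - x) < e -> ~ feasible s phi u.
Proof.
move=> xR nF; have [[_ C] _ _] := regB xR.
have [[i [si pi]]|[i [si pi]]] : (exists i : 'I_m, (i < s)%N /\ 0 < phi i x) \/
    (exists i : 'I_m, (s <= i)%N /\ phi i x != 0).
- apply: contrapT => /not_orP[h1 h2]; apply: nF; apply/feasibleP; split=> i si.
    by rewrite leNgt; apply/negP => pi; apply: h1; exists i.
  by apply/eqP; apply: contrapT => /negP pi; apply: h2; exists i.
- have [r r0 hr] := C2_continuous (C i) pi.
  exists r => // u /hr; rewrite ltr_norml => /andP[h _] /feasibleP[/(_ i si) ui _].
  by lra.
- have pi0 : 0 < `|phi i x| by rewrite normr_gt0.
  have [r r0 hr] := C2_continuous (C i) pi0.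
  exists r => // u /hr h /feasibleP[_ /(_ i si) ui].
  by move: h; rewrite ui sub0r normrN ltxx.
Qed.

(** Weierstrass' theorem: the feasible part of the closed ball is compact because the ball lies
    where the constraints are continuous. *)
Lemma prox_argmin r z : 0 < r -> r < R0 ->
  exists2 u, F u /\ enorm (u - xbar) <= r &
    forall u', F u' -> enorm (u' - xbar) <= r ->
      phi0 u + enorm (u - z) ^+ 2 / 2 <= phi0 u' + enorm (u' - z) ^+ 2 / 2.
Proof.
move=> r0 rR; pose A : set 'rV[R]_n := [set u | F u /\ enorm (u - xbar) <= r].
have A0 : A !=set0.
  by exists xbar; split; [have [y [fx]] := Lbar|rewrite subrr enorm0 ltW].
have cA : closed A.
  move=> x clA; have xr : enorm (x - xbar) <= r.
    apply/ler_addgt0Pr => e e0.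
    have /clA[u [[_ ur] /= ux]] : nbhs x [set u | enorm (u - x) < e].
      by apply/nbhs_enormP; exists e.
    have := enorm_dist_trans u x xbar; rewrite (enorm_distC x u); lra.
  split=> //; apply: contrapT => nF.
  have [e e0 he] := infeasible_open (le_lt_trans xr rR) nF.
  have /clA[u [[Fu _] /= /he]] : nbhs x [set u | enorm (u - x) < e].
    by apply/nbhs_enormP; exists e.
  exact.
have kA : compact A.
  have AB : A `<=` [set u | enorm (u - xbar) <= r] by move=> u [].
  exact: (subclosed_compact cA (@compact_enorm_ball _ _ xbar r) AB).
pose q u := phi0 u + enorm (u - z) ^+ 2 / 2.
have cq : {within A, continuous q}.
  apply: continuous_in_subspaceT => u; rewrite inE => -[_ ur].
  apply/continuous_enormP => e e0; have e2 : 0 < e / 2 by rewrite divr_gt0.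
  have [r1 r10 h1] := phi0_continuous (le_lt_trans ur rR) e2.
  have N0 := enorm_ge0 (u - z); set N := enorm (u - z) in N0.
  pose c := Num.min 1 (e / (2 * (N + 1))).
  have c0 : 0 < c by rewrite lt_min ltr01 divr_gt0// mulr_gt0//; lra.
  have c1 : c <= 1 by rewrite ge_min lexx.
  have ce : c * (2 * (N + 1)) <= e.
    by rewrite -ler_pdivlMr ?ge_min ?lexx ?orbT// mulr_gt0//; lra.
  exists (Num.min r1 c) => [|u']; first by rewrite lt_min r10.
  rewrite lt_min => /andP[/h1 + u'c].
  rewrite /q -/N; have -> : u' - z = (u - z) + (u' - u).
    by rewrite [RHS]addrC addrA subrK.
  rewrite (sqr_enormD (u - z) (u' - u)) -/N.
  have := normr_dot_le (u - z) (u' - u); rewrite -/N.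
  move: u'c (enorm_ge0 (u' - u)); set D := enorm (u' - u) => Dc D0.
  have ND : N * D <= N * c by rewrite ler_wpM2l// ltW.
  have DD : D ^+ 2 <= c by nra.
  have DD0 : 0 <= D ^+ 2 by exact: sqr_ge0.
  rewrite !ler_norml !ltr_norml => /andP[a1 a2] /andP[b1 b2].
  by apply/andP; split; lra.
have [u uA uP] := EVT_min_rV A0 kA cq.
move: uA; rewrite inE => uA; exists u => // u' Fu' u'r.
by apply: uP; rewrite inE.
Qed.

Let growth tau r := uniform_growth F phi0 K xbar tau r.

Lemma local_uniform_growth y (sigma tau : R) : Lambda s phi0 phi xbar 0 y ->
  (forall w, Ssub s phi xbar y w ->
    sigma * enorm w ^+ 2 <= quad_form (hess_L phi0 phi xbar y) w) ->
  tau < sigma -> exists2 r, 0 < r & growth tau r.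
Proof.
move=> L HS ts; have [r r0 hr] := local_growth sJ (regB xbarR) L HS ts.
exists r => // x v x' xr vr x'r [y' L'] Fx'.
by apply: hr L' Fx' => //; rewrite subr0.
Qed.

Lemma hess_L_uniform_growth (sigma : R) U V : 0 <= sigma ->
  nbhs xbar U -> nbhs (0 : 'rV[R]_n) V ->
  (forall x v y w, U x -> V v -> Lambda s phi0 phi x v y -> Ssub s phi x y w ->
    sigma * enorm w ^+ 2 <= quad_form (hess_L phi0 phi x y) w) ->
  exists2 r, 0 < r & growth sigma r.
Proof.
move=> s0 /nbhs_enormP[rU rU0 hU] /nbhs_enormP[rV rV0 hV] H.
have [ybar L] := Lbar.
have UB : U xbar by apply: hU; rewrite subrr enorm0.
have V0 : V 0 by apply: hV; rewrite subrr enorm0.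
(* The condition at [(xbar, 0)] alone gives growth with modulus -1/2, which makes the proximal map
   available before the local estimates are joined. *)
have ls : - (1 / 2) < sigma by lra.
have [r r0 gr] := local_uniform_growth L (fun w => H _ _ _ w UB V0 L) ls.
pose r1 := Num.min R0 (Num.min rU rV).
have r10 : 0 < r1 by rewrite !lt_min R0_gt0 rU0.
apply: (growth_extend (R0 := R0) _ _ _ _ _ s0 r0 gr r10) => //.
- apply: (proximal_subgradient (f := f)) => //.
  + exact: essential_objectiveT.
  + exact: essential_objectiveF.
- exact: prox_argmin.
- move=> x v tau; rewrite !lt_min => /and3P[xR xU _] /and3P[_ _ vV] [y Ly] ts.
  have Vv : V v by apply: hV; rewrite subr0.
  have [rho rho0 h] := local_growth sJ (regB xR) Ly
    (fun w => H _ _ _ w (hU _ xU) Vv Ly) ts.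
  exists rho => // x1 v1 x2 x1r v1r x2r [y1 L1] F2.
  exact: h L1 F2.
Qed.

(** Growth around [(xbar, 0)] contains growth around each nearby pair, on the smaller radius [q]. *)
Lemma uniform_growth_hess_L (sigma r : R) : 0 <= sigma -> 0 < r ->
  growth sigma r ->
  exists U V : set 'rV[R]_n, [/\ nbhs xbar U, nbhs (0 : 'rV[R]_n) V &
    forall x v y w, U x -> V v -> Lambda s phi0 phi x v y -> Ssub s phi x y w ->
      sigma * enorm w ^+ 2 <= quad_form (hess_L phi0 phi x y) w].
Proof.
move=> s0 r0 gr; pose r' := Num.min r R0.
have r'0 : 0 < r' by rewrite lt_min r0.
have r'r : r' <= r by rewrite ge_min lexx.
have r'R : r' <= R0 by rewrite ge_min lexx orbT.
exists [set x | enorm (x - xbar) < r'], [set v | enorm v < r'].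
split; [by apply/nbhs_enormP; exists r'| |].
  by apply/nbhs_enormP; exists r' => // v; rewrite subr0.
move=> x v y w /= xr vr L; have [_ _ vE _] := L.
pose q := Num.min (r' - enorm (x - xbar)) (r' - enorm v).
have q0 : 0 < q by rewrite lt_min !subr_gt0 xr.
have qx : q <= r' - enorm (x - xbar) by rewrite ge_min lexx.
have qv : q <= r' - enorm v by rewrite ge_min lexx orbT.
apply: (growth_hess_L sJ (regB (lt_le_trans xr r'R)) q0 s0).
  by rewrite -vE.
move=> x1 v1 x2 x1q v1q x2q L1 F2; rewrite -vE in v1q.
apply: gr => //.
- by have := enorm_dist_trans x x1 xbar; lra.
- by have := ler_enorm_dist v1 v; lra.
- by have := enorm_dist_trans x x2 xbar; lra.
- by exists y.
Qed.

Lemma essential_objective_lsc : exists2 W, nbhs xbar W & lsc_on W f.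
Proof.
exists [set x | enorm (x - xbar) < R0]; first by apply/nbhs_enormP; exists R0.
move=> x /= xR a; rewrite /f; have [Fx|nFx] := pselect (feasible s phi x).
  rewrite (essential_objectiveT _ Fx) lte_fin => ax.
  have ax0 : 0 < phi0 x - a by rewrite subr_gt0.
  have [r r0 hr] := phi0_continuous xR ax0.
  apply/nbhs_enormP; exists r => // u /hr; rewrite ltr_norml => /andP[h _] _.
  have [Fu|nFu] := pselect (feasible s phi u); last first.
    by rewrite (essential_objectiveF _ nFu) ltry.
  by rewrite (essential_objectiveT _ Fu) lte_fin; lra.
move=> _; have [e e0 he] := infeasible_open xR nFx.
apply/nbhs_enormP; exists e => // u /he nFu _.
by rewrite (essential_objectiveF _ nFu) ltry.
Qed.

Lemma strong_variational_sufficiency_growth (sigma : R) : 0 <= sigma ->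
  strong_variational_sufficiency s phi0 phi xbar sigma <->
  exists2 r, 0 < r & growth sigma r.
Proof.
move=> s0; split.
  move=> [_ _ [U [V [theta [e [data cvx]]]]]].
  apply: (variational_convexity_uniform_growth (f := f) (R0 := R0) _ _ _ _ _ _ data cvx) => //.
  by move=> x; exact: essential_objectiveT.
move=> [r r0 gr]; split; first exact: essential_objective_lsc.
  by apply: regular_subdiff_subdiff; apply/subdiff_Lambda.
apply: (uniform_growth_variational_convexity (f := f) (R0 := R0) _ _ _ _ _ _ _ _ s0 r0 gr) => //.
- by move=> x; exact: essential_objectiveT.
- by move=> x; exact: essential_objectiveF.
- exact: prox_argmin.
Qed.

Lemma strong_variational_sufficiency_hess_L (sigma : R) : 0 <= sigma ->
  strong_variational_sufficiency s phi0 phi xbar sigma <->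
  exists U V : set 'rV[R]_n, [/\ nbhs xbar U, nbhs (0 : 'rV[R]_n) V &
    forall x v y w, U x -> V v -> Lambda s phi0 phi x v y -> Ssub s phi x y w ->
      sigma * enorm w ^+ 2 <= quad_form (hess_L phi0 phi x y) w].
Proof.
move=> s0; split.
  move=> /(strong_variational_sufficiency_growth s0)[r r0 gr].
  exact: uniform_growth_hess_L gr.
move=> [U [V [nU nV H]]]; apply/(strong_variational_sufficiency_growth s0).
exact: hess_L_uniform_growth nU nV H.
Qed.

End LocalProblem.

(** * Modulus zero, positivity on a subspace, and the three equivalences *)

Lemma strong_variational_sufficiency0 (R : realType) (n m s : nat)
    (phi0 : 'rV[R]_n -> R) (phi : 'I_m -> 'rV[R]_n -> R) (x : 'rV[R]_n) :
  variational_sufficiency s phi0 phi x <->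
  strong_variational_sufficiency s phi0 phi x 0.
Proof.
have th0 (theta : 'rV[R]_n -> \bar R) :
    (fun x => theta x - (0 / 2 * enorm x ^+ 2)%:E)%E = theta.
  by apply/funext => u; rewrite mul0r mul0r sube0.
split=> -[lsc sub [U [V [theta [e D]]]]]; split=> //;
  exists U, V, theta, e; last by case: D.
by split=> //; rewrite th0; case: D => _ [].
Qed.

(** The quadratic form attains a positive minimum on the compact unit sphere of the subspace;
    homogeneity does the rest. *)
Lemma positive_on_subspace (R : realType) (n m : nat) (P : {set 'I_m})
    (a : 'I_m -> 'rV[R]_n) (H : 'M[R]_n) :
  (forall w, (forall i, i \in P -> dot (a i) w = 0) -> w != 0 ->
    0 < quad_form H w) ->
  exists2 sigma, 0 < sigma & forall w, (forall i, i \in P -> dot (a i) w = 0) ->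
    sigma * enorm w ^+ 2 <= quad_form H w.
Proof.
move=> HP; pose S := [set w : 'rV[R]_n | forall i, i \in P -> dot (a i) w = 0].
pose A : set 'rV[R]_n := S `&` [set w | enorm w = 1].
have SZ c w : S w -> S (c *: w) by move=> Sw i iP; rewrite dotZr Sw// mulr0.
have normal w : S w -> w != 0 -> A ((enorm w)^-1 *: w).
  move=> Sw w0; split; first exact: SZ.
  by rewrite /= enormZ gtr0_norm ?invr_gt0 ?enorm_gt0// mulVf// enorm_eq0.
(* An empty sphere means that the subspace is trivial, and any positive constant works. *)
have [A0|/set0P A0] := eqVneq A set0.
  exists 1 => // w Sw; have [->|w0] := eqVneq w 0.
    by rewrite enorm0 expr0n mulr0 /quad_form dot0r.
  by have := normal _ Sw w0; rewrite A0.
have cq : continuous (quad_form H).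
  move=> w; apply/continuous_enormP => e e0.
  pose C := \sum_i \sum_j `|H i j|.
  have C0 : 0 <= C by apply: sumr_ge0 => i _; apply: sumr_ge0.
  have W0 := enorm_ge0 w.
  pose N := C * (2 * enorm w + 1) + 1.
  have N0 : 0 < N by rewrite /N ltr_wpDl// mulr_ge0//; lra.
  pose c := Num.min 1 (e / N).
  have c0 : 0 < c by rewrite lt_min ltr01 divr_gt0.
  have c1 : c <= 1 by rewrite ge_min lexx.
  have ce : c * N <= e by rewrite -ler_pdivlMr// ge_min lexx orbT.
  exists c => // w' w'c.
  have {1}-> : w' = w + (w' - w) by rewrite subrKC.
  move: w'c; set d := w' - w => dc; have d0 := enorm_ge0 d.
  have := normr_bilin_le H d w; have := normr_bilin_le H w d.
  have := normr_bilin_le H d d; rewrite quad_formD -/(quad_form H d) -/C.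
  have h1 : C * (enorm w * enorm d) <= C * (enorm w * c).
    by rewrite ler_wpM2l// ler_wpM2l// ltW.
  have h2 : C * (enorm d * enorm d) <= C * c by rewrite ler_wpM2l//; nra.
  rewrite /N in ce.
  rewrite !ler_norml ltr_norml => /andP[a1 a2] /andP[b1 b2] /andP[e1' e2].
  by apply/andP; split; lra.
have clS : closed S.
  have -> : S = \bigcap_(i in [set i | i \in P]) (dot (a i) @^-1` [set 0]).
    by apply/seteqP; split=> w /= Sw i; [move/Sw|move=> iP; exact: Sw].
  apply: closed_bigI => i _.
  exact: (iffLR (continuous_closedP _) (@dot_continuousr _ _ (a i)) _ (@closed_eq R 0)).
have kA : compact A.
  have AB : A `<=` [set w | enorm (w - 0) <= 1].
    by move=> w [_ /= w1]; rewrite /= subr0 w1.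
  have clA : closed A.
    apply: closedI => //.
    have -> : [set w : 'rV[R]_n | enorm w = 1] = (fun w => enorm (w - 0)) @^-1` [set 1].
      by apply/seteqP; split=> w /=; rewrite subr0.
    exact: (iffLR (continuous_closedP _) (@continuous_enorm_dist _ _ 0) _ (@closed_eq R 1)).
  exact: (subclosed_compact clA (@compact_enorm_ball _ _ 0 1) AB).
have [w0 w0A w0P] := EVT_min_rV A0 kA (continuous_subspaceT cq).
move: w0A; rewrite inE => -[Sw0 /= w01].
exists (quad_form H w0).
  by apply: HP => //; rewrite -enorm_eq0 w01 oner_eq0.
move=> w Sw; have [->|wN] := eqVneq w 0.
  by rewrite enorm0 expr0n mulr0 /quad_form dot0r.
have wA := normal _ Sw wN.
have := w0P ((enorm w)^-1 *: w); rewrite inE => /(_ wA).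
have W0 : 0 < enorm w by rewrite enorm_gt0.
rewrite quad_formZ exprVn ler_pdivlMl ?exprn_gt0// mulrC.
exact.
Qed.

Theorem theorem7p3 (R : realType) (n m s : nat) (hs : (s <= m)%N)
    (phi0 : 'rV[R]_n -> R) (phi : 'I_m -> 'rV[R]_n -> R) (xbar : 'rV[R]_n)
    (hphi0 : C2_around phi0 xbar)
    (hphi : forall i : 'I_m, C2_around (phi i) xbar)
    (hfeas : feasible s phi xbar)
    (hKKT : exists ybar : 'rV[R]_m, [/\ multiplier_cone s ybar,
        grad_L phi0 phi xbar ybar = 0 & dot ybar (gmap phi xbar) = 0])
    (hLICQ : LICQ s phi xbar) :
  [/\ (* (i) *)
      (\forall x \near xbar & v \near (0 : 'rV[R]_n),
         forall y y' : 'rV[R]_m, Lambda s phi0 phi x v y ->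
           Lambda s phi0 phi x v y' -> y = y') /\
      (variational_sufficiency s phi0 phi xbar <->
       exists U V : set 'rV[R]_n, [/\ nbhs xbar U, nbhs (0 : 'rV[R]_n) V &
         forall x v y w, U x -> V v -> Lambda s phi0 phi x v y ->
           Ssub s phi x y w -> 0 <= quad_form (hess_L phi0 phi x y) w]),
      (* (ii) *)
      (forall sigma : R, 0 < sigma ->
       (strong_variational_sufficiency s phi0 phi xbar sigma <->
        exists U V : set 'rV[R]_n, [/\ nbhs xbar U, nbhs (0 : 'rV[R]_n) V &
          forall x v y w, U x -> V v -> Lambda s phi0 phi x v y ->
            Ssub s phi x y w ->
            sigma * enorm w ^+ 2 <= quad_form (hess_L phi0 phi x y) w]))
    & (* (iii) *)
      (exists! ybar : 'rV[R]_m, Lambda s phi0 phi xbar 0 ybar) /\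
      ((exists2 sigma : R, 0 < sigma &
          strong_variational_sufficiency s phi0 phi xbar sigma) <->
       (forall ybar w, Lambda s phi0 phi xbar 0 ybar ->
          Ssub s phi xbar ybar w -> w != 0 ->
          0 < quad_form (hess_L phi0 phi xbar ybar) w))].
Proof.
(* The index set is frozen at [xbar]; nearby feasible points can only have fewer active
   constraints. *)
pose J := (active s phi xbar :|: equality_idx m s)%SET.
have sJ (i : 'I_m) : (s <= i)%N -> i \in J by move=> si; rewrite !inE si orbT.
have /feasibleP[f1 f2] := hfeas.
have rxbar : regular_point phi0 phi J xbar.
  split=> //; last exact: free_dual_system hLICQ.
  move=> i; rewrite !inE negb_or negb_and -leqNgt => /andP[/orP[h|pi] si].
    by rewrite h in si.
  by rewrite lt_neqAle pi f1// ltnNge.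
have [R0 R00 regB] := regular_point_open rxbar.
have Lbar : exists y, Lambda s phi0 phi xbar 0 y.
  by have [y [cy gy y0]] := hKKT; exists y; split.
have xR : enorm (xbar - xbar) < R0 by rewrite subrr enorm0.
(* One equivalence for all [sigma >= 0] covers (i), with [sigma = 0], and (ii). *)
have VS := strong_variational_sufficiency_hess_L sJ R00 regB Lbar.
split.
- split.
    exists ([set x | enorm (x - xbar) < R0], setT).
      by split; [apply/nbhs_enormP; exists R0|exact: filterT].
    by move=> [x v] [/= xr _] y y' Ly Ly'; exact: Lambda_unique (regB _ xr) Ly Ly'.
  apply: (iff_trans (strong_variational_sufficiency0 _ _ _ _)).
  apply: (iff_trans (VS 0 (lexx 0))).
  split=> -[U [V [nU nV H]]]; exists U, V; split=> // x v y w Ux Vv Ly Sw.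
    by have := H x v y w Ux Vv Ly Sw; rewrite mul0r.
  by rewrite mul0r; exact: H Ux Vv Ly Sw.
- by move=> sigma s0; exact: VS sigma (ltW s0).
- split.
    have [y Ly] := Lbar; exists y; split=> // y' Ly'.
    exact: Lambda_unique (regB _ xR) Ly Ly'.
  split.
    move=> [sigma s0 /(VS _ (ltW s0))[U [V [nU nV H]]]] y w Ly Sw w0.
    apply: lt_le_trans (H _ _ _ _ (nbhs_singleton nU) (nbhs_singleton nV) Ly Sw).
    by rewrite mulr_gt0// exprn_gt0// enorm_gt0.
  move=> H; have [y Ly] := Lbar.
  have [sigma s0 Hs] := positive_on_subspace (fun w Sw w0 => H y w Ly Sw w0).
  (* The condition at the single point [xbar] gives uniform growth only for moduli strictly below
     [sigma]. *)
  have s20 : 0 < sigma / 2 by rewrite divr_gt0.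
  exists (sigma / 2) => //.
  apply/(strong_variational_sufficiency_growth sJ R00 regB Lbar (ltW s20)).
  by apply: (local_uniform_growth sJ R00 regB Ly Hs); lra.
Qed.
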